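(* Let $k$ be a field of characteristic $0$, let $X=\{x_1,\dots,x_n\}$ be a finite set of variables, and let $I$ be a monomial ideal in the polynomial ring $S=k[x_1,\dots,x_n]$. Let $H$ be the Hilbert scheme parametrizing the graded ideals of $S$ with the same Hilbert function as $I$, and let $GL(n)=GL_n(k)$ act on $H$ by linear coordinate changes. Then $I$ is a most degenerate ideal, i.e. the $GL(n)$-orbit of the point of $H$ corresponding to $I$ is Zariski closed in $H$, if and only if the preorder $\le_I$ on $X$ associated to $I$ is a total preorder.
   Context: Grading: $S=k[x_1,\dots,x_n]$ has the standard grading with $\deg x_i=1$ and graded pieces $S_d$. A graded ideal is an ideal generated by homogeneous polynomials, with graded pieces $I_d=I\cap S_d$; its Hilbert function is $d\mapsto \dim_k I_d$. A monomial ideal is an ideal generated by monomials. Preorder associated to a monomial ideal: for a monomial ideal $I\subseteq k[X]$ define a relation $\le_I$ on $X$ by: $x\le_I y$ if for every monomial $m$ in $k[X]$, $xm\in I$ implies $ym\in I$. This relation is reflexive and transitive, i.e. a preorder. A preorder $\le$ on $X$ is total if for any $a,b\in X$, $a\le b$ or $b\le a$ (or both). Hilbert scheme: for a fixed function $h:\mathbb{N}\to\mathbb{N}$, let $H=H_h$ be the set of graded ideals $J\subseteq S$ with $\dim_k J_d=h(d)$ for all $d$. It is given the structure of an algebraic set (with its Zariski topology) via the injection $J\mapsto (J_d)_{0\le d\le D}\in\prod_{d=0}^{D}\mathrm{Gr}(h(d),S_d)$ into a product of Grassmannians of subspaces, for any sufficiently large $D$. Each point $p\in H$ thus corresponds to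 a graded ideal $I_p$. Group action: $g\in GL(n)$ acts on $S$ by the linear change of coordinates on the space $S_1$ spanned by $x_1,\dots,x_n$, extended to a $k$-algebra automorphism of $S$. It sends a graded ideal $J$ to the graded ideal $g.J$, which has the same Hilbert function. This defines the action on $H$: $g.p=q$ where $I_q=g.I_p$. Most degenerate: a graded ideal $I_p$ is called most degenerate (it cannot be degenerated further) if the orbit $\{g.p : g\in GL(n)\}$ is closed in $H$. *)

(* Defs.v *)
From HB Require Import structures.
From mathcomp Require Import all_boot all_order all_algebra.
From mathcomp Require Import boolp classical_sets.
From mathcomp Require Import mpoly.

Set Implicit Arguments.
Unset Strict Implicit.
Unset Printing Implicit Defensive.

Import GRing.Theory.
Local Open Scope ring_scope.
Local Open Scope classical_set_scope.

Definition mon (n d : nat) := {m : 'X_{1..n < d.+1} | mdeg m == d}.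

Definition mnm_of_mon n d (m : mon n d) : 'X_{1..n} := bmnm (val m).

(* An alias of [dhomog], which the library makes a [vectType] only for n > 0. *)
Definition hpoly (n : nat) (k : fieldType) (d : nat) := dhomog n k d.

HB.instance Definition _ n k d := GRing.Lmodule.on (hpoly n k d).
HB.instance Definition _ n k d := SubChoice.on (hpoly n k d).

Coercion mpoly_of_hpoly n k d (p : hpoly n k d) : {mpoly k[n]} :=
  mpoly_of_dhomog p.

Section HpolyVector.
Variables (n : nat) (k : fieldType) (d : nat).

Let to_row (p : hpoly n k d) : 'rV[k]_#|{: mon n d}| :=
  \row_i p@_(mnm_of_mon (enum_val i)).

Lemma hpoly_vecaxiom : Vector.axiom #|{: mon n d}| (hpoly n k d).
Proof.
exists to_row => [a p q|].
  by apply/rowP => i; rewrite !mxE; exact: (linearP (mcoeff _)).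
pose g (r : 'rV[k]_#|{: mon n d}|) : {mpoly k[n]} :=
  \sum_(m : mon n d) r ord0 (enum_rank m) *: 'X_[mnm_of_mon m].
have gh r : g r \is d.-homog.
  apply: rpred_sum => m _; apply: rpredZ; rewrite dhomogX; exact: (valP m).
have gc r (m : mon n d) : (g r)@_(mnm_of_mon m) = r ord0 (enum_rank m).
  rewrite /g linear_sum (bigD1 m) //= mcoeffZ mcoeffX eqxx mulr1.
  rewrite big1 ?addr0 // => m' ne; rewrite mcoeffZ mcoeffX.
  case: eqP => [/val_inj/val_inj e|]; last by rewrite mulr0.
  by rewrite e eqxx in ne.
exists (fun r => DHomog (gh r) : hpoly n k d) => [p|r].
  apply/val_inj/mpolyP => m /=.
  case: (eqVneq (mdeg m) d) => [e|ne]; last first.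
    rewrite (dhomog_nemf_coeff (gh _) ne).
    by rewrite (dhomog_nemf_coeff (valP p) ne).
  have lt_m : (mdeg m < d.+1)%N by rewrite e.
  have em : mdeg (BMultinom lt_m) == d by rewrite e.
  by have := gc (to_row p) (Sub (BMultinom lt_m) em); rewrite mxE enum_rankK.
by apply/rowP => i; rewrite mxE [LHS]gc enum_valK.
Qed.

HB.instance Definition _ :=
  Lmodule_hasFinDim.Build k (hpoly n k d) hpoly_vecaxiom.

End HpolyVector.

Definition total_preorder (T : Type) (le : T -> T -> Prop) : Prop :=
  [/\ forall x, le x x, forall x y z, le x y -> le y z -> le x z
    & forall x y, le x y \/ le y x].

Section Ideals.
Variables (n : nat) (k : fieldType).
Implicit Types (J : set {mpoly k[n]}) (p q : {mpoly k[n]}).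

Definition is_ideal J : Prop :=
  [/\ J 0, forall p q, J p -> J q -> J (p + q) & forall p q, J q -> J (p * q)].

Definition ideal_gen (A : set {mpoly k[n]}) : set {mpoly k[n]} :=
  smallest is_ideal A.

Definition monomial_ideal J : Prop :=
  exists A : set 'X_{1..n}, J = ideal_gen [set 'X_[m] | m in A].

Definition graded_ideal J : Prop :=
  exists A : set {mpoly k[n]},
    (forall p, A p -> p \is homog mdeg) /\ J = ideal_gen A.

(* J_d = J `&` S_d. A subspace with this property exists, and is unique, as
   soon as J is an ideal: see [mem_gpiece]. *)
Definition gpiece J (d : nat) : {vspace hpoly n k d} :=
  xget 0%VS [set U | forall p : hpoly n k d, p \in U <-> J p].

Lemma mem_gpiece J d : is_ideal J ->
  forall p : hpoly n k d, p \in gpiece J d <-> J p.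
Proof.
move=> [J0 JD JM].
suff [U hU] : exists U : {vspace hpoly n k d}, forall p : hpoly n k d, p \in U <-> J p.
  rewrite /gpiece; exact: (@xgetPex _ 0%VS
    [set U | forall p : hpoly n k d, p \in U <-> J p] (ex_intro _ U hU)).
pose P i := `[< exists U : {vspace hpoly n k d},
   \dim U = i /\ forall p : hpoly n k d, p \in U -> J p >].
have P0 : exists i, P i.
  exists 0%N; apply/asboolP; exists 0%VS; split; first by rewrite dimv0.
  by move=> p; rewrite memv0 => /eqP ->.
have ub i : P i -> (i <= \dim {:hpoly n k d})%N.
  by move=> /asboolP[U [<- _]]; rewrite dimvS ?subvf.
case: (ex_maxnP P0 ub) => i /asboolP[U [dU JU]] maxU.
exists U => p; split; first exact: JU.
move=> Jp; have PU : P (\dim (U + <[p]>)).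
  apply/asboolP; exists (U + <[p]>)%VS; split=> // q.
  case/memv_addP => u uU [v /vlineP[c ->] ->].
  apply: (JD u (c *: p)); first exact: JU.
  by rewrite -[X in J X]/(c *: (p : {mpoly k[n]})) -mul_mpolyC; apply: JM.
have := maxU _ PU; rewrite -dU => le.
have /eqP -> : U == (U + <[p]>)%VS by rewrite eqEdim addvSl.
by apply: (subvP (addvSr U <[p]>%VS)); exact: memv_line.
Qed.

Definition hilbert J (d : nat) : nat := \dim (gpiece J d).

Definition ideal_le J (i j : 'I_n) : Prop :=
  forall m : 'X_{1..n}, J ('X_i * 'X_[m]) -> J ('X_j * 'X_[m]).

(* g . x_j = \sum_i g_ij x_i: the columns of g are the images of the variables,
   so that (g h) . p = g . (h . p). *)
Definition lin_subst (g : 'M[k]_n) p : {mpoly k[n]} :=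
  p \mPo [tuple \sum_i g i j *: 'X_i | j < n].

Definition GL_orbit J : set (set {mpoly k[n]}) :=
  [set lin_subst g @` J | g in [set g : 'M[k]_n | g \in unitmx]].

End Ideals.

Section HilbertScheme.
Variables (n : nat) (k : fieldType) (h : nat -> nat).

Definition hilb_scheme : set (set {mpoly k[n]}) :=
  [set J | graded_ideal J /\ forall d, hilbert J d = h d].

(* Plücker coordinates of a point of Gr(r, S_d): the maximal minors of the
   matrix of coefficients of a basis, one for each choice of r columns. All
   functions from 'I_r to the monomials are allowed as indices rather than the
   increasing ones only; the additional coordinates are 0 or repeat the usual
   ones up to sign. *)
Definition plucker d (r : nat) (U : {vspace hpoly n k d})
    (f : {ffun 'I_r -> mon n d}) : k :=
  \det (\matrix_(i < r, j < r) ((vbasis U)`_i : hpoly n k d)@_(mnm_of_mon (f j))).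

Definition plucker_index (D : nat) :=
  {d : 'I_D.+1 & {ffun 'I_(h d) -> mon n d}}.

Definition plucker_ring (D : nat) := {mpoly k[#|{: plucker_index D}|]}.

Definition plucker_var D (a : 'I_#|{: plucker_index D}|) : plucker_index D :=
  enum_val a.

Definition plucker_eval D (F : plucker_ring D) (J : set {mpoly k[n]}) : k :=
  F.@[fun a => let u := plucker_var a in plucker (gpiece J (tag u)) (tagged u)].

Definition multihomogeneous D (F : plucker_ring D) : Prop :=
  exists e : 'I_D.+1 -> nat, forall m, m \in msupp F ->
    forall d, (\sum_(a | tag (plucker_var a) == d) m a)%N = e d.

(* The Zariski topology induced by J |-> (J_d)_(d <= D), each Grassmannian
   being embedded in a projective space by its Plücker coordinates: the closed
   sets are the zero loci of multihomogeneous polynomials. *)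
Definition zariski_closed_at (D : nat) (Z : set (set {mpoly k[n]})) : Prop :=
  exists E : set (plucker_ring D),
    (forall F, E F -> multihomogeneous F) /\
    Z = [set J | hilb_scheme J /\ forall F, E F -> plucker_eval F J = 0].

Definition zariski_closed (Z : set (set {mpoly k[n]})) : Prop :=
  exists D0 : nat, forall D, (D0 <= D)%N -> zariski_closed_at D Z.

End HilbertScheme.

Definition most_degenerate n (k : fieldType) (J : set {mpoly k[n]}) : Prop :=
  zariski_closed (hilbert J) (GL_orbit J).

(* Main.v *)
(** The reverse implication.  If the preorder is total, choose rho with
    x_i <= x_j iff rho i <= rho j.  The stabilizer of I contains the parabolic
    group P of the matrices that only replace variables by larger or equivalent
    ones, and U P is dense in the matrix algebra for the opposite unipotent
    group U.  On the open chart where the Plücker coordinates indexed by the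
    monomials of I do not vanish, the entries of u are polynomial functions of
    the coordinates of u I (characteristic 0 makes the linear terms nonzero),
    so that the orbit is closed in the chart.  Every point J of the closure of
    the orbit has a translate in the chart: otherwise the Plücker vector of some
    J_d would belong to L and be orthogonal to L, where L is the span of the
    Plücker vectors of the g I_d, for the form induced by <X^a, X^b> = a! [a = b].
    But L has an integral basis, on which this form is positive definite.
    All points constructed in this way are rational over k, which need not be
    algebraically closed.

    The direct implication.  For p < q, replace the part of a monomial ideal B
    on each line { m x_q^a x_p^(e-a) } by an initial segment of the same size.
    Invertibility of binomial matrices in characteristic 0 shows that the
    resulting ideal is a limit of ideals g B, hence it belongs to a closed
    orbit if B does.  As this decreases a weight, a closed orbit contains
    for every d a monomial ideal g I that is strongly stable in degrees <= d.
    Then the derivations preserving I contain a conjugate of the upper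
    triangular matrices, whose invariant subspaces form a chain; the span of the
    variables above x_i is invariant for every i, so x_i and x_j are comparable. *)

From HB Require Import structures.
Require Import Defs.
From mathcomp Require Import all_boot all_order all_algebra all_fingroup.
From mathcomp Require Import boolp classical_sets.
From mathcomp Require Import mpoly.

Set Implicit Arguments.
Unset Strict Implicit.
Unset Printing Implicit Defensive.

Import GRing.Theory.
Local Open Scope ring_scope.
Local Open Scope classical_set_scope.

(** * Polynomial functions *)

(** Polynomiality is obtained by closure: a class of functions that contains 1 and is stable under
    differences and products contains determinants and coefficients of linear substitutions. The
    classes used are the functions polynomial on lines, the integer-valued ones and the regular ones
    on the chart.

    The form of the overview is the right one because <g p, q> = <p, g^T q>: the coordinate of g J
    at the monomials of I is, up to a scalar, the pairing of J with g^T I. Over k positivity is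
    lost, since -1 may be a square, so nondegeneracy on L must come from a Gram determinant that is
    a nonzero integer.

    In the direct implication d is independent of the D at which closedness is used. A total weight
    can be minimized only over finitely many degrees; this is enough, as two monomials witness that
    two variables are incomparable. *)

Definition fun_subring (T : Type) (R : comNzRingType) (P : (T -> R) -> Prop) :=
  [/\ P (fun=> 1), forall f g, P f -> P g -> P (fun x => f x - g x)
    & forall f g, P f -> P g -> P (fun x => f x * g x)].

Section FunSubring.
Variables (T : Type) (R : comNzRingType) (P : (T -> R) -> Prop).
Hypothesis subP : fun_subring P.
Implicit Types f g : T -> R.

Lemma fun_subring_ext f g : f =1 g -> P f -> P g.
Proof. by move=> /funext ->. Qed.

Lemma fun_subring1 : P (fun=> 1). Proof. by case: subP. Qed.

Lemma fun_subringB f g : P f -> P g -> P (fun x => f x - g x).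
Proof. by case: subP => _ + _; apply. Qed.

Lemma fun_subringM f g : P f -> P g -> P (fun x => f x * g x).
Proof. by case: subP => _ _; apply. Qed.

Lemma fun_subring0 : P (fun=> 0).
Proof.
apply: fun_subring_ext (fun_subringB fun_subring1 fun_subring1) => x.
exact: subrr.
Qed.

Lemma fun_subringN f : P f -> P (fun x => - f x).
Proof.
move=> Pf; apply: fun_subring_ext (fun_subringB fun_subring0 Pf) => x.
exact: sub0r.
Qed.

Lemma fun_subringD f g : P f -> P g -> P (fun x => f x + g x).
Proof.
move=> Pf Pg; apply: fun_subring_ext (fun_subringB Pf (fun_subringN Pg)) => x.
by rewrite opprK.
Qed.

Lemma fun_subring_sum I (r : seq I) (Q : pred I) (F : I -> T -> R) :
  (forall i, Q i -> P (F i)) -> P (fun x => \sum_(i <- r | Q i) F i x).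
Proof.
move=> PF; elim: r => [|i r IH].
  by apply: fun_subring_ext fun_subring0 => x; rewrite big_nil.
case: (boolP (Q i)) => Qi.
  apply: fun_subring_ext (fun_subringD (PF i Qi) IH) => x.
  by rewrite big_cons Qi.
by apply: fun_subring_ext IH => x; rewrite big_cons (negPf Qi).
Qed.

Lemma fun_subring_prod I (r : seq I) (Q : pred I) (F : I -> T -> R) :
  (forall i, Q i -> P (F i)) -> P (fun x => \prod_(i <- r | Q i) F i x).
Proof.
move=> PF; elim: r => [|i r IH].
  by apply: fun_subring_ext fun_subring1 => x; rewrite big_nil.
case: (boolP (Q i)) => Qi.
  apply: fun_subring_ext (fun_subringM (PF i Qi) IH) => x.
  by rewrite big_cons Qi.
by apply: fun_subring_ext IH => x; rewrite big_cons (negPf Qi).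
Qed.

Lemma fun_subringX f e : P f -> P (fun x => f x ^+ e).
Proof.
move=> Pf; elim: e => [|e IH].
  by apply: fun_subring_ext fun_subring1 => x; rewrite expr0.
by apply: fun_subring_ext (fun_subringM Pf IH) => x; rewrite exprS.
Qed.

Lemma fun_subring_nat (i : nat) : P (fun=> i%:R).
Proof.
elim: i => [|i IH]; first exact: fun_subring0.
by apply: fun_subring_ext (fun_subringD fun_subring1 IH) => x; rewrite -natr1 addrC.
Qed.

Lemma fun_subring_det r (A : T -> 'M[R]_r) :
  (forall i j, P (fun x => A x i j)) -> P (fun x => \det (A x)).
Proof.
move=> PA; apply: fun_subring_sum => s _; apply: fun_subringM.
  apply: fun_subringX; apply: fun_subringN; exact: fun_subring1.
by apply: fun_subring_prod.
Qed.

Lemma fun_subring_mpolyM n (F G : T -> {mpoly R[n]}) :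
  (forall m, P (fun x => (F x)@_m)) -> (forall m, P (fun x => (G x)@_m)) ->
  forall m, P (fun x => (F x * G x)@_m).
Proof.
move=> PF PG m.
apply: (@fun_subring_ext (fun x => \sum_(k : 'X_{1..n < (mdeg m).+1, (mdeg m).+1}
   | (m == k.1 + k.2)%MM) (F x)@_(k.1) * (G x)@_(k.2))).
  by move=> x; rewrite mcoeffM.
by apply: fun_subring_sum => k _; exact: fun_subringM.
Qed.

Lemma fun_subring_meval n (F : {mpoly R[n]}) (v : T -> 'I_n -> R) :
  (forall c, P (fun=> c)) -> (forall i, P (fun x => v x i)) ->
  P (fun x => F.@[v x]).
Proof.
move=> PC Pv; apply: (@fun_subring_ext
  (fun x => \sum_(m <- msupp F) F@_m * \prod_i v x i ^+ m i)).
  by move=> x; rewrite mevalE.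
apply: fun_subring_sum => m _; apply: fun_subringM => //.
by apply: fun_subring_prod => i _; exact: fun_subringX.
Qed.

End FunSubring.

(** The coefficients of g x^a are polynomials in the entries of g with natural coefficients; so the
    lemma also covers the class of integer-valued functions, which does not contain all
    constants. *)
Lemma fun_subring_lin_subst (T : Type) (k : fieldType) (P : (T -> k) -> Prop) n
    (g : T -> 'M[k]_n) (a : 'X_{1..n}) m : fun_subring P ->
  (forall i j, P (fun x => g x i j)) ->
  P (fun x => (lin_subst (g x) 'X_[a])@_m).
Proof.
move=> sP Pg; apply: (fun_subring_ext (f := fun x =>
  (\prod_(j < n) (\sum_i g x i j *: 'X_i) ^+ a j)@_m)).
  move=> x; rewrite /lin_subst comp_mpolyX; congr (_@__).
  by apply: eq_bigr => j _; rewrite tnth_mktuple.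
suff H r : forall m, P (fun x => (\prod_(j <- r)
    (\sum_i g x i j *: 'X_i) ^+ a j)@_m) by exact: H.
elim: r => [|j r IH] {}m.
  apply: (fun_subring_ext (f := fun=> (m == 0%MM)%:R)).
    by move=> x; rewrite big_nil mcoeff1.
  exact: (fun_subring_nat sP (m == 0%MM)).
apply: (fun_subring_ext (f := fun x => ((\sum_i g x i j *: 'X_i) ^+ a j *
    \prod_(j <- r) (\sum_i g x i j *: 'X_i) ^+ a j)@_m)).
  by move=> x; rewrite big_cons.
apply: fun_subring_mpolyM => // {}m; elim: (a j) m => [|e IHe] m.
  apply: (fun_subring_ext (f := fun=> (m == 0%MM)%:R)).
    by move=> x; rewrite expr0 mcoeff1.
  exact: (fun_subring_nat sP (m == 0%MM)).
apply: (fun_subring_ext (f := fun x => ((\sum_i g x i j *: 'X_i) *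
    (\sum_i g x i j *: 'X_i) ^+ e)@_m)).
  by move=> x; rewrite exprS.
apply: fun_subring_mpolyM => // {}m.
apply: (fun_subring_ext (f := fun x => \sum_i g x i j * (U_(i)%MM == m)%:R)).
  move=> x; rewrite linear_sum; apply: eq_bigr => i _.
  by rewrite /= mcoeffZ mcoeffX.
apply: (fun_subring_sum sP) => i _; apply: (fun_subringM sP) => //.
exact: (fun_subring_nat sP (U_(i)%MM == m)).
Qed.

Section PolynomialFunctions.
Variables (k : fieldType) (char0 : [pchar k] =i pred0).

Lemma natr_eq0_char0 (i : nat) : ((i%:R : k) == 0) = (i == 0%N).
Proof. by have /pcharf0P -> := char0. Qed.

Lemma natr_inj_char0 : injective (fun i : nat => i%:R : k).
Proof.
move=> i j; wlog le_ij : i j / (i <= j)%N.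
  by move=> W; case/orP: (leq_total i j) => /W // W' /esym/W'.
move=> /eqP; rewrite eq_sym -subr_eq0 -natrB // natr_eq0_char0 subn_eq0 => le_ji.
by apply/eqP; rewrite eqn_leq le_ij.
Qed.

Lemma poly_nat_eq0 (p : {poly k}) : (forall i : nat, p.[i%:R] = 0) -> p = 0.
Proof.
move=> p0; apply/eqP; case: eqP => // /eqP nz; exfalso.
have := @max_poly_roots _ p [seq i%:R | i <- iota 0 (size p)] nz.
rewrite map_inj_uniq ?iota_uniq; last exact: natr_inj_char0.
rewrite size_map size_iota ltnn => H; suff: false by [].
by apply: H => //; apply/allP => _ /mapP[i _ ->]; rewrite rootE p0.
Qed.

Definition polyfun (f : k -> k) : Prop := exists p : {poly k}, f =1 horner p.

Lemma polyfun_subring : fun_subring polyfun.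
Proof.
split=> [|f g [p Ep] [q Eq]|f g [p Ep] [q Eq]].
- by exists 1 => x; rewrite hornerC.
- by exists (p - q) => x; rewrite Ep Eq hornerD hornerN.
- by exists (p * q) => x; rewrite Ep Eq hornerM.
Qed.

Lemma polyfun_cst c : polyfun (fun=> c).
Proof. by exists c%:P => x; rewrite hornerC. Qed.

Lemma polyfun_id : polyfun id.
Proof. by exists 'X => x; rewrite hornerX. Qed.

Lemma polyfun_nat_eq0 f : polyfun f -> (forall i : nat, f i%:R = 0) ->
  forall x, f x = 0.
Proof.
move=> [p Ep] f0 x; rewrite Ep (_ : p = 0) ?horner0 //.
by apply: poly_nat_eq0 => i; rewrite -Ep.
Qed.

Lemma polyfun_mul_eq0 f g : polyfun f -> polyfun g ->
  (forall x, f x * g x = 0) -> (forall x, f x = 0) \/ (forall x, g x = 0).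
Proof.
move=> [p Ep] [q Eq] fg0; have: p * q = 0.
  by apply: poly_nat_eq0 => i; rewrite hornerM -Ep -Eq.
move=> /eqP; rewrite mulf_eq0 => /orP[] /eqP e; [left|right] => x.
  by rewrite Ep e horner0.
by rewrite Eq e horner0.
Qed.

Section Lines.
Variable V : lmodType k.

(** Polynomiality on each affine line requires no coordinates on V, and is all that the
    irreducibility argument of [linewise_poly_mul_eq0] uses. *)
Definition linewise_poly (Phi : V -> k) : Prop :=
  forall a b, polyfun (fun t => Phi (a + t *: b)).

Lemma linewise_poly_subring : fun_subring linewise_poly.
Proof.
split=> [a b|f g Pf Pg a b|f g Pf Pg a b].
- exact: polyfun_cst.
- exact: (fun_subringB polyfun_subring).
- exact: (fun_subringM polyfun_subring).
Qed.

Lemma linewise_poly_cst c : linewise_poly (fun=> c).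
Proof. by move=> a b; exact: polyfun_cst. Qed.

(** Irreducibility of affine space: on the line from a point where f does not vanish to any point b,
    the factor g must be the zero polynomial, hence g vanishes at b. *)
Lemma linewise_poly_mul_eq0 f g : linewise_poly f -> linewise_poly g ->
  (forall x, f x * g x = 0) -> (forall x, f x = 0) \/ (forall x, g x = 0).
Proof.
move=> Pf Pg fg0; case: (pselect (forall x, f x = 0)); first by left.
move=> /existsNP[a fa]; right=> b.
have [|f0|g0] := polyfun_mul_eq0 (Pf a (b - a)) (Pg a (b - a)).
- by move=> t; exact: fg0.
- by case: fa; have := f0 0; rewrite scale0r addr0.
- by have := g0 1; rewrite scale1r addrC subrK.
Qed.

End Lines.

Lemma linewise_poly_entry m n i j : linewise_poly (fun g : 'M[k]_(m, n) => g i j).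
Proof.
move=> a b; exists ((a i j)%:P + (b i j) *: 'X) => t.
by rewrite !mxE hornerD hornerC hornerZ hornerX mulrC.
Qed.

Lemma linewise_poly_nat_eq0 m n (Phi : 'M[k]_(m, n) -> k) : linewise_poly Phi ->
  (forall g : 'M[nat]_(m, n), Phi (map_mx (fun i => i%:R) g) = 0) ->
  forall g, Phi g = 0.
Proof.
move=> PPhi Phi0 g.
(* s lists the entries that are still arbitrary; the induction frees one entry at a time, by moving
   along a coordinate line. *)
suff H (s : seq ('I_m * 'I_n)) :
    forall g : 'M[k]_(m, n), (forall i j, (i, j) \notin s ->
      exists a : nat, g i j = a%:R) -> Phi g = 0.
  by apply: (H (enum {: 'I_m * 'I_n})) => i j; rewrite mem_enum.
elim: s => [|[i j] s IH] {}g gnat.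
  have /choice[a Ea] : forall u : 'I_m * 'I_n, exists a : nat, g u.1 u.2 = a%:R.
    by move=> [i j]; exact: gnat.
  rewrite -(Phi0 (\matrix_(i, j) a (i, j))); congr Phi.
  by apply/matrixP => i j; rewrite !mxE -Ea.
have := polyfun_nat_eq0 (PPhi (g - g i j *: delta_mx i j) (delta_mx i j)).
move=> /(_ _ (g i j)); rewrite subrK; apply=> a.
apply: IH => i' j' nij; rewrite !mxE.
case: (eqVneq (i', j') (i, j)) => [[-> ->]|ne].
  by exists a; rewrite !eqxx mulr1 subrr mulr1 add0r.
have [b ->] : exists b : nat, g i' j' = b%:R.
  by apply: gnat; rewrite inE negb_or ne.
exists b; move: ne; rewrite xpair_eqE => /negPf ->.
by rewrite !mulr0 subr0 addr0.
Qed.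

End PolynomialFunctions.

(** * Determinants of products of rectangular matrices *)

Section DetExpand.
Variables (R : comNzRingType) (T : finType) (r : nat).

(** Multilinearity in the columns: f chooses one summand in each column. All functions f are kept,
    those with a repeated value contributing a determinant with two equal columns. *)
Lemma det_sum_expand (A : 'I_r -> T -> R) (C : T -> 'I_r -> R) :
  \det (\matrix_(i, j) \sum_t A i t * C t j) =
  \sum_(f : {ffun 'I_r -> T}) (\prod_j C (f j) j) * \det (\matrix_(i, j) A i (f j)).
Proof.
rewrite -det_tr [LHS]/determinant.
under eq_bigr => s _.
  under eq_bigr => j _ do rewrite !mxE.
  rewrite bigA_distr_bigA /= big_distrr /=.
  over.
rewrite exchange_big /=; apply: eq_bigr => f _.
rewrite -det_tr big_distrr /=; apply: eq_bigr => s _.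
rewrite mulrCA; congr (_ * _); rewrite -big_split /=; apply: eq_bigr => j _.
by rewrite !mxE mulrC.
Qed.

(* The form of the Cauchy-Binet formula in which only the vanishing of the
   left-hand side matters. *)
Lemma cauchy_binet_eq0 (A B : 'I_r -> T -> R) (w : T -> R) :
  \det (\matrix_(i, j) \sum_t w t * A i t * B j t) = 0 ->
  \sum_(f : {ffun 'I_r -> T}) (\prod_j w (f j)) *
     \det (\matrix_(i, j) A i (f j)) * \det (\matrix_(i, j) B i (f j)) = 0.
Proof.
move=> AB0; under eq_bigr => f _ do rewrite [X in _ * X]/determinant big_distrr /=.
rewrite exchange_big big1 //= => s _.
transitivity ((-1) ^+ s * \det (\matrix_(i, j) \sum_t A i t * (w t * B (s^-1 j)%g t))).
  rewrite det_sum_expand big_distrr; apply: eq_bigr => f _ /=.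
  rewrite mulrCA; congr (_ * _); rewrite mulrAC; congr (_ * _).
  rewrite [X in _ * X](reindex_inj (@perm_inj _ s^-1)) -big_split /=.
  by apply: eq_bigr => j _; rewrite mxE permKV.
suff -> : \matrix_(i, j) (\sum_t A i t * (w t * B (s^-1 j)%g t)) =
    col_perm s^-1 (\matrix_(i, j) \sum_t w t * A i t * B j t).
  by rewrite col_permE det_mulmx AB0 mul0r mulr0.
apply/matrixP => i j; rewrite !mxE; apply: eq_bigr => t _.
by rewrite mulrCA mulrA.
Qed.

End DetExpand.

(** * Linear substitutions *)

Section Monomials.
Variable n : nat.
Implicit Types m : 'X_{1..n}.

Lemma mnm_ind (P : 'X_{1..n} -> Prop) :
  P 0%MM -> (forall m i, P m -> P (m + U_(i))%MM) -> forall m, P m.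
Proof.
move=> P0 PS m; elim: {m}(mdeg m) {-2}m (erefl (mdeg m)) => [|d IH] m dm.
  by have /eqP := dm; rewrite mdeg_eq0 => /eqP ->.
have [i mi] : exists i, m i != 0%N.
  apply: contrapT => /forallNP nm; move: dm; rewrite mdegE big1 // => i _.
  by apply/eqP/negPn/negP; exact: nm.
have le : (U_(i) <= m)%MM by rewrite lep1mP.
rewrite -(submK le); apply: PS; apply: IH; apply/eqP.
by rewrite -eqSS -dm -{2}(submK le) mdegD mdeg1 addn1.
Qed.

Definition mfact m : nat := \prod_(i < n) (m i)`!.

Lemma mfact0 : mfact 0%MM = 1%N.
Proof. by rewrite /mfact big1 // => i _; rewrite mnm0E. Qed.

Lemma mfactS m i : mfact (m + U_(i))%MM = ((m i).+1 * mfact m)%N.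
Proof.
rewrite /mfact (bigD1 i) // [in RHS](bigD1 i) //= mnmDE mnm1E eqxx addn1 factS.
rewrite -mulnA; congr (_ * (_ * _))%N; apply: eq_bigr => j ji.
by rewrite mnmDE mnm1E eq_sym (negPf ji) addn0.
Qed.

Lemma mfact_gt0 m : (0 < mfact m)%N.
Proof. by rewrite prodn_gt0 // => i; rewrite fact_gt0. Qed.

End Monomials.

Lemma mpoly_ring_ind n (R : comNzRingType) (P : {mpoly R[n]} -> Prop) :
  (forall c, P c%:MP) -> (forall i, P 'X_i) ->
  (forall p q, P p -> P q -> P (p + q)) ->
  (forall p q, P p -> P q -> P (p * q)) -> forall p, P p.
Proof.
move=> PC PX PD PM p; rewrite (mpolyE p).
elim: (msupp p) => [|m s IH]; first by rewrite big_nil; exact: (PC 0).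
rewrite big_cons; apply: (PD) => //; rewrite -mul_mpolyC; apply: (PM) => //.
elim/mnm_ind: m => [|m i Pm]; first by rewrite mpolyX0; exact: (PC 1).
by rewrite mpolyXD; apply: PM.
Qed.

Section LinSubst.
Variables (n : nat) (k : fieldType).
Implicit Types (g h A B : 'M[k]_n) (p q : {mpoly k[n]}).

Lemma lin_substD g p q : lin_subst g (p + q) = lin_subst g p + lin_subst g q.
Proof. exact: comp_mpolyD. Qed.

Lemma lin_substZ g c p : lin_subst g (c *: p) = c *: lin_subst g p.
Proof. exact: comp_mpolyZ. Qed.

Lemma lin_substC g c : lin_subst g c%:MP = c%:MP.
Proof. exact: comp_mpolyC. Qed.

Lemma lin_substM g p q : lin_subst g (p * q) = lin_subst g p * lin_subst g q.
Proof. exact: rmorphM. Qed.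

Lemma lin_subst0 g : lin_subst g 0 = 0.
Proof. exact: comp_mpoly0. Qed.

Lemma lin_subst_sum g I (r : seq I) (P : pred I) (F : I -> {mpoly k[n]}) :
  lin_subst g (\sum_(i <- r | P i) F i) = \sum_(i <- r | P i) lin_subst g (F i).
Proof. exact: raddf_sum. Qed.

Lemma lin_substXU g j : lin_subst g 'X_j = \sum_i g i j *: 'X_i.
Proof. by rewrite /lin_subst comp_mpolyXU (nth_map j) ?size_enum_ord ?nth_ord_enum. Qed.

Lemma lin_subst_comp g h p : lin_subst g (lin_subst h p) = lin_subst (g *m h) p.
Proof.
elim/mpoly_ring_ind: p => [c|j|p q IHp IHq|p q IHp IHq].
- by rewrite !lin_substC.
- rewrite !lin_substXU lin_subst_sum.
  under eq_bigr => i _ do rewrite lin_substZ lin_substXU scaler_sumr.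
  rewrite exchange_big; apply: eq_bigr => l _.
  rewrite mxE scaler_suml; apply: eq_bigr => i _.
  by rewrite scalerA mulrC.
- by rewrite !lin_substD IHp IHq.
- by rewrite !lin_substM IHp IHq.
Qed.

Lemma lin_subst1 p : lin_subst 1%:M p = p.
Proof.
elim/mpoly_ring_ind: p => [c|j|p q IHp IHq|p q IHp IHq].
- by rewrite !lin_substC.
- rewrite !lin_substXU (bigD1 j) //= mxE eqxx scale1r big1 ?addr0 // => i ij.
  by rewrite mxE (negPf ij) scale0r.
- by rewrite !lin_substD IHp IHq.
- by rewrite !lin_substM IHp IHq.
Qed.

Lemma lin_substK g : g \in unitmx -> cancel (lin_subst g) (lin_subst (invmx g)).
Proof. by move=> Ug p; rewrite lin_subst_comp mulVmx // lin_subst1. Qed.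

Lemma lin_substKV g : g \in unitmx -> cancel (lin_subst (invmx g)) (lin_subst g).
Proof. by move=> Ug p; rewrite lin_subst_comp mulmxV // lin_subst1. Qed.

Lemma lin_subst_dhomogX g (m : 'X_{1..n}) : lin_subst g 'X_[m] \is (mdeg m).-homog.
Proof.
elim/mnm_ind: m => [|m i IH].
  by rewrite mpolyX0 mdeg0 -mpolyC1 lin_substC mpolyC1 dhomog1.
rewrite mpolyXD lin_substM mdegD; apply: dhomogM => //.
rewrite lin_substXU mdeg1; apply: rpred_sum => j _.
by apply: rpredZ; rewrite dhomogX /= mdeg1.
Qed.

Lemma lin_subst_dhomog g d p : p \is d.-homog -> lin_subst g p \is d.-homog.
Proof.
move=> /dhomogP hp; rewrite (mpolyE p) lin_subst_sum big_seq.
apply: rpred_sum => m /hp <-; rewrite lin_substZ.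
by apply: rpredZ; exact: lin_subst_dhomogX.
Qed.

Lemma mderivXU i j : ('X_j : {mpoly k[n]})^`M(i) = ((j == i)%:R)%:MP.
Proof.
rewrite mderivX mnm1E; case: eqVneq => [->|_]; last by rewrite scale0r mpolyC0.
by rewrite scale1r -{1}[U_(i)%MM]add0m addmK mpolyX0 mpolyC1.
Qed.

Lemma lin_subst_deriv g p i :
  (lin_subst g p)^`M(i) = \sum_l g i l *: lin_subst g p^`M(l).
Proof.
elim/mpoly_ring_ind: p => [c|j|p q IHp IHq|p q IHp IHq].
- rewrite lin_substC mderivC big1 // => l _.
  by rewrite mderivC lin_subst0 scaler0.
- rewrite lin_substXU linear_sum (bigD1 i) //= mderivZ mderivXU eqxx.
  rewrite big1 ?addr0 => [|l li]; last first.
    by rewrite mderivZ mderivXU (negPf li) mpolyC0 scaler0.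
  rewrite [RHS](bigD1 j) //= mderivXU eqxx lin_substC big1 ?addr0 // => l li.
  by rewrite mderivXU eq_sym (negPf li) lin_substC mpolyC0 scaler0.
- rewrite lin_substD mderivD IHp IHq -big_split; apply: eq_bigr => l _.
  by rewrite mderivD lin_substD scalerDr.
rewrite lin_substM mderivM IHp IHq mulr_suml mulr_sumr -big_split.
apply: eq_bigr => l _ /=.
by rewrite mderivM lin_substD !lin_substM scalerDr scalerAl scalerAr.
Qed.

Lemma mcoeffXUM i p (m : 'X_{1..n}) :
  ('X_i * p)@_m = if m i == 0%N then 0 else p@_(m - U_(i)).
Proof.
case: (eqVneq (m i) 0%N) => mi; last first.
  by rewrite -{1}(@submK _ U_(i)%MM m) ?lep1mP // addmC mulrC mcoeffMX.
apply: memN_msupp_eq0; rewrite mulrC (perm_mem (msuppMX _ _)).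
apply/mapP => -[c _ /(congr1 (fun m : 'X_{1..n} => m i))].
by rewrite mi mnmDE mnm1E eqxx.
Qed.

(* The pairing <X^a, X^b> = a! [a = b] satisfies <g p, q> = <p, g^T q>. *)
Lemma lin_subst_contravariant g (a b : 'X_{1..n}) :
  (mfact b)%:R * (lin_subst g 'X_[a])@_b
    = (mfact a)%:R * (lin_subst g^T 'X_[b])@_a :> k.
Proof.
elim/mnm_ind: a b => [|a i IH] b.
  rewrite mpolyX0 -mpolyC1 lin_substC mcoeffC mfact0 !mul1r.
  case: eqVneq => [->|nb]; first by rewrite mfact0 mpolyX0 -mpolyC1 lin_substC
    mcoeffC eqxx !mulr1.
  rewrite mulr0 (dhomog_nemf_coeff (lin_subst_dhomogX _ _)) //.
  by rewrite /= mdeg0 eq_sym mdeg_eq0.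
(* Multiplication by x_i and differentiation by x_i are adjoint for the pairing; the induction on a
   then reduces to the chain rule. *)
have -> : (mfact (a + U_(i)))%:R * (lin_subst g^T 'X_[b])@_(a + U_(i))
    = (mfact a)%:R * ((lin_subst g^T 'X_[b])^`M(i))@_a :> k.
  by rewrite mcoeff_deriv mulrnAr mfactS natrM -mulrA mulr_natl.
rewrite lin_subst_deriv [in RHS]linear_sum mulr_sumr.
rewrite addmC mpolyXD lin_substM lin_substXU mulr_suml linear_sum mulr_sumr.
apply: eq_bigr => l _; rewrite /= -scalerAl !mcoeffZ mxE mderivX lin_substZ mcoeffZ.
rewrite !(mulrCA _ (g l i)); congr (_ * _).
rewrite [X in _ = X]mulrCA -IH.
rewrite mcoeffXUM; case: (eqVneq (b l) 0%N) => [->|bl].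
  by rewrite !(mul0r, mulr0).
rewrite mulrA -natrM; congr (_%:R * _).
have {1}-> : b = (b - U_(l) + U_(l))%MM by rewrite submK // lep1mP.
by rewrite mfactS mnmBE mnm1E eqxx subn1 prednK // lt0n.
Qed.

(** The derivation of S that sends x_b to \sum_a A_ab x_a, that is, the infinitesimal action of A in
    gl(n). *)
Definition lin_deriv A p : {mpoly k[n]} :=
  \sum_a \sum_b A a b *: ('X_a * p^`M(b)).

Lemma lin_subst_lin_deriv g A B p : g *m A = B *m g ->
  lin_subst g (lin_deriv A p) = lin_deriv B (lin_subst g p).
Proof.
move=> gA; transitivity (\sum_b \sum_c (g *m A) c b *: ('X_c * lin_subst g p^`M(b))).
  rewrite /lin_deriv exchange_big lin_subst_sum; apply: eq_bigr => b _ /=.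
  rewrite lin_subst_sum; under [LHS]eq_bigr => a _.
    rewrite lin_substZ lin_substM lin_substXU mulr_suml scaler_sumr.
    over.
  rewrite exchange_big; apply: eq_bigr => c _; rewrite mxE scaler_suml.
  by apply: eq_bigr => a _; rewrite -scalerAl scalerA mulrC.
rewrite gA /lin_deriv exchange_big; apply: eq_bigr => a _ /=.
under [RHS]eq_bigr => c _ do rewrite lin_subst_deriv mulr_sumr scaler_sumr.
rewrite exchange_big; apply: eq_bigr => l _ /=; rewrite mxE scaler_suml.
by apply: eq_bigr => c _; rewrite -scalerAr scalerA.
Qed.

Lemma lin_derivX A (m : 'X_{1..n}) : lin_deriv A 'X_[m] =
  \sum_a \sum_b (A a b * (m b)%:R) *: 'X_[U_(a) + (m - U_(b))].
Proof.
apply: eq_bigr => a _; apply: eq_bigr => b _.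
by rewrite mderivX -scalerAr scalerA mpolyXD.
Qed.

(** The monomial x_a m is reached from x_b m only through the entry A_ab, so a single coefficient
    isolates each off-diagonal entry of A. *)
Lemma mcoeff_lin_derivX A (m : 'X_{1..n}) a b : a != b ->
  (lin_deriv A 'X_[m + U_(b)])@_(m + U_(a)) = A a b * (m b).+1%:R.
Proof.
move=> ab; rewrite lin_derivX linear_sum (bigD1 a) //= linear_sum (bigD1 b) //=.
rewrite mcoeffZ mcoeffX addmK [(U_(a) + m)%MM]addmC eqxx mulr1 mnmDE mnm1E eqxx addn1.
have N a' b' : (a', b') != (a, b) ->
    ((A a' b' * ((m + U_(b))%MM b')%:R) *: 'X_[U_(a') + (m + U_(b) - U_(b'))])@_(m
      + U_(a)) = 0 :> k.
  move=> ne; rewrite mcoeffZ mcoeffX; case: eqP => [e|]; last by rewrite mulr0.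
  case: (eqVneq ((m + U_(b))%MM b') 0%N) => [->|nb]; first by rewrite mulr0 mul0r.
  exfalso; have le : (U_(b') <= m + U_(b))%MM by rewrite lep1mP.
  have {}e : (U_(a') + U_(b) = U_(a) + U_(b'))%MM.
    apply: (@addmI _ m); rewrite addmA [(m + U_(a'))%MM]addmC -addmA -{1}(submK le).
    by rewrite addmA e -addmA.
  move/negP: ne; apply; rewrite xpair_eqE.
  move/mnmP: e => e; have := e a; have := e b.
  rewrite !mnmDE !mnm1E !eqxx [b == a]eq_sym (negPf ab).
  by case: (b' == b) => /=; case: (a' == a); case: (a' == b); case: (b' == a).
rewrite [X in _ + X + _]big1 => [|b' bb']; last by rewrite N // xpair_eqE eqxx.
rewrite big1 => [|a' aa']; last first.
  by rewrite linear_sum big1 //= => b' _; rewrite N // xpair_eqE (negPf aa').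
by rewrite !addr0.
Qed.

End LinSubst.

(** * Graded ideals *)

Section HomogeneousPolynomials.
Variables (n : nat) (k : fieldType).
Implicit Types (p q : {mpoly k[n]}).

Lemma mk_mon_subproof d (m : 'X_{1..n}) : mdeg m = d -> (mdeg m < d.+1)%N.
Proof. by move=> ->. Qed.

Definition mk_mon d (m : 'X_{1..n}) (dm : mdeg m = d) : mon n d :=
  exist _ (BMultinom (mk_mon_subproof dm)) (introT eqP dm).

Lemma mk_monK d (m : 'X_{1..n}) (dm : mdeg m = d) : mnm_of_mon (mk_mon dm) = m.
Proof. by []. Qed.

Lemma mdeg_mon d (m : mon n d) : mdeg (mnm_of_mon m) = d.
Proof. exact/eqP/(valP m). Qed.

Lemma mnm_of_mon_inj d : injective (@mnm_of_mon n d).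
Proof. by move=> a b /val_inj/val_inj. Qed.

Definition to_hpoly d p : hpoly n k d := indhomog d p.

Lemma to_hpolyK d p : p \is d.-homog -> to_hpoly d p = p :> {mpoly k[n]}.
Proof. by move=> hp; rewrite /mpoly_of_hpoly /to_hpoly /indhomog insubdK. Qed.

Lemma hpoly_dhomog d (p : hpoly n k d) : (p : {mpoly k[n]}) \is d.-homog.
Proof. exact: (valP p). Qed.

Lemma hpoly_inj d : injective (@mpoly_of_hpoly n k d).
Proof. exact: val_inj. Qed.

Lemma hpolyP d (p q : hpoly n k d) :
  (forall m : mon n d, (p : {mpoly k[n]})@_(mnm_of_mon m)
    = (q : {mpoly k[n]})@_(mnm_of_mon m)) -> p = q.
Proof.
move=> pq; apply/hpoly_inj/mpolyP => m; case: (eqVneq (mdeg m) d) => [e|ne].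
  exact: (pq (mk_mon e)).
by rewrite !(dhomog_nemf_coeff (hpoly_dhomog _)).
Qed.

Lemma hpolyD d (p q : hpoly n k d) : ((p + q : hpoly n k d) : {mpoly k[n]})
  = (p : {mpoly k[n]}) + q.
Proof. by []. Qed.

Lemma hpolyZ d c (p : hpoly n k d) : ((c *: p : hpoly n k d) : {mpoly k[n]})
  = c *: (p : {mpoly k[n]}).
Proof. by []. Qed.

Lemma hpoly0 d : ((0 : hpoly n k d) : {mpoly k[n]}) = 0.
Proof. by []. Qed.

Lemma hpoly_sum d I (r : seq I) (P : pred I) (F : I -> hpoly n k d) :
  ((\sum_(i <- r | P i) F i : hpoly n k d) : {mpoly k[n]})
    = \sum_(i <- r | P i) (F i : {mpoly k[n]}).
Proof. by elim/big_rec2: _ => // i y1 y2 _ <-. Qed.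

Lemma sum_mon d p : p \is d.-homog ->
  p = \sum_(m : mon n d) p@_(mnm_of_mon m) *: 'X_[mnm_of_mon m].
Proof.
move=> hp; apply/mpolyP => m; rewrite linear_sum /=.
case: (eqVneq (mdeg m) d) => [e|ne].
  rewrite (bigD1 (mk_mon e)) //= mcoeffZ mcoeffX eqxx mulr1 big1 ?addr0 // => a ne.
  rewrite mcoeffZ mcoeffX; case: eqP => [ea|]; last by rewrite mulr0.
  by case/eqP: ne; apply: mnm_of_mon_inj.
rewrite (dhomog_nemf_coeff hp) // big1 // => a _; rewrite mcoeffZ mcoeffX.
by case: eqP => [ea|]; rewrite ?mulr0 //; case/eqP: ne; rewrite -ea mdeg_mon.
Qed.

End HomogeneousPolynomials.

Section IdealTheory.
Variables (n : nat) (k : fieldType).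
Implicit Types (J : set {mpoly k[n]}) (p q : {mpoly k[n]}).

Lemma ideal_gen_ideal A : is_ideal (@ideal_gen n k A).
Proof.
split=> [K [[K0 _ _] _] //|p q Jp Jq K KA|p q Jq K KA].
  by case: (KA) => -[_ KD _] _; apply: KD; [exact: Jp|exact: Jq].
by case: (KA) => -[_ _ KM] _; apply: KM; exact: Jq.
Qed.

Lemma ideal_gen_incl A : A `<=` @ideal_gen n k A.
Proof. by move=> p Ap K [_]; apply. Qed.

Lemma ideal_gen_min A J : is_ideal J -> A `<=` J -> ideal_gen A `<=` J.
Proof. by move=> iJ AJ p; apply. Qed.

Lemma graded_ideal_is_ideal J : graded_ideal J -> is_ideal J.
Proof. by case=> A [_ ->]; exact: ideal_gen_ideal. Qed.

Lemma ideal_scale J c p : is_ideal J -> J p -> J (c *: p).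
Proof. by case=> _ _ JM Jp; rewrite -mul_mpolyC; exact: JM. Qed.

Lemma ideal_sum J I (r : seq I) (P : pred I) (F : I -> {mpoly k[n]}) : is_ideal J ->
  (forall i, P i -> J (F i)) -> J (\sum_(i <- r | P i) F i).
Proof. by case=> J0 JD _ JF; elim/big_ind: _. Qed.

Lemma graded_ideal_subset J J' : graded_ideal J -> is_ideal J' ->
  (forall d p, p \is d.-homog -> J p -> J' p) -> J `<=` J'.
Proof.
move=> [A [hA EJ]] iJ' JJ'; rewrite EJ; apply: ideal_gen_min => // p Ap.
have /homogP[d hd] := hA p Ap.
by apply: (JJ' d) => //; rewrite EJ; exact: ideal_gen_incl.
Qed.

Lemma gpiece_subset J J' d : is_ideal J -> is_ideal J' ->
  (forall p, p \is d.-homog -> J p -> J' p) <-> (gpiece J d <= gpiece J' d)%VS.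
Proof.
move=> iJ iJ'; split=> [JJ'|/subvP JJ' p hp Jp].
  apply/subvP => p /(mem_gpiece iJ) Jp; apply/(mem_gpiece iJ').
  by apply: JJ' => //; exact: hpoly_dhomog.
have /(mem_gpiece iJ)/JJ' : J (to_hpoly d p) by rewrite to_hpolyK.
by move/(mem_gpiece iJ'); rewrite to_hpolyK.
Qed.

Lemma gpiece_eq_of_subset J J' d : is_ideal J -> is_ideal J' ->
  (forall p, p \is d.-homog -> J p -> J' p) -> hilbert J d = hilbert J' d ->
  forall p, p \is d.-homog -> J' p -> J p.
Proof.
move=> iJ iJ' /(gpiece_subset d iJ iJ') le eqh; apply/(gpiece_subset d iJ' iJ).
have /eqP <- : gpiece J d == gpiece J' d; last exact: subvv.
by rewrite eqEdim le -/(hilbert J' d) -/(hilbert J d) eqh leqnn.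
Qed.

Section Image.
Variables (g : 'M[k]_n) (Ug : g \in unitmx).

Lemma lin_subst_imageE J p :
  (lin_subst g @` J) p <-> J (lin_subst (invmx g) p).
Proof.
split=> [[q Jq <-]|Jp]; first by rewrite lin_substK.
by exists (lin_subst (invmx g) p) => //; rewrite lin_substKV.
Qed.

Lemma is_ideal_image J : is_ideal J -> is_ideal (lin_subst g @` J).
Proof.
move=> [J0 JD JM]; split=> [|p q|p q]; rewrite !lin_subst_imageE.
- by rewrite lin_subst0.
- by rewrite lin_substD; exact: JD.
- by rewrite lin_substM; exact: JM.
Qed.

Lemma graded_ideal_image J : graded_ideal J -> graded_ideal (lin_subst g @` J).
Proof.
move=> gJ; have iJ := graded_ideal_is_ideal gJ; case: gJ => A [hA EJ].
exists (lin_subst g @` A); split.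
  move=> _ [p Ap <-]; have /homogP[d hd] := hA p Ap.
  by apply/homogP; exists d; exact: lin_subst_dhomog.
rewrite eqEsubset; split=> [_ [p + <-]|].
  rewrite EJ; apply: (@ideal_gen_min A [set p | ideal_gen (lin_subst g @` A)
    (lin_subst g p)]) => [|q Aq /=]; last first.
    by apply: ideal_gen_incl; exists q.
  have [G0 GD GM] := ideal_gen_ideal (lin_subst g @` A).
  split=> [|q r|q r] /=; rewrite ?lin_subst0 ?lin_substD ?lin_substM //.
    exact: GD.
  exact: GM.
apply: ideal_gen_min; first exact: is_ideal_image.
by move=> _ [p Ap <-]; exists p => //; rewrite EJ; exact: ideal_gen_incl.
Qed.

End Image.

Definition lin_hpoly (g : 'M[k]_n) d (p : hpoly n k d) : hpoly n k d :=
  to_hpoly d (lin_subst g p).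

Lemma lin_hpolyE g d (p : hpoly n k d) : lin_hpoly g p = lin_subst g p :> {mpoly k[n]}.
Proof. by rewrite to_hpolyK //; apply/lin_subst_dhomog/hpoly_dhomog. Qed.

Lemma lin_hpoly_is_linear g d : linear (@lin_hpoly g d).
Proof.
move=> c p q; apply: hpoly_inj.
by rewrite lin_hpolyE !hpolyD !hpolyZ lin_substD lin_substZ !lin_hpolyE.
Qed.

HB.instance Definition _ g d :=
  GRing.isLinear.Build k (hpoly n k d) (hpoly n k d) _ (@lin_hpoly g d)
    (@lin_hpoly_is_linear g d).

Lemma hilbert_image_le g J d : g \in unitmx -> is_ideal J ->
  (hilbert J d <= hilbert (lin_subst g @` J) d)%N.
Proof.
move=> Ug iJ; rewrite /hilbert -(@limg_dim_eq _ _ _ (linfun (@lin_hpoly g d)));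
  last first.
  apply/eqP; rewrite -subv0; apply/subvP => p /memv_capP[_].
  rewrite memv_ker lfunE /= => /eqP/(congr1 (@mpoly_of_hpoly n k d)).
  rewrite lin_hpolyE hpoly0 => /(congr1 (lin_subst (invmx g))).
  by rewrite lin_substK // lin_subst0 memv0 => e; apply/eqP/hpoly_inj.
apply: dimvS; apply/subvP => _ /memv_imgP[p /(mem_gpiece iJ) Jp ->].
apply/(mem_gpiece (is_ideal_image Ug iJ)); rewrite lfunE /= lin_hpolyE.
by exists p.
Qed.

Lemma hilbert_image g J : g \in unitmx -> is_ideal J ->
  hilbert (lin_subst g @` J) = hilbert J.
Proof.
move=> Ug iJ; apply/funext => d; apply/eqP; rewrite eqn_leq hilbert_image_le // andbT.
have Ug' : invmx g \in unitmx by rewrite unitmx_inv.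
have := hilbert_image_le d Ug' (is_ideal_image Ug iJ).
suff -> : lin_subst (invmx g) @` (lin_subst g @` J) = J by [].
rewrite eqEsubset; split=> [_ [_ [p Jp <-] <-]|p Jp]; first by rewrite lin_substK.
by exists (lin_subst g p); [exists p|rewrite lin_substK].
Qed.

Lemma GL_orbit_hilb (I J : set {mpoly k[n]}) : graded_ideal I -> GL_orbit I J ->
  hilb_scheme (hilbert I) J.
Proof.
move=> gI [g /= Ug <-]; split; first exact: graded_ideal_image.
by move=> d; rewrite hilbert_image //; exact: graded_ideal_is_ideal.
Qed.

Lemma GL_orbit_refl (I : set {mpoly k[n]}) : GL_orbit I I.
Proof.
exists 1%:M; first exact: unitmx1.
rewrite eqEsubset; split=> [_ [p Ip <-]|p Ip]; first by rewrite lin_subst1.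
by exists p; rewrite ?lin_subst1.
Qed.

Lemma GL_orbit_trans (I J K : set {mpoly k[n]}) : GL_orbit I J -> GL_orbit J K ->
  GL_orbit I K.
Proof.
move=> [g /= Ug <-] [h /= Uh <-]; exists (h *m g); first by rewrite /= unitmx_mul Uh.
rewrite eqEsubset; split=> [_ [p Ip <-]|_ [_ [p Ip <-] <-]].
  by rewrite -lin_subst_comp; exists (lin_subst g p) => //; exists p.
by exists p => //; rewrite lin_subst_comp.
Qed.

End IdealTheory.

(** * Plücker coordinates and monomial ideals *)

Section Minors.
Variables (n : nat) (k : fieldType) (d : nat).
Implicit Types (U : {vspace hpoly n k d}).

(** Plücker coordinates computed on an arbitrary family of vectors: unlike the basis chosen inside
    [plucker], the family can depend polynomially on a parameter. *)
Definition minor r (v : 'I_r -> {mpoly k[n]}) (f : 'I_r -> mon n d) : k :=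
  \det (\matrix_(i, j) (v i)@_(mnm_of_mon (f j))).

Lemma minor_dim_ge r U (v : 'I_r -> hpoly n k d) f : (forall i, v i \in U) ->
  minor v f != 0 -> (r <= \dim U)%N.
Proof.
move=> Uv nz; pose X := [tuple v i | i < r].
have fX : free X.
  apply/freeP => c /(congr1 (@mpoly_of_hpoly n k d)) c0 i.
  pose A := \matrix_(i, j) (v i : {mpoly k[n]})@_(mnm_of_mon (f j)).
  have UA : A \in unitmx by rewrite unitmxE unitfE.
  suff /rowP/(_ i) : \row_i c i = 0 by rewrite !mxE.
  apply: (can_inj (mulmxK UA)); rewrite mul0mx; apply/rowP => j.
  have /(congr1 (mcoeff (mnm_of_mon (f j)))) := c0.
  rewrite hpoly_sum hpoly0 mcoeff0 linear_sum !mxE => E; rewrite -[RHS]E.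
  apply: eq_bigr => l _; rewrite !mxE hpolyZ /= mcoeffZ; congr (_ * _).
  by rewrite (nth_map l) ?size_enum_ord // nth_ord_enum.
have <- : \dim <<X>> = r by rewrite (eqnP fX) size_tuple.
by apply: dimvS; apply/span_subvP => _ /mapP[i _ ->].
Qed.

Lemma minor_dim_le r U (f : 'I_r -> mon n d) :
  (forall p, p \in U -> (forall j, (p : {mpoly k[n]})@_(mnm_of_mon (f j)) = 0) ->
    p = 0) ->
  (\dim U <= r)%N.
Proof.
move=> inj; pose c (p : hpoly n k d) : 'rV[k]_r := \row_j (p : {mpoly
  k[n]})@_(mnm_of_mon (f j)).
have lc : linear c.
  by move=> a p q; apply/rowP => j; rewrite !mxE hpolyD hpolyZ mcoeffD mcoeffZ.
pose cL := GRing.isLinear.Build k (hpoly n k d) 'rV[k]_r _ c lc.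
pose cl : {linear hpoly n k d -> 'rV[k]_r} := HB.pack c cL.
have cK : (U :&: lker (linfun cl) = 0)%VS.
  apply/eqP; rewrite -subv0; apply/subvP => p /memv_capP[Up].
  rewrite memv_ker lfunE /= => /eqP/rowP c0; rewrite memv0; apply/eqP/inj => // j.
  by have := c0 j; rewrite !mxE.
rewrite -(limg_dim_eq cK); apply: leq_trans (dimvS (subvf _)) _.
by rewrite dimvf /dim /= mul1n.
Qed.

(** The factor c is the determinant of the coordinates of v in the chosen basis of U; it is 0 when v
    is linearly dependent. *)
Lemma minor_plucker r U (v : 'I_r -> hpoly n k d) : \dim U = r ->
  (forall i, v i \in U) ->
  exists c, forall f : {ffun 'I_r -> mon n d}, minor v f = c * plucker U f.
Proof.
move=> dU; case: r / dU v => v Uv.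
exists (\det (\matrix_(i, l) coord (vbasis U) l (v i))) => f.
rewrite /plucker -det_mulmx; congr (\det _); apply/matrixP => i j; rewrite !mxE.
rewrite {1}(coord_vbasis (Uv i)) hpoly_sum linear_sum; apply: eq_bigr => l _.
by rewrite !mxE hpolyZ /= mcoeffZ.
Qed.

Lemma plucker_neq0 r U : \dim U = r ->
  exists f : {ffun 'I_r -> mon n d}, plucker U f != 0.
Proof.
move=> dU; case: r / dU.
pose A : 'M[k]_(\dim U, #|{: mon n d}|) :=
  \matrix_(i, j) ((vbasis U)`_i : hpoly n k d)@_(mnm_of_mon (enum_val j)).
have rA : row_full A^T.
  rewrite /row_full mxrank_tr; apply: (@inj_row_free _ _ _ A) => c cA.
  have fB : free (vbasis U) by exact: (basis_free (vbasisP U)).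
  have /freeP fB' := fB; apply/rowP => i; rewrite [RHS]mxE; apply: (fB' (c ord0)).
  apply: hpolyP => m; rewrite hpoly_sum linear_sum hpoly0 mcoeff0.
  have /rowP/(_ (enum_rank m)) := cA; rewrite !mxE => E; rewrite -[RHS]E.
  by apply: eq_bigr => l _; rewrite !mxE enum_rankK hpolyZ /= mcoeffZ.
exists [ffun i => enum_val (fullrankfun rA i)].
have := fullrowsub_unit rA; rewrite -unitmx_tr unitmxE unitfE.
rewrite (_ : _^T = \matrix_(i, j) ((vbasis U)`_i : hpoly n k d)@_(mnm_of_mon
   ([ffun i => enum_val (fullrankfun rA i)] j))) //.
by apply/matrixP => i j; rewrite !mxE ffunE.
Qed.

(** In the chart where the coordinate f does not vanish, U projects isomorphically onto the
    coefficients listed by f. Prescribing a unit vector there gives an element of the reduced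
    basis. *)
Lemma plucker_reduced r U (f : {ffun 'I_r -> mon n d}) (y : 'I_r -> k) :
  \dim U = r -> plucker U f != 0 ->
  exists2 b : hpoly n k d, b \in U & forall j,
    (b : {mpoly k[n]})@_(mnm_of_mon (f j)) = y j.
Proof.
move=> dU; case: r / dU f y => f y nz.
pose A : 'M[k]_(\dim U) := \matrix_(i,
  j) ((vbasis U)`_i : hpoly n k d)@_(mnm_of_mon (f j)).
have UA : A \in unitmx by rewrite unitmxE unitfE.
exists (\sum_i ((\row_j y j) *m invmx A) ord0 i *: (vbasis U)`_i).
  apply: memv_suml => i _; apply: memvZ; apply: vbasis_mem; apply: mem_nth.
  by rewrite size_tuple.
move=> j; have /rowP/(_ j) := mulmxKV UA (\row_j y j); rewrite !mxE => <-.
rewrite hpoly_sum linear_sum; apply: eq_bigr => l _.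
by rewrite hpolyZ /= mcoeffZ [A _ _]mxE.
Qed.

Lemma plucker_coef_inj r U (f : {ffun 'I_r -> mon n d}) (p : hpoly n k d) :
  \dim U = r -> plucker U f != 0 -> p \in U ->
  (forall j, (p : {mpoly k[n]})@_(mnm_of_mon (f j)) = 0) -> p = 0.
Proof.
move=> dU; case: r / dU f => f nz Up p0.
pose A : 'M[k]_(\dim U) := \matrix_(i,
  j) ((vbasis U)`_i : hpoly n k d)@_(mnm_of_mon (f j)).
have UA : A \in unitmx by rewrite unitmxE unitfE.
suff /rowP c0 : \row_i coord (vbasis U) i p = 0.
  rewrite (coord_vbasis Up) big1 // => i _.
  by have := c0 i; rewrite !mxE => ->; rewrite scale0r.
apply: (can_inj (mulmxK UA)); rewrite mul0mx; apply/rowP => j.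
rewrite [RHS]mxE -(p0 j) {2}(coord_vbasis Up) hpoly_sum linear_sum mxE.
by apply: eq_bigr => l _; rewrite !mxE hpolyZ /= mcoeffZ.
Qed.

(* Cramer's rule. *)
Lemma plucker_replace r U (f : {ffun 'I_r -> mon n d}) (b : hpoly n k d) l m :
  \dim U = r -> plucker U f != 0 -> b \in U ->
  (forall j, (b : {mpoly k[n]})@_(mnm_of_mon (f j)) = (j == l)%:R) ->
  plucker U [ffun j => if j == l then m else f j]
    = (b : {mpoly k[n]})@_(mnm_of_mon m) * plucker U f.
Proof.
move=> dU; case: r / dU f l => f l nz Ub bf.
pose A : 'M[k]_(\dim U) := \matrix_(i,
  j) ((vbasis U)`_i : hpoly n k d)@_(mnm_of_mon (f j)).
pose y := \row_i coord (vbasis U) i b.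
have yA : y *m A = delta_mx ord0 l.
  apply/rowP => j; rewrite !mxE -(bf j) {1}(coord_vbasis Ub) hpoly_sum linear_sum.
  by apply: eq_bigr => i _; rewrite !mxE hpolyZ /= mcoeffZ.
have ydet i : y ord0 i * \det A = cofactor A i l.
  have := congr1 (fun M => (M *m \adj A) ord0 i) yA.
  rewrite -mulmxA mul_mx_adj mul_mx_scalar mxE mulrC => ->.
  by rewrite -rowE !mxE.
rewrite /plucker (expand_det_col _ l) {1}(coord_vbasis Ub) hpoly_sum linear_sum mulr_suml.
apply: eq_bigr => i _; rewrite hpolyZ /= mcoeffZ !mxE ffunE eqxx.
rewrite mulrAC [RHS]mulrC; congr (_ * _).
have := ydet i; rewrite mxE => ->; rewrite /cofactor; congr (_ * \det _).
by apply/matrixP => a c; rewrite !mxE ffunE eq_sym (negPf (neq_lift _ _)).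
Qed.

End Minors.

Section MonomialIdeals.
Variables (n : nat) (k : fieldType).
Implicit Types (B : set 'X_{1..n}) (m : 'X_{1..n}).

Definition upclosed B : Prop := forall m i, B m -> B (m + U_(i))%MM.

Definition mon_ideal B : set {mpoly k[n]} := [set p | forall m, m \in msupp p -> B m].

Definition exponents (J : set {mpoly k[n]}) : set 'X_{1..n} := [set m | J 'X_[m]].

Definition mons B d : {set mon n d} := [set m : mon n d | `[< B (mnm_of_mon m) >]]%SET.

Lemma upclosedD B m m' : upclosed B -> B m -> B (m + m')%MM.
Proof.
move=> uB Bm; elim/mnm_ind: m' => [|m' i IH]; first by rewrite addm0.
by rewrite addmA; exact: uB.
Qed.

Lemma mon_idealX B m : mon_ideal B 'X_[m] <-> B m.
Proof.
by split=> [|Bm m']; [apply; rewrite msuppX mem_head|rewrite msuppX inE => /eqP ->].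
Qed.

Lemma mon_ideal_is_ideal B : upclosed B -> is_ideal (mon_ideal B).
Proof.
move=> uB; split=> [m|p q Bp Bq m /msuppD_le|p q Bq m /msuppM_le].
- by rewrite msupp0.
- by rewrite mem_cat => /orP[/Bp|/Bq].
- move=> /allpairsP[[a b] /= [_ /Bq Bb ->]].
  by rewrite addmC; exact: upclosedD.
Qed.

Lemma mon_ideal_gen B : upclosed B -> mon_ideal B = ideal_gen [set 'X_[m] | m in B].
Proof.
move=> uB; rewrite eqEsubset; split=> [p Bp|]; last first.
  apply: ideal_gen_min; first exact: mon_ideal_is_ideal.
  by move=> _ [m Bm <-]; apply/mon_idealX.
set A := [set 'X_[m] | m in B]; have iA := @ideal_gen_ideal n k A.
rewrite (mpolyE p) big_seq; apply: (@ideal_sum _ _ (ideal_gen A)) => // m /Bp Bm.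
apply: (@ideal_scale _ _ (ideal_gen A)) => //.
by apply: ideal_gen_incl; exists m.
Qed.

Lemma mon_ideal_monomial B : upclosed B -> monomial_ideal (mon_ideal B).
Proof. by move=> uB; exists B; exact: mon_ideal_gen. Qed.

Lemma monomial_ideal_graded (J : set {mpoly k[n]}) : monomial_ideal J -> graded_ideal J.
Proof.
move=> [A ->]; exists [set 'X_[m] | m in A]; split=> // _ [m _ <-].
by apply/homogP; exists (mdeg m); rewrite dhomogX.
Qed.

Lemma monomial_idealE (J : set {mpoly k[n]}) : monomial_ideal J ->
  upclosed (exponents J) /\ J = mon_ideal (exponents J).
Proof.
move=> [A EJ]; pose B m := exists2 a, A a & (a <= m)%MM.
have uB : upclosed B.
  by move=> m i [a Aa am]; exists a => //; apply: lepm_trans am _; exact: lem_addr.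
suff EB : J = mon_ideal B.
  suff -> : exponents J = B by [].
  by apply/funext => m; apply/propext; rewrite /exponents /= EB; exact: mon_idealX.
rewrite EJ eqEsubset; split.
  apply: ideal_gen_min; first exact: mon_ideal_is_ideal.
  by move=> _ [a Aa <-]; apply/mon_idealX; exists a => //; exact: lepm_refl.
rewrite mon_ideal_gen //; apply: ideal_gen_min; first exact: ideal_gen_ideal.
move=> _ [m [a Aa am] <-]; rewrite -(submK am) mpolyXD.
have [_ _ GM] := @ideal_gen_ideal n k [set 'X_[m] | m in A].
by apply: GM; apply: ideal_gen_incl; exists a.
Qed.

Lemma mons_coef B d (p : hpoly n k d) : (forall m : mon n d, m \in mons B d ->
  (p : {mpoly k[n]})@_(mnm_of_mon m) = 0) -> mon_ideal B p -> p = 0.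
Proof.
move=> p0 Bp; apply: hpolyP => m; rewrite hpoly0 mcoeff0.
case: (boolP (m \in mons B d)) => [/p0 //|nBm]; apply/eqP.
rewrite mcoeff_eq0; apply: contra nBm => /Bp Bm.
by rewrite inE; apply/asboolP.
Qed.

Lemma hilbert_mon_ideal B d : upclosed B -> hilbert (mon_ideal B) d = #|mons B d|.
Proof.
move=> uB; have iB := mon_ideal_is_ideal uB; apply/eqP; rewrite eqn_leq; apply/andP;
  split.
  apply: (minor_dim_le (f := fun j : 'I_#|mons B d| => enum_val j)).
  move=> p /(mem_gpiece iB) Bp p0; apply: (mons_coef _ Bp) => m Bm.
  by have := p0 (enum_rank_in Bm m); rewrite enum_rankK_in.
apply: (@minor_dim_ge _ _ _ _ _ (fun j : 'I_#|mons B d| =>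
  to_hpoly d 'X_[mnm_of_mon (enum_val j)]) (fun j => enum_val j)) => [i|].
  apply/(mem_gpiece iB); rewrite to_hpolyK; last by rewrite dhomogX /= mdeg_mon.
  by apply/mon_idealX; have := enum_valP i; rewrite inE => /asboolP.
rewrite /minor (_ : \matrix_(i, j) _ = 1%:M) ?det1 ?oner_neq0 //.
apply/matrixP => i j; rewrite !mxE to_hpolyK; last by rewrite dhomogX /= mdeg_mon.
rewrite mcoeffX; case: (eqVneq i j) => [->|ij]; first by rewrite eqxx.
case: eqP => // /mnm_of_mon_inj/enum_val_inj e; by rewrite e eqxx in ij.
Qed.

End MonomialIdeals.

(** * The closure of an orbit *)

(** Plücker vectors transform linearly under g. As all tuples f' are summed over, the coefficients
    are products of entries rather than minors. *)
Lemma minor_act n (k : fieldType) d r (g : 'M[k]_n) (v : 'I_r -> hpoly n k d)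
    (f : 'I_r -> mon n d) : minor (fun i => lin_hpoly g (v i)) f =
  \sum_(f' : {ffun 'I_r -> mon n d})
    (\prod_j (lin_subst g 'X_[mnm_of_mon (f' j)])@_(mnm_of_mon (f j))) * minor v f'.
Proof.
rewrite -(@det_sum_expand k (mon n d) _ (fun i m => (v i : {mpoly k[n]})@_(mnm_of_mon m))
  (fun m j => (lin_subst g 'X_[mnm_of_mon m])@_(mnm_of_mon (f j)))).
congr (\det _); apply/matrixP => i j; rewrite !mxE lin_hpolyE.
rewrite {1}(sum_mon (hpoly_dhomog (v i))) lin_subst_sum linear_sum.
by apply: eq_bigr => m _; rewrite lin_substZ /= mcoeffZ.
Qed.

(** * Multigraded forms in the Plücker coordinates *)

Section PluckerRing.
Variables (n : nat) (k : fieldType) (h : nat -> nat) (D : nat).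
Local Notation index := (plucker_index n h D).
Implicit Types (F G : plucker_ring n k h D) (e : 'I_D.+1 -> nat) (xi : index -> k).

Definition multideg e F : Prop := forall m, m \in msupp F ->
  forall d, (\sum_(a | tag (plucker_var a) == d) m a)%N = e d.

Definition coord_eval F xi : k := F.@[fun a => xi (plucker_var a)].

Definition coord_var (u : index) : plucker_ring n k h D := 'X_(enum_rank u).

Lemma coord_eval_var u xi : coord_eval (coord_var u) xi = xi u.
Proof. by rewrite /coord_eval mevalXU /plucker_var enum_rankK. Qed.

Lemma multidegC c : multideg (fun=> 0%N) c%:MP.
Proof.
move=> m; rewrite msuppC; case: eqP => // _; rewrite inE => /eqP -> d.
by rewrite big1 // => a _; rewrite mnm0E.
Qed.

Lemma multideg0 e : multideg e 0.
Proof. by move=> m; rewrite msupp0. Qed.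

Lemma multidegD e F G : multideg e F -> multideg e G -> multideg e (F + G).
Proof. by move=> eF eG m /msuppD_le; rewrite mem_cat => /orP[/eF|/eG]. Qed.

Lemma multidegZ e c F : multideg e F -> multideg e (c *: F).
Proof. by move=> eF m /msuppZ_le; exact: eF. Qed.

Lemma multideg_sum e I (r : seq I) (P : pred I) (Q : I -> plucker_ring n k h D) :
  (forall i, P i -> multideg e (Q i)) -> multideg e (\sum_(i <- r | P i) Q i).
Proof.
by move=> PQ; elim/big_ind: _ => //; [exact: multideg0|exact: multidegD].
Qed.

Lemma multidegM e e' F G : multideg e F -> multideg e' G ->
  multideg (fun d => e d + e' d)%N (F * G).
Proof.
move=> eF eG m /msuppM_le/allpairsP[[a b] /= [/eF Ea /eG Eb ->]] d.
by rewrite -Ea -Eb -big_split; apply: eq_bigr => i _; rewrite mnmDE.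
Qed.

Lemma multidegX e F i : multideg e F -> multideg (fun d => i * e d)%N (F ^+ i).
Proof.
move=> eF; elim: i => [|i IH]; first by rewrite expr0 -mpolyC1; exact: multidegC.
by rewrite exprS => m mF d; rewrite mulSn (multidegM eF IH).
Qed.

Lemma multideg_prod I (r : seq I) (E : I -> 'I_D.+1 -> nat) (Q : I ->
  plucker_ring n k h D) :
  (forall i, multideg (E i) (Q i)) ->
  multideg (fun d => \sum_(i <- r) E i d)%N (\prod_(i <- r) Q i).
Proof.
move=> EQ; elim: r => [|i r IH] m; rewrite ?big_nil ?big_cons => mQ d.
  by rewrite big_nil; move: mQ; rewrite -mpolyC1 => /multidegC ->.
by rewrite big_cons; exact: (multidegM (EQ i) IH mQ).
Qed.

Lemma multideg_var u : multideg (fun d => tag u == d : nat) (coord_var u).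
Proof.
move=> m; rewrite msuppX inE => /eqP -> d.
rewrite big_mkcond (bigD1 (enum_rank u)) //= /plucker_var enum_rankK mnm1E eqxx.
rewrite big1 => [|a ne]; first by case: (_ == _).
by rewrite mnm1E [enum_rank u == a]eq_sym (negPf ne); case: (_ == _).
Qed.

Lemma coord_eval_scale e F (la : 'I_D.+1 -> k) xi : multideg e F ->
  coord_eval F (fun u => la (tag u) * xi u) = (\prod_d la d ^+ e d) * coord_eval F xi.
Proof.
move=> eF; rewrite /coord_eval !mevalE big_distrr /= big_seq [RHS]big_seq.
apply: eq_bigr => m mF; rewrite mulrCA; congr (_ * _).
under eq_bigr => a _ do rewrite exprMn.
rewrite big_split; congr (_ * _).
rewrite (partition_big (fun a => tag (plucker_var a)) predT) //=.
apply: eq_bigr => d _; rewrite -(eF m mF d) expr_sum.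
by apply: eq_bigr => a /eqP ->.
Qed.

Definition family_minors (v : forall d : 'I_D.+1, 'I_(h d) ->
  hpoly n k d) (u : index) : k :=
  minor (v (tag u)) (tagged u).

Definition plucker_coords (J : set {mpoly k[n]}) (u : index) : k :=
  plucker (gpiece J (tag u)) (tagged u).

Lemma family_minors_plucker (J : set {mpoly k[n]})
    (v : forall d : 'I_D.+1, 'I_(h d) ->
      hpoly n k d) : (forall d, hilbert J d = h d) -> is_ideal J ->
  (forall d i, J (v d i)) ->
  exists la : 'I_D.+1 -> k, forall u, family_minors v u = la (tag u) * plucker_coords J u.
Proof.
move=> hJ iJ Jv; suff /choice[la Ela] : forall d : 'I_D.+1, exists c : k,
    forall f : {ffun 'I_(h d) -> mon n d}, minor (v d) f = c * plucker (gpiece J d) f.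
  by exists la => -[d f]; exact: Ela.
move=> d; apply: minor_plucker; first exact: hJ.
by move=> i; apply/(mem_gpiece iJ).
Qed.

Definition coord_action (g : 'M[k]_n) xi (u : index) : k :=
  \sum_(f : {ffun 'I_(h (tag u)) -> mon n (tag u)})
    (\prod_j (lin_subst g 'X_[mnm_of_mon (f j)])@_(mnm_of_mon (tagged u j)))
    * xi (Tagged (fun d : 'I_D.+1 => {ffun 'I_(h d) -> mon n d}) f).

Definition action_form (g : 'M[k]_n) (u : index) : plucker_ring n k h D :=
  \sum_(f : {ffun 'I_(h (tag u)) -> mon n (tag u)})
    (\prod_j (lin_subst g 'X_[mnm_of_mon (f j)])@_(mnm_of_mon (tagged u j)))
    *: coord_var (Tagged (fun d : 'I_D.+1 => {ffun 'I_(h d) -> mon n d}) f).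

Definition act_form (g : 'M[k]_n) F : plucker_ring n k h D :=
  F \mPo [tuple action_form g (plucker_var a) | a < #|{: index}|].

Lemma coord_eval_act g F xi : coord_eval (act_form g F) xi
  = coord_eval F (coord_action g xi).
Proof.
rewrite /coord_eval comp_mpoly_meval; apply: meval_eq => a.
rewrite tnth_mktuple linear_sum /=; apply: eq_bigr => f _.
by rewrite mevalZ -/(coord_eval _ _) coord_eval_var.
Qed.

Lemma multideg_act g e F : multideg e F -> multideg e (act_form g F).
Proof.
move=> eF; rewrite /act_form comp_mpolyEX big_seq; apply: multideg_sum => m mF.
apply: multidegZ; rewrite comp_mpolyX => m' m'F d; rewrite -(eF m mF d).
suff /(_ m' m'F d) -> : multideg (fun d => \sum_a m a * (tag (plucker_var a) == d))%N
    (\prod_a tnth [tuple action_form g (plucker_var a) | a < #|{: index}|] a ^+ m a).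
  by rewrite [RHS]big_mkcond; apply: eq_bigr => a _; case: (_ == _);
    rewrite ?muln0 ?muln1.
apply: multideg_prod => a; apply: multidegX; rewrite tnth_mktuple.
by apply: multideg_sum => f _; apply: multidegZ; exact: multideg_var.
Qed.

Lemma family_minors_act g (v : forall d : 'I_D.+1, 'I_(h d) -> hpoly n k d) u :
  family_minors (fun d i => lin_hpoly g (v d i)) u = coord_action g (family_minors v) u.
Proof. exact: minor_act. Qed.

End PluckerRing.

Section Closure.
Variables (n : nat) (k : fieldType) (I : set {mpoly k[n]}) (D : nat).
Hypothesis gI : graded_ideal I.
Local Notation h := (hilbert I).
Implicit Types (J : set {mpoly k[n]}).

Definition in_orbit_closure J : Prop := hilb_scheme h J /\
  forall F : plucker_ring n k h D, multihomogeneous F ->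
  (forall J', GL_orbit I J' -> plucker_eval F J' = 0) -> plucker_eval F J = 0.

Lemma orbit_closed_atP : zariski_closed_at h D (GL_orbit I) <->
  forall J, in_orbit_closure J -> GL_orbit I J.
Proof.
split=> [[E [hE EI]] J [hJ JE]|cl].
  rewrite EI; split=> // F EF; apply: JE; first exact: hE.
  by move=> J'; rewrite EI => -[_]; apply.
exists [set F | multihomogeneous F /\ forall J, GL_orbit I J -> plucker_eval F J = 0].
split=> [F []//|]; rewrite eqEsubset; split=> [J IJ|J [hJ JE]]; last first.
  by apply: cl; split=> // F hF IF; apply: JE.
by split=> [|F [_]]; [exact: GL_orbit_hilb|apply].
Qed.

Definition basis_family J (d : 'I_D.+1) (i : 'I_(h d)) : hpoly n k d := (vbasis
  (gpiece J d))`_i.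

Lemma basis_family_mem J d i : hilb_scheme h J -> J (basis_family J (d := d) i).
Proof.
move=> [/graded_ideal_is_ideal iJ hJ]; apply/(mem_gpiece iJ).
by apply: vbasis_mem; apply: mem_nth; rewrite size_tuple -/(hilbert J d) hJ.
Qed.

Lemma plucker_coords_act g J : g \in unitmx -> hilb_scheme h J ->
  exists la : 'I_D.+1 -> k, (forall d, la d != 0) /\
    forall u : plucker_index n h D, coord_action g (plucker_coords J) u
      = la (tag u) * plucker_coords (lin_subst g @` J) u.
Proof.
move=> Ug hJ; have iJ := graded_ideal_is_ideal hJ.1.
have igJ := is_ideal_image Ug iJ.
pose w (d : 'I_D.+1) i := lin_hpoly g (basis_family J (d := d) i).
have [|d i|la Ela] := family_minors_plucker (v := w) _ igJ.
- by move=> d; rewrite hilbert_image //; exact: hJ.2.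
- by rewrite /w lin_hpolyE; exists (basis_family J i) => //; exact: basis_family_mem.
exists la; split=> [d|u]; last by rewrite -Ela; exact: esym (family_minors_act _ _ _).
(* If the factor vanished, so would all minors of the images under g; applying g^-1 would then kill
   the Plücker vector of J_d. *)
apply/eqP => la0; have [f /eqP[]] := plucker_neq0 (hJ.2 d).
pose u : plucker_index n h D := Tagged (fun d : 'I_D.+1 => {ffun 'I_(h d) -> mon n d}) f.
rewrite -[LHS]/(family_minors (basis_family J) u).
have -> : basis_family J = fun d i => lin_hpoly (invmx g) (w d i).
  apply/functional_extensionality_dep => c; apply/funext => i; apply: hpoly_inj.
  by rewrite !lin_hpolyE lin_substK.
rewrite family_minors_act /coord_action big1 // => f' _.
by rewrite Ela /= la0 mul0r mulr0.
Qed.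

(** The pullback of F by g has the same multidegree and vanishes on the orbit, which g preserves. *)
Lemma in_orbit_closure_act g J : g \in unitmx -> in_orbit_closure J ->
  in_orbit_closure (lin_subst g @` J).
Proof.
move=> Ug [hJ JE]; split.
  split; first exact: graded_ideal_image hJ.1.
  by move=> d; rewrite hilbert_image ?hJ.2 //; exact: graded_ideal_is_ideal hJ.1.
move=> F [e eF] IF.
have actE K : hilb_scheme h K -> exists2 c : k, c != 0 &
    plucker_eval (act_form g F) K = c * plucker_eval F (lin_subst g @` K).
  move=> hK; have [la [la0 Ela]] := plucker_coords_act Ug hK.
  exists (\prod_d la d ^+ e d).
    by apply/prodf_neq0 => d _; rewrite expf_neq0.
  rewrite -[LHS]/(coord_eval _ (plucker_coords K)) coord_eval_act.
  by rewrite (funext Ela) (coord_eval_scale _ _ eF).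
have [c c0 Ec] := actE _ hJ.
have := JE (act_form g F); rewrite Ec => /(_ (ex_intro _ e (multideg_act eF))).
move=> H; have /eqP : c * plucker_eval F (lin_subst g @` J) = 0.
  apply: H => J' IJ'; have [c' _ ->] := actE _ (GL_orbit_hilb gI IJ').
  by rewrite IF ?mulr0 //; apply: (GL_orbit_trans IJ'); exists g.
by rewrite mulf_eq0 (negPf c0) => /eqP.
Qed.

(** F evaluated at the minors of [v t] is a polynomial in t that vanishes for t <> 0, hence also at
    0. Independence is asked only at t = 0: elsewhere a dependent family has zero minors, so its
    scalar in front of the Plücker vector is 0. *)
Lemma in_orbit_closure_limit (char0 : [pchar k] =i pred0) K
    (v : k -> forall d : 'I_D.+1, 'I_(h d) -> hpoly n k d) :
  hilb_scheme h K ->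
  (forall d i m, polyfun (fun t => (v t d i : {mpoly k[n]})@_m)) ->
  (forall t, t != 0 -> exists2 J, GL_orbit I J & forall d i, J (v t d i)) ->
  (forall d i, K (v 0 d i)) -> (forall d : 'I_D.+1, exists f : 'I_(h d) ->
    mon n d, minor (v 0 d) f != 0) ->
  in_orbit_closure K.
Proof.
move=> hK vpoly vorb vK vfree; split=> // F [e eF] IF.
have Pol : polyfun (fun t => coord_eval F (family_minors (v t))).
  apply: (@fun_subring_meval _ _ _ (polyfun_subring k) _ F
    (fun t a => family_minors (v t) (plucker_var a))) => [|a]; first exact: polyfun_cst.
  apply: (fun_subring_det (polyfun_subring k)) => i j.
  by apply: fun_subring_ext (vpoly _ i (mnm_of_mon (tagged (plucker_var a) j))) => t;
    rewrite mxE.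
have Pol0 t : t != 0 -> coord_eval F (family_minors (v t)) = 0.
  move=> /vorb[J IJ Jv]; have hJ := GL_orbit_hilb gI IJ.
  have [la Ela] := family_minors_plucker hJ.2 (graded_ideal_is_ideal hJ.1) Jv.
  rewrite (funext Ela) (coord_eval_scale _ _ eF).
  by rewrite [coord_eval _ _](IF J IJ) mulr0.
have F0 : coord_eval F (family_minors (v 0)) = 0.
  have [t|->//|/(_ 1) /eqP] := polyfun_mul_eq0 char0 Pol (polyfun_id k);
    last by rewrite oner_eq0.
  by case: (eqVneq t 0) => [->|/Pol0 ->]; rewrite ?mulr0 ?mul0r.
have [la Ela] := family_minors_plucker hK.2 (graded_ideal_is_ideal hK.1) vK.
have nzp : \prod_d la d ^+ e d != 0.
  apply/prodf_neq0 => d _; rewrite expf_neq0 //.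
  apply/eqP => la0; have [f /eqP[]] := vfree d.
  have := Ela (Tagged (fun d : 'I_D.+1 => {ffun 'I_(h d) -> mon n d}) (finfun f)).
  rewrite /= la0 mul0r => E; rewrite -[RHS]E /family_minors /minor /=.
  by congr (\det _); apply/matrixP => i j; rewrite !mxE ffunE.
move: F0; rewrite (funext Ela) (coord_eval_scale _ _ eF) => /eqP.
by rewrite mulf_eq0 (negPf nzp) => /eqP.
Qed.

End Closure.

(** * Compression of monomial ideals *)

Section BinomialMatrix.
Variables (k : fieldType) (char0 : [pchar k] =i pred0).

(** In characteristic 0 the number C(a, b) is the value at a of a polynomial of degree b, namely a
    (a - 1) ... (a - b + 1) / b!. *)
Lemma binomial_poly r (y : nat -> k) : exists2 p : {poly k}, (size p <= r)%N &
  forall a : nat, p.[a%:R] = \sum_(b < r) y b * 'C(a, b)%:R.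
Proof.
pose q b : {poly k} := \prod_(l < b) ('X - l%:R%:P).
have qE b a : (q b).[a%:R] = (a ^_ b)%:R.
  elim: b => [|b IH]; first by rewrite /q big_ord0 hornerC ffactn0.
  rewrite /q big_ord_recr /= -/(q b) hornerM IH ffactnSr natrM !hornerE.
  case: (leqP b a) => [le|lt]; first by rewrite natrB.
  by rewrite ffact_small // !mul0r.
exists (\sum_(b < r) (y b / b`!%:R) *: q b) => [|a].
  apply: (leq_trans (size_sum _ _ _)); apply/bigmax_leqP => b _.
  apply: (leq_trans (size_scale_leq _ _)).
  by rewrite /q size_prod_XsubC /index_enum -enumT size_enum_ord.
rewrite horner_sum; apply: eq_bigr => b _; rewrite hornerZ qE -bin_ffact natrM.
rewrite -mulrA; congr (_ * _); rewrite mulrC mulfK //.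
by rewrite natr_eq0_char0 // -lt0n fact_gt0.
Qed.

(** A relation between the rows of the matrix C(s_i, b) is a polynomial of degree less than the size
    of s that vanishes at all the elements of s, hence is zero. *)
Lemma binomial_solve (s : seq nat) (b0 : 'I_(size s)) : uniq s ->
  exists c : 'I_(size s) -> k, forall b : 'I_(size s),
    \sum_i c i * 'C((nth 0%N s i), b)%:R = (b == b0)%:R.
Proof.
move=> us; pose M : 'M[k]_(size s) := \matrix_(b, i) 'C((nth 0%N s i), b)%:R.
have UM : M \in unitmx.
  rewrite -row_free_unit; apply: inj_row_free => y yM.
  pose y' a := if insub a is Some i then y ord0 i else 0.
  have y'E (i : 'I_(size s)) : y' i = y ord0 i by rewrite /y' valK.
  have [p sp pE] := binomial_poly (size s) y'.
  have p0 : p = 0.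
    apply/eqP; case: eqP => // /eqP nz; exfalso.
    have := @max_poly_roots _ p [seq i%:R | i <- s] nz.
    rewrite map_inj_uniq //; last exact: natr_inj_char0.
    rewrite size_map ltnNge sp => H; suff: false by [].
    apply: H => //; apply/allP => _ /mapP[a sa ->]; rewrite rootE pE.
    have ia : (index a s < size s)%N by rewrite index_mem.
    have /rowP/(_ (Ordinal ia)) := yM; rewrite !mxE => E; apply/eqP; rewrite -[RHS]E.
    by apply: eq_bigr => b _; rewrite !mxE y'E /= nth_index.
  (* The zero polynomial is now evaluated at 0, 1, 2, ..., which need not belong to s: as C(a, b) =
     0 for b > a, the coefficients vanish successively. *)
  suff H (a : nat) (ha : (a < size s)%N) : y' a = 0.
    by apply/rowP => i; rewrite mxE -y'E H.
  elim/ltn_ind: a ha => a IH ha.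
  have := pE a; rewrite p0 horner0 (bigD1 (Ordinal ha)) //= binn mulr1.
  rewrite big1 ?addr0 => [->//|b /eqP nb].
  have [lt|gt|e] := ltngtP b a; first by rewrite IH ?mul0r.
    by rewrite bin_small // mulr0.
  by case: nb; apply: val_inj.
exists (fun i => (invmx M *m delta_mx b0 (@ord0 0)) i ord0) => b.
have /colP/(_ b) := mulKVmx UM (delta_mx b0 (@ord0 0)).
rewrite mxE [RHS]mxE eqxx andbT => <-; apply: eq_bigr => i _.
by rewrite [M _ _]mxE mulrC.
Qed.

End BinomialMatrix.

(** * Comparison of finite sets of integers with initial segments *)

Section Counting.
Implicit Types (P Q : pred nat).

(** Q contains P and its translate P + 1, and the union of these has more elements than P unless P
    is empty. *)
Lemma count_iota_shift P Q s m : (forall a, P a -> Q a) -> (forall a, P a -> Q a.+1) ->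
  has P (iota s m) -> (count P (iota s m) < count Q (iota s m.+1))%N.
Proof.
move=> PQ PQS; have shift s' m' : (count P (iota s' m') <= count Q (iota s'.+1 m'))%N.
  elim: m' s' => // m' IH s' /=; apply: leq_add => //.
  by case Ps: (P s') => //; rewrite PQS.
elim: m s => // m IH s; rewrite /= => /orP[Ps|/IH lt].
  by rewrite Ps (PQ _ Ps) ltn_add2l; have := shift s m.+1; rewrite /= Ps.
by rewrite -addnS; apply: leq_add => //; case Ps: (P s) => //; rewrite (PQ _ Ps).
Qed.

Lemma sub_count_iota P Q s m m' : (m <= m')%N -> (forall a, P a -> Q a) ->
  (count P (iota s m) <= count Q (iota s m'))%N.
Proof.
move=> le PQ; rewrite -(subnKC le) iotaD count_cat.
exact: leq_trans (sub_count PQ _) (leq_addr _ _).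
Qed.

Lemma nth_filter_iota_ge P m i : (i < count P (iota 0 m))%N ->
  (i <= nth 0 (filter P (iota 0 m)) i)%N.
Proof.
rewrite -size_filter; set s := filter P (iota 0 m).
have ss : sorted ltn s by apply: sorted_filter (iota_ltn_sorted 0 m); exact: ltn_trans.
elim: i => // i IH lt; apply: leq_ltn_trans (IH (ltnW lt)) _.
by have := sorted_ltn_nth ltn_trans 0%N ss; apply => //; rewrite inE ltnW.
Qed.

Lemma sum_filter_iota_ge P m (f : nat -> nat) : {homo f : a b / (a < b)%N} ->
  (\sum_(i < count P (iota 0 m)) f i <= \sum_(a <- iota 0 m | P a) f a)%N.
Proof.
move=> hf; rewrite -big_filter (big_nth 0%N) big_mkord size_filter.
apply: leq_sum => i _; have := nth_filter_iota_ge (ltn_ord i).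
by rewrite leq_eqVlt => /orP[/eqP <-//|/hf/ltnW].
Qed.

(** The element of rank i of P is at least i. Equality of the sums would give equality for all i and
    make P an initial segment, against the gap at a. *)
Lemma sum_filter_iota_gt P m a (f : nat -> nat) : {homo f : a b / (a < b)%N} ->
  (a.+1 < m)%N -> ~~ P a -> P a.+1 ->
  (\sum_(i < count P (iota 0 m)) f i < \sum_(a <- iota 0 m | P a) f a)%N.
Proof.
move=> hf am nPa PSa; rewrite -big_filter (big_nth 0%N) big_mkord size_filter.
have hf' i : (i < count P (iota 0 m))%N -> (f i <= f (nth 0 (filter P (iota 0 m)) i))%N.
  by move=> /nth_filter_iota_ge; rewrite leq_eqVlt => /orP[/eqP <-//|/hf/ltnW].
rewrite ltn_neqAle leq_sum ?andbT => [|i _]; last exact: hf'.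
apply/negP => /eqP eqs.
have eqi (i : 'I_(count P (iota 0 m))) : nth 0%N (filter P (iota 0 m)) i = i.
  apply/eqP; rewrite eqn_leq nth_filter_iota_ge // andbT leqNgt; apply/negP => /hf lt.
  move/eqP: eqs; rewrite (bigD1 i) //= [X in _ == X](bigD1 i) //= ltn_eqF // -addSn.
  by apply: leq_add => //; apply: leq_sum => j _; exact: hf'.
have Sa : a.+1 \in filter P (iota 0 m) by rewrite mem_filter PSa mem_iota.
have lt : (a.+1 < count P (iota 0 m))%N.
  have ilt : (index a.+1 (filter P (iota 0 m)) < count P (iota 0 m))%N.
    by rewrite -size_filter index_mem.
  by have := eqi (Ordinal ilt); rewrite /= nth_index // => {1}->.
have := eqi (Ordinal (ltnW lt)) => /= E; case/negP: nPa.
have : nth 0%N (filter P (iota 0 m)) a \in filter P (iota 0 m).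
  by rewrite mem_nth // size_filter ltnW.
by rewrite E mem_filter => /andP[].
Qed.

End Counting.

(** * Compression along the lines of a pair of variables *)

Section Compression.
Variables (n : nat) (p q : 'I_n).
Hypothesis pq : (p < q)%N.
Implicit Types (B : set 'X_{1..n}) (m : 'X_{1..n}).

Let neqp : q == p = false.
Proof. by apply/negP => /eqP e; have := pq; rewrite e ltnn. Qed.

Let nepq : p == q = false.
Proof. by rewrite eq_sym neqp. Qed.

(* The monomials with the same (p,q)-total degree as [m] and the same other
   exponents form a line, on which they are numbered by their q-exponent. *)
Definition on_line (m : 'X_{1..n}) (a : nat) : 'X_{1..n} :=
  [multinom if i == q then a else if i == p then (m p + m q - a)%N else m i | i < n].

Definition line_length (m : 'X_{1..n}) : nat := (m p + m q).+1.

Definition line_pred B (m : 'X_{1..n}) : pred nat := fun a => `[< B (on_line m a) >].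

Definition line_count B (m : 'X_{1..n}) : nat := count (line_pred B m) (iota 0
  (line_length m)).

Definition compress B : set 'X_{1..n} := [set m : 'X_{1..n} | (m q < line_count B m)%N].

Lemma on_lineE m a i : on_line m a i =
  if i == q then a else if i == p then (m p + m q - a)%N else m i.
Proof. exact: mnmE. Qed.

Lemma on_line_id m : on_line m (m q) = m.
Proof.
apply/mnmP => i; rewrite on_lineE; case: eqP => [->//|_].
by case: eqP => [->|//]; rewrite addnK.
Qed.

Lemma on_line_sum m a : (a < line_length m)%N ->
  (on_line m a p + on_line m a q)%N = (m p + m q)%N.
Proof. by rewrite ltnS => le; rewrite !on_lineE eqxx eqxx nepq subnK. Qed.

Lemma on_line_comp m a b : (a < line_length m)%N -> on_line (on_line m a) b = on_line m b.
Proof.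
move=> lt; apply/mnmP => i; rewrite on_lineE on_line_sum // !on_lineE.
by case: eqP => // _; case: eqP.
Qed.

Lemma line_length_on_line m a : (a < line_length m)%N ->
  line_length (on_line m a) = line_length m.
Proof. by move=> lt; rewrite /line_length on_line_sum. Qed.

Lemma mdeg_bigD2 m : mdeg m = (m q + (m p + \sum_(i | (i != q) && (i != p)) m i))%N.
Proof. by rewrite mdegE (bigD1 q) //= (bigD1 p) //= nepq. Qed.

Lemma mdeg_on_line m a : (a < line_length m)%N -> mdeg (on_line m a) = mdeg m.
Proof.
move=> lt; rewrite !mdeg_bigD2 !addnA; congr (_ + _)%N; last first.
  by apply: eq_bigr => i /andP[iq ip]; rewrite on_lineE (negPf iq) (negPf ip).
by rewrite addnC on_line_sum // addnC.
Qed.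

Lemma on_lineDU m a i : i != p -> i != q ->
  on_line (m + U_(i))%MM a = (on_line m a + U_(i))%MM.
Proof.
move=> ip iq; apply/mnmP => j; rewrite mnmDE !on_lineE !mnmDE !mnm1E (negPf ip)
  (negPf iq) !addn0.
by case: eqP => [->|_]; [|case: eqP => [->|//]]; rewrite ?(negPf iq) ?(negPf ip) addn0.
Qed.

(** m x_p and m x_q lie on the same line, so i may be either. Multiplication by x_p preserves the
    position on the line, while multiplication by x_q raises it by one. *)
Lemma on_lineDp m a i : i \in [:: p; q] -> (a < line_length m)%N ->
  on_line (m + U_(i))%MM a = (on_line m a + U_(p))%MM.
Proof.
rewrite !inE ltnS => ipq le; apply/mnmP => j; rewrite mnmDE !on_lineE !mnmDE !mnm1E.
have -> : (m p + (i == p) + (m q + (i == q)) = (m p + m q).+1)%N.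
  by rewrite addnACA -[RHS]addn1; case/orP: ipq => /eqP ->; rewrite eqxx ?nepq ?neqp.
case: (eqVneq j q) => [->|jq]; first by rewrite nepq addn0.
case: (eqVneq j p) => [_|jp]; first by rewrite addn1 subSn.
by case/orP: ipq => /eqP ->; rewrite ![_ == j]eq_sym ?(negPf jp) ?(negPf jq) // addn0.
Qed.

Lemma on_lineDq m a i : i \in [:: p;
  q] -> on_line (m + U_(i))%MM a.+1 = (on_line m a + U_(q))%MM.
Proof.
rewrite !inE => ipq; apply/mnmP => j; rewrite mnmDE !on_lineE !mnmDE !mnm1E.
have -> : (m p + (i == p) + (m q + (i == q)) = (m p + m q).+1)%N.
  by rewrite addnACA -[RHS]addn1; case/orP: ipq => /eqP ->; rewrite eqxx ?nepq ?neqp.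
case: (eqVneq j q) => [_|jq]; first by rewrite addn1.
rewrite addn0; case: (eqVneq j p) => [_|jp]; first by rewrite subSS.
by case/orP: ipq => /eqP ->; rewrite ![_ == j]eq_sym ?(negPf jp) ?(negPf jq) // addn0.
Qed.

Lemma line_countDU B m i : upclosed B -> (line_count B m <= line_count B (m + U_(i)))%N.
Proof.
move=> uB; case: (boolP (i \in [:: p; q])) => [ipq|]; last first.
  rewrite !inE negb_or => /andP[ip iq].
  apply: sub_count_iota => [|a]; last first.
    by move=> /asboolP Ba; apply/asboolP; rewrite on_lineDU //; exact: uB.
  by rewrite ltnS leq_add // mnmDE leq_addr.
rewrite /line_count; set P := line_pred B m.
rewrite -(@eq_in_count _ (fun a => P a && (a < line_length m)%N)) => [|a]; last first.
  by rewrite mem_iota add0n => /andP[_ ->]; rewrite andbT.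
apply: sub_count_iota => [|a /andP[/asboolP Ba lt]].
  by rewrite ltnS leq_add // mnmDE leq_addr.
by apply/asboolP; rewrite on_lineDp //; exact: uB.
Qed.

(** If P is the set of positions of B on the line of m, multiplication by x_p and by x_q puts P and
    P + 1 into B on the next line. This gain of one compensates for the larger q-exponent in
    [upclosed_compress]. *)
Lemma line_countDq B m : upclosed B -> (0 < line_count B m)%N ->
  (line_count B m < line_count B (m + U_(q)))%N.
Proof.
move=> uB; rewrite -has_count => hP; rewrite /line_count; set P := line_pred B m in hP *.
have qpq : q \in [:: p; q] by rewrite !inE eqxx orbT.
have EP : {in iota 0 (line_length m), P =1 (fun a => P a && (a < line_length m)%N)}.
  by move=> a; rewrite mem_iota add0n => /andP[_ ->]; rewrite andbT.
have -> : line_length (m + U_(q))%MM = (line_length m).+1.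
  by rewrite /line_length !mnmDE !mnm1E neqp eqxx addn0 addn1 addnS.
rewrite (eq_in_count EP); apply: count_iota_shift => [a|a|].
- move=> /andP[/asboolP Ba lt]; apply/asboolP; rewrite on_lineDp //; exact: uB.
- move=> /andP[/asboolP Ba lt]; apply/asboolP; rewrite on_lineDq //; exact: uB.
- by rewrite -(eq_in_has EP).
Qed.

Lemma upclosed_compress B : upclosed B -> upclosed (compress B).
Proof.
move=> uB m i; rewrite /compress /= mnmDE mnm1E => lt.
case: (eqVneq i q) => [->|iq].
  by rewrite addn1; apply: leq_ltn_trans lt (line_countDq uB (leq_ltn_trans (leq0n _)
    lt)).
by rewrite addn0; exact: leq_trans lt (line_countDU m i uB).
Qed.

Lemma line_count_on_line B m a : (a < line_length m)%N ->
  line_count B (on_line m a) = line_count B m.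
Proof.
move=> lt; rewrite /line_count line_length_on_line //; apply: eq_count => b.
by rewrite /line_pred on_line_comp.
Qed.

Lemma line_count_le B m : (line_count B m <= line_length m)%N.
Proof. by rewrite -[X in (_ <= X)%N](size_iota 0); exact: count_size. Qed.

Lemma compress_on_line B m a : (a < line_length m)%N ->
  compress B (on_line m a) = (a < line_count B m)%N :> Prop.
Proof. by move=> lt; rewrite /compress /= line_count_on_line // on_lineE eqxx. Qed.

(** Each line is represented by its only monomial that is not divisible by x_q. *)
Lemma sum_lines d (G : mon n d -> nat) (F : 'X_{1..n} -> nat) :
  (forall m : mon n d, G m = F (mnm_of_mon m)) ->
  (\sum_m G m = \sum_(m : mon n d | mnm_of_mon m q == 0%N)
     \sum_(a <- iota 0 (line_length (mnm_of_mon m))) F (on_line (mnm_of_mon m) a))%N.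
Proof.
move=> GF.
have dl (m : mon n d) a : (a < line_length (mnm_of_mon m))%N ->
  mdeg (on_line (mnm_of_mon m) a) = d by move=> lt; rewrite mdeg_on_line // mdeg_mon.
pose bot (m : mon n d) : mon n d := mk_mon (dl m 0%N isT).
have botE (m : mon n d) : mnm_of_mon (bot m) = on_line (mnm_of_mon m) 0 by [].
rewrite (partition_big bot (fun m : mon n d => mnm_of_mon m q == 0%N)) => [|m _];
  last first.
  by rewrite botE on_lineE eqxx.
apply: eq_bigr => m /eqP mq; rewrite -[X in iota _ X]subn0 -/(index_iota 0 _) big_mkord.
pose sh (a : 'I_(line_length (mnm_of_mon m))) : mon n d := mk_mon (dl m a (ltn_ord a)).
rewrite (reindex sh) /=; last first.
  have lt (m' : mon n d) : bot m' == m ->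
    (mnm_of_mon m' q < line_length (mnm_of_mon m))%N.
    by move=> /eqP <-; rewrite botE line_length_on_line // ltnS leq_addl.
  exists (fun m' : mon n d => insubd (Ordinal (isT : (0 < line_length (mnm_of_mon
    m))%N)) (mnm_of_mon m' q)) => [a _|m'].
    by apply: val_inj; rewrite /= val_insubd /= on_lineE eqxx ltn_ord.
  rewrite inE => e; apply: mnm_of_mon_inj; rewrite mk_monK val_insubd lt //.
  by rewrite -(eqP e) botE on_line_comp // on_line_id.
rewrite (eq_bigl predT) => [|a]; first by apply: eq_bigr => a _; rewrite GF.
apply/eqP/mnm_of_mon_inj; rewrite botE mk_monK on_line_comp //.
by rewrite -{1}mq on_line_id.
Qed.

Lemma sum_mons B d (F : 'X_{1..n} -> nat) :
  (\sum_(m in mons B d) F (mnm_of_mon m) =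
   \sum_(m : mon n d | mnm_of_mon m q == 0%N)
     \sum_(a <- iota 0 (line_length (mnm_of_mon m)) | line_pred B (mnm_of_mon m) a)
        F (on_line (mnm_of_mon m) a))%N.
Proof.
rewrite big_mkcond (@sum_lines _ _ (fun m => if `[< B m >] then F m else 0)%N) => [|m].
  by apply: eq_bigr => m _; rewrite [RHS]big_mkcond.
by rewrite inE.
Qed.

Lemma sum_mons_compress B d (F : 'X_{1..n} -> nat) :
  (\sum_(m in mons (compress B) d) F (mnm_of_mon m) =
   \sum_(m : mon n d | mnm_of_mon m q == 0%N)
     \sum_(a < line_count B (mnm_of_mon m)) F (on_line (mnm_of_mon m) a))%N.
Proof.
rewrite sum_mons; apply: eq_bigr => m _; set c := line_count _ _.
rewrite -[X in iota _ X]subn0 -/(index_iota 0 _) big_mkord.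
rewrite (big_ord_widen_cond _ predT (fun a =>
  F (on_line (mnm_of_mon m) a)) (line_count_le B _)).
apply: eq_bigl => a; rewrite /line_pred compress_on_line //.
by apply/asboolP/idP.
Qed.

Lemma card_mons_compress B d : #|mons (compress B) d| = #|mons B d|.
Proof.
rewrite -!sum1_card (sum_mons_compress B d (fun=> 1%N)) (sum_mons B d (fun=> 1%N)).
by apply: eq_bigr => m _; rewrite sum1_count sum1_card card_ord.
Qed.

(** Replacing x_p by x_q raises this weight as soon as p < q, so one and the same potential controls
    the compressions for all pairs of variables. *)
Definition index_weight (m : 'X_{1..n}) : nat := \sum_(i < n) i * m i.

Lemma index_weight_on_line m :
  {homo (fun a => index_weight (on_line m a)) : a b / (a < b)%N}.
Proof.
have E a : index_weight (on_line m a) = (q * a + (p * (m p + m q - a) +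
    \sum_(i < n | (i != q) && (i != p)) i * m i))%N.
  rewrite /index_weight (bigD1 q) //= (bigD1 p) /= ?nepq //.
  rewrite !on_lineE !eqxx nepq; congr (_ + (_ + _))%N.
  by apply: eq_bigr => i /andP[iq ip]; rewrite on_lineE (negPf iq) (negPf ip).
apply: homo_ltn; first exact: ltn_trans.
move=> a; rewrite !E !addnA ltn_add2r mulnS.
case: (leqP (m p + m q) a) => [le|lt].
  have /eqP -> : (m p + m q - a == 0)%N by rewrite subn_eq0.
  have /eqP -> : (m p + m q - a.+1 == 0)%N by rewrite subn_eq0 leqW.
  by rewrite !muln0 !addn0 -[X in (X < _)%N]add0n ltn_add2r; exact: leq_ltn_trans pq.
rewrite -(@subnSK a (m p + m q)) // mulnS addnA ltn_add2r addnC ltn_add2r //.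
Qed.

Definition total_index_weight B d : nat := \sum_(m in mons B d) index_weight
  (mnm_of_mon m).

Lemma total_index_weight_compress_le B d :
  (total_index_weight (compress B) d <= total_index_weight B d)%N.
Proof.
rewrite /total_index_weight sum_mons_compress sum_mons; apply: leq_sum => m _.
exact/sum_filter_iota_ge/index_weight_on_line.
Qed.

Lemma total_index_weight_compress_lt B m : B (m + U_(q))%MM -> ~ B (m + U_(p))%MM ->
  (total_index_weight (compress B) (mdeg m).+1 < total_index_weight B (mdeg m).+1)%N.
Proof.
move=> Bq nBp; rewrite /total_index_weight sum_mons_compress sum_mons.
pose M := (m + U_(q))%MM.
have lt0 : (0 < line_length M)%N by [].
have dM : mdeg (on_line M 0) = (mdeg m).+1 by rewrite mdeg_on_line // mdegD mdeg1 addn1.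
pose m0 := mk_mon dM.
have m0q : mnm_of_mon m0 q == 0%N by rewrite mk_monK on_lineE eqxx.
rewrite (bigD1 m0) //= [X in (_ < X)%N](bigD1 m0) //= -addSn; apply: leq_add; last first.
  apply: leq_sum => m' _; exact/sum_filter_iota_ge/index_weight_on_line.
have onM a : on_line (mnm_of_mon m0) a = on_line M a by rewrite mk_monK on_line_comp.
(* x_p m and x_q m occupy the consecutive positions m q and m q + 1 of the same line: the first is a
   gap of B, the second is in B. *)
apply: (@sum_filter_iota_gt _ _ (m q)); first exact: index_weight_on_line.
- by rewrite mk_monK line_length_on_line // /line_length /M !mnmDE !mnm1E neqp eqxx
  addn0 addn1 addnS !ltnS leq_addl.
- apply/asboolPn; rewrite onM /M on_lineDp ?inE ?eqxx ?orbT //.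
    by rewrite on_line_id.
  by rewrite ltnS leq_addl.
- by apply/asboolP; rewrite onM /M on_lineDq ?inE ?eqxx ?orbT // on_line_id.
Qed.

End Compression.

(** * The shears that degenerate an ideal to its compression *)

Section Shear.
Variables (n : nat) (k : fieldType) (p q : 'I_n).
Hypothesis pq : (p < q)%N.

Let neqp : q == p = false.
Proof. by apply/negP => /eqP e; have := pq; rewrite e ltnn. Qed.

Let nepq : p == q = false.
Proof. by rewrite eq_sym neqp. Qed.

(* x_q |-> t x_q + x_p *)
Definition shear (t : k) : 'M[k]_n :=
  \matrix_(i, j) if j == q then t * (i == q)%:R + (i == p)%:R else (i == j)%:R.

Lemma shear_unit t : t != 0 -> shear t \in unitmx.
Proof.
move=> t0; rewrite -row_free_unit; apply: inj_row_free => y /rowP y0.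
have yj j : j != q -> y ord0 j = 0.
  move=> jq; have := y0 j; rewrite !mxE (bigD1 j) //= mxE (negPf jq) eqxx mulr1.
  rewrite big1 ?addr0 // => i ij; by rewrite mxE (negPf jq) (negPf ij) mulr0.
apply/rowP => j; rewrite [RHS]mxE; case: (eqVneq j q) => [->|/yj //].
have := y0 q; rewrite !mxE (bigD1 q) //= mxE !eqxx neqp addr0 mulr1.
rewrite big1 ?addr0 => [|i iq]; last by rewrite yj // mul0r.
by move/eqP; rewrite mulf_eq0 (negPf t0) orbF => /eqP.
Qed.

Lemma shearXq t : lin_subst (shear t) 'X_q = t *: 'X_q + 'X_p.
Proof.
rewrite lin_substXU (bigD1 q) // (bigD1 p) /= ?nepq // big1 ?addr0 => [|i /andP[iq ip]].
  by rewrite !mxE !eqxx nepq neqp mulr1 addr0 mulr0 add0r scale1r.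
by rewrite mxE eqxx (negPf iq) (negPf ip) mulr0 addr0 scale0r.
Qed.

Lemma shearX t j : j != q -> lin_subst (shear t) 'X_j = 'X_j.
Proof.
move=> jq; rewrite lin_substXU (bigD1 j) //= big1 ?addr0 => [|i ij].
  by rewrite mxE (negPf jq) eqxx scale1r.
by rewrite mxE (negPf jq) (negPf ij) scale0r.
Qed.

Lemma shear_monomial t (m : 'X_{1..n}) : m q = 0%N -> lin_subst (shear t) 'X_[m] = 'X_[m].
Proof.
elim/mnm_ind: m => [|m i IH]; first by rewrite mpolyX0 -mpolyC1 lin_substC.
rewrite mnmDE mnm1E => /eqP; rewrite addn_eq0 => /andP[/eqP mq].
case: (eqVneq i q) => // iq _.
by rewrite mpolyXD lin_substM IH // shearX.
Qed.

(** The binomial theorem for (t x_q + x_p)^a. As C(a, b) = 0 for b > a, b can run over the whole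
    line, a range independent of a. *)
Lemma shear_on_line t m a : (a < line_length p q m)%N ->
  lin_subst (shear t) 'X_[on_line p q m a] =
  \sum_(b < line_length p q m) ('C(a, b)%:R * t ^+ b) *: 'X_[on_line p q m b].
Proof.
rewrite ltnS => le; pose r : 'X_{1..n} := [multinom if (i == q) || (i == p) then 0%N
  else m i | i < n].
have E b : (b <= m p + m q)%N ->
    on_line p q m b = (r + (U_(q) *+ b + U_(p) *+ (m p + m q - b)))%MM.
  move=> leb; apply/mnmP => i; rewrite on_lineE !mnmDE !mulmnE !mnm1E mnmE.
  case: (eqVneq i q) => [->|iq]; first by rewrite nepq mul1n mul0n addn0 add0n.
  rewrite mul0n add0n.
  by case: (eqVneq i p) => [_|ip]; rewrite ?mul1n ?mul0n ?addn0.
rewrite E // !mpolyXD -!mpolyXn !lin_substM shear_monomial ?mnmE ?eqxx //.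
have substX c l : lin_subst (shear t) ('X_c ^+ l) = lin_subst (shear t) 'X_c ^+ l.
  by rewrite /lin_subst rmorphXn.
rewrite !substX shearXq (shearX t (j := p)) ?nepq // addrC exprDn.
have la : (a.+1 <= line_length p q m)%N by [].
rewrite [RHS](bigID (fun b : 'I__ => b < a.+1)%N) /= [X in _ = _ + X]big1 ?addr0;
  last first.
  by move=> b; rewrite -ltnNge => lt; rewrite bin_small // mul0r scale0r.
rewrite -(big_ord_widen _ (fun b => ('C(a, b)%:R * t ^+ b) *: 'X_[on_line p q m b]) la).
rewrite mulr_suml mulr_sumr; apply: eq_bigr => b _.
have leb : (b <= m p + m q)%N by apply: leq_trans le; rewrite -ltnS.
rewrite E // !mpolyXD -!mpolyXn exprZn.
have -> : (m p + m q - b = (a - b) + (m p + m q - a))%N.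
  by rewrite [RHS]addnC addnBA ?subnK // -ltnS.
rewrite exprD -mulr_natl -!mul_mpolyC mpolyCM mpolyC_nat.
move: 'X_[r] (_%:R) ('X_p ^+ (a - b)) (_%:MP) ('X_q ^+ b) ('X_p ^+ _) => A c P s Q K.
by rewrite [P * (s * Q)]mulrCA [P * Q]mulrC -!mulrA mulrCA; congr (_ * _); rewrite mulrCA.
Qed.

End Shear.

Section CompressionLimit.
Variables (n : nat) (k : fieldType) (char0 : [pchar k] =i pred0).
Variables (I : set {mpoly k[n]}) (gI : graded_ideal I).
Variables (p q : 'I_n) (B : set 'X_{1..n}).
Hypotheses (pq : (p < q)%N) (uB : upclosed B) (IB : GL_orbit I (mon_ideal B)).
Local Notation line := (on_line p q).
Local Notation len := (line_length p q).
Local Notation cnt := (line_count p q B).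

(** The shear sends the monomial at position a to the sum of the C(a, b) t^b times the one at
    position b. By invertibility of the binomial matrix, combinations of the monomials of B on the
    line can have any coefficients c_b at the first [cnt m] positions; those of a unit vector are
    chosen. *)
Lemma compress_echelon (m : 'X_{1..n}) : compress p q B m ->
  exists2 c : nat -> k, forall b, (b < cnt m)%N -> c b = (b == m q)%:R &
    forall t, (lin_subst (shear p q t) @` mon_ideal B)
      (\sum_(b < len m) (c b * t ^+ b) *: 'X_[line m b]).
Proof.
rewrite /compress /= => lt; pose s := filter (line_pred p q B m) (iota 0 (len m)).
have sz : size s = cnt m by rewrite size_filter.
have lts : (m q < size s)%N by rewrite sz.
have [c Ec] := binomial_solve char0 (Ordinal lts) (filter_uniq _ (iota_uniq _ _)).
exists (fun b => \sum_i c i * 'C(nth 0%N s i, b)%:R) => [b|t].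
  by rewrite -sz => ltb; rewrite (Ec (Ordinal ltb)) -val_eqE.
have sP (i : 'I_(size s)) : (nth 0%N s i < len m)%N /\ B (line m (nth 0%N s i)).
  have := mem_nth 0%N (ltn_ord i); rewrite mem_filter mem_iota => /andP[/asboolP Bi].
  by rewrite add0n.
exists (\sum_i c i *: 'X_[line m (nth 0%N s i)]).
  have iB := mon_ideal_is_ideal k uB.
  apply: (@ideal_sum _ _ (mon_ideal B)) => // i _;
    apply: (@ideal_scale _ _ (mon_ideal B)) => //.
  by apply/mon_idealX; exact: (sP i).2.
rewrite lin_subst_sum; under [LHS]eq_bigr => i _.
  rewrite lin_substZ shear_on_line ?(sP i).1 // scaler_sumr.
  over.
rewrite exchange_big; apply: eq_bigr => b _ /=.
under eq_bigr => i _ do rewrite scalerA.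
rewrite -scaler_suml; congr (_ *: _); rewrite mulr_suml.
by apply: eq_bigr => i _; rewrite mulrA.
Qed.

Lemma mon_ideal_compress_hilb : hilb_scheme (hilbert I) (mon_ideal (compress p q B) :
  set {mpoly k[n]}).
Proof.
have uC := upclosed_compress pq uB; split.
  exact/monomial_ideal_graded/mon_ideal_monomial.
move=> d; rewrite hilbert_mon_ideal // card_mons_compress //.
by rewrite -(GL_orbit_hilb gI IB).2 hilbert_mon_ideal.
Qed.

Lemma mon_ideal_compress_closure D :
  in_orbit_closure I D (mon_ideal (compress p q B) : set {mpoly k[n]}).
Proof.
have uC := upclosed_compress pq uB; set C := compress p q B in uC *.
have hC : forall d, hilbert I d = #|mons C d|.
  by move=> d; rewrite -mon_ideal_compress_hilb.2 hilbert_mon_ideal.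
pose f d (i : 'I_(hilbert I d)) : mon n d := enum_val (cast_ord (hC d) i).
have fC d i : C (mnm_of_mon (f d i)).
  by have := enum_valP (cast_ord (hC d) i); rewrite inE => /asboolP.
have finj d : injective (f d) by move=> i j /enum_val_inj/cast_ord_inj.
have /choice[c Ec] : forall m : 'X_{1..n}, exists c : nat -> k, C m ->
    (forall b, (b < cnt m)%N -> c b = (b == m q)%:R) /\
    forall t, (lin_subst (shear p q t) @` mon_ideal B)
      (\sum_(b < len m) (c b * t ^+ b) *: 'X_[line m b]).
  move=> m; case: (pselect (C m)) => [Cm|nCm]; last by exists (fun=> 0).
  by have [c c1 c2] := compress_echelon Cm; exists c.
(* The element of [compress_echelon] divided by t^(m q). The exponents b - m q are positive, because
   m q < cnt m <= b, so the quotient is polynomial in t and equals m at t = 0. *)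
pose w t (m : 'X_{1..n}) : {mpoly k[n]} := 'X_[m] +
  \sum_(b < len m | (cnt m <= b)%N) (c m b * t ^+ (b - m q)) *: 'X_[line m b].
have wh t d (m : mon n d) : w t (mnm_of_mon m) \is d.-homog.
  apply: rpredD; first by rewrite dhomogX /= mdeg_mon.
  by apply: rpred_sum => b _; apply: rpredZ; rewrite dhomogX /= mdeg_on_line // mdeg_mon.
pose v t (d : 'I_D.+1) i : hpoly n k d := to_hpoly d (w t (mnm_of_mon (f d i))).
have vE t d i : (v t d i : {mpoly k[n]}) = w t (mnm_of_mon (f d i)).
  by rewrite to_hpolyK.
have w0 m : C m -> w 0 m = 'X_[m].
  rewrite /w => Cm; rewrite big1 ?addr0 // => b le.
  by rewrite expr0n subn_eq0 leqNgt (leq_trans Cm le) mulr0 scale0r.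
apply: (in_orbit_closure_limit gI char0 (v := v)) => [|d i m|t t0|d i|d].
- exact: mon_ideal_compress_hilb.
- apply: (fun_subring_ext (f := fun t => ('X_[mnm_of_mon (f d i)])@_m +
    \sum_(b < len (mnm_of_mon (f d i)) | (cnt (mnm_of_mon (f d i)) <= b)%N)
     c (mnm_of_mon (f d i)) b * t ^+ (b - mnm_of_mon (f d i) q) * ('X_[line
       (mnm_of_mon (f d i)) b])@_m)).
    move=> t; rewrite vE mcoeffD linear_sum; congr (_ + _).
    by apply: eq_bigr => b _; rewrite /= mcoeffZ.
  have PS := polyfun_subring k; apply: (fun_subringD PS); first exact: polyfun_cst.
  apply: (fun_subring_sum PS) => b _; apply: (fun_subringM PS); last exact: polyfun_cst.
  apply: (fun_subringM PS); first exact: polyfun_cst.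
  by apply: (fun_subringX PS); exact: polyfun_id.
- exists (lin_subst (shear p q t) @` mon_ideal B).
    by apply: (GL_orbit_trans IB); exists (shear p q t) => //; exact: shear_unit.
  move=> d i; rewrite vE; have Cm := fC d i; move: (mnm_of_mon _) Cm => m Cm.
  have [c1 c2] := Ec m Cm.
  have iJ := is_ideal_image (shear_unit pq t0) (mon_ideal_is_ideal k uB).
  have /= lt : (m q < cnt m)%N by exact: Cm.
  have ltl : (m q < len m)%N := leq_trans lt (line_count_le _ _ _ _).
  suff -> : w t m = (t ^- m q) *: (\sum_(b < len m) (c m b * t ^+ b) *: 'X_[line m b]).
    exact: (@ideal_scale _ _ (lin_subst (shear p q t) @` mon_ideal B)).
  rewrite (bigID (fun b : 'I__ => cnt m <= b)%N) /= addrC scalerDr; congr (_ + _).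
    rewrite (bigD1 (Ordinal ltl)) -?ltnNge //= c1 // eqxx mul1r on_line_id big1 ?addr0.
      by rewrite scalerA mulVf ?scale1r // expf_neq0.
    move=> b /andP[]; rewrite -ltnNge => /c1 -> ne.
    by rewrite -val_eqE in ne; rewrite (negPf ne) mul0r scale0r.
  rewrite scaler_sumr; apply: eq_bigr => b le; rewrite scalerA; congr (_ *: _).
  rewrite mulrCA; congr (_ * _); rewrite -[in RHS](subnK (ltnW (leq_trans lt le))) exprD.
  by rewrite mulrCA mulVf ?mulr1 // expf_neq0.
- by rewrite vE w0 //; apply/mon_idealX.
- exists (f d); rewrite /minor (_ : \matrix_(i, j) _ = 1%:M) ?det1 ?oner_neq0 //.
  apply/matrixP => i j; rewrite !mxE vE w0 // mcoeffX.
  by rewrite (inj_eq (@mnm_of_mon_inj _ _)) (inj_eq (@finj _)).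
Qed.

End CompressionLimit.

(** * Totality of the preorder of a closed orbit *)

Section StronglyStable.
Variables (n : nat) (k : fieldType) (char0 : [pchar k] =i pred0).
Variables (I : set {mpoly k[n]}) (monI : monomial_ideal I).

(* Every monomial ideal in the orbit minimizing the total weight of its
   monomials in degrees <= d is strongly stable in these degrees, because a
   compression would otherwise decrease the weight. *)
Lemma closed_orbit_strongly_stable D d :
  (forall J, in_orbit_closure I D J -> GL_orbit I J) ->
  exists B : set 'X_{1..n}, [/\ upclosed B, GL_orbit I (mon_ideal B) &
    forall (p q : 'I_n) m, (p < q)%N -> (mdeg m < d)%N -> B (m + U_(q))%MM ->
      B (m + U_(p))%MM].
Proof.
move=> cl; have gI := monomial_ideal_graded monI.
pose W (B : set 'X_{1..n}) := (\sum_(e < d.+1) total_index_weight B e)%N : nat.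
pose P N := `[< exists B : set 'X_{1..n}, [/\ upclosed B,
  GL_orbit I (mon_ideal B) & W B = N] >].
have exP : exists N, P N.
  have [uI EI] := monomial_idealE monI; exists (W (exponents I)); apply/asboolP.
  by exists (exponents I); split; rewrite -?EI //; exact: GL_orbit_refl.
case: (ex_minnP exP) => N /asboolP[B [uB IB <-]] minN.
exists B; split=> // p q m pq md Bq; apply: contrapT => nBp.
have := minN (W (compress p q B)); rewrite leqNgt => H;
  suff /negP : ~~ (W (compress p q B) < W B)%N.
  apply; rewrite /W (bigD1 (Ordinal (md : ((mdeg m).+1 < d.+1)%N))) //=.
  rewrite [X in (_ < X)%N](bigD1 (Ordinal (md : ((mdeg m).+1 < d.+1)%N))) //= -addSn.
  apply: leq_add; first exact: total_index_weight_compress_lt.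
  by apply: leq_sum => e _; exact: total_index_weight_compress_le.
apply: H; apply/asboolP; exists (compress p q B); split=> //.
  exact: upclosed_compress.
by apply: cl; exact: mon_ideal_compress_closure.
Qed.

End StronglyStable.

Section TotalPreorder.
Variables (n : nat) (k : fieldType) (char0 : [pchar k] =i pred0).
Implicit Types (B : set 'X_{1..n}) (m : 'X_{1..n}).

(** A truncation of the preorder: strong stability is known only in degrees at most d, that is, for
    multipliers of degree less than d. *)
Definition le_below B (d : nat) (i j : 'I_n) : Prop :=
  forall m, (mdeg m < d)%N -> B (m + U_(i))%MM -> B (m + U_(j))%MM.

Lemma le_below_trans B d i j l : le_below B d i j -> le_below B d j l -> le_below B d i l.
Proof. by move=> ij jl m md /(ij m md)/(jl m md). Qed.

Lemma lin_deriv_delta p q (f : {mpoly k[n]}) : lin_deriv (delta_mx p q) f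
  = 'X_p * f^`M(q).
Proof.
rewrite /lin_deriv (bigD1 p) //= (bigD1 q) //= mxE !eqxx scale1r.
rewrite big1 => [|j jq]; last by rewrite mxE (negPf jq) andbF scale0r.
rewrite addr0 big1 ?addr0 // => i ip; rewrite big1 // => j _.
by rewrite mxE (negPf ip) scale0r.
Qed.

Lemma stable_lin_deriv B d (p q : 'I_n) (f : {mpoly k[n]}) : upclosed B ->
  le_below B d q p ->
  mon_ideal B f -> (forall m, m \in msupp f -> mdeg m <= d)%N ->
  mon_ideal B (lin_deriv (delta_mx p q) f).
Proof.
move=> uB qp Bf df; have iB := mon_ideal_is_ideal k uB.
rewrite lin_deriv_delta (mpolyE f) linear_sum mulr_sumr big_seq.
apply: (@ideal_sum _ _ (mon_ideal B)) => // m mf.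
rewrite /= mderivZ -scalerAr; apply: (@ideal_scale _ _ (mon_ideal B)) => //.
rewrite mderivX -scalerAr -mpolyXD.
case: (eqVneq (m q) 0%N) => [->|mq]; first by rewrite scale0r; case: iB.
apply: (@ideal_scale _ _ (mon_ideal B)) => //; apply/mon_idealX.
have Em : m = (m - U_(q) + U_(q))%MM by rewrite submK // lep1mP.
rewrite addmC; apply: qp; last by rewrite -Em; exact: Bf.
by have := df m mf; rewrite {1}Em mdegD mdeg1 addn1.
Qed.

(** A monomial ideal contains each monomial of its elements; by [mcoeff_lin_derivX], x_a m occurs in
    the derivative of x_b m when A_ab is nonzero and a <> b. *)
Lemma lin_deriv_mon_ideal_entry B d (A : 'M[k]_n) : 
  (forall m, (mdeg m <= d)%N -> B m -> mon_ideal B (lin_deriv A 'X_[m])) ->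
  forall a b, A a b != 0 -> le_below B d b a.
Proof.
move=> AB a b Aab m md Bm; case: (eqVneq a b) => [->//|ab].
apply: (AB (m + U_(b))%MM) => //; first by rewrite mdegD mdeg1 addn1.
rewrite mcoeff_msupp mcoeff_lin_derivX // mulf_neq0 //.
by rewrite natr_eq0_char0.
Qed.

(** A subspace stable under upper triangular matrices is spanned by an initial segment of the basis:
    from a vector with a nonzero coordinate q, the elementary matrix E_pq extracts e_p for every p
    <= q. *)
Lemma borel_stable_chain (V W : 'cV[k]_n -> Prop) :
  (forall U, U = V \/ U = W -> [/\ forall u v, U u -> U v -> U (u + v), U 0,
     forall c u, U u -> U (c *: u) & forall (p q : 'I_n) u, (p <= q)%N -> U u ->
       U (delta_mx p q *m u)]) ->
  (forall u, V u -> W u) \/ (forall u, W u -> V u).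
Proof.
move=> H; have [VD V0 VZ VB] := H V (or_introl erefl).
have [WD W0 WZ WB] := H W (or_intror erefl).
have Ecol (u : 'cV[k]_n) : u = \sum_q u q ord0 *: delta_mx q ord0.
  rewrite [LHS]matrix_sum_delta; apply: eq_bigr => q _.
  by rewrite big_ord1.
have dmul (p q : 'I_n) (u : 'cV[k]_n) : u q ord0 != 0 ->
  delta_mx p ord0 = (u q ord0)^-1 *: (delta_mx p q *m u).
  move=> nz; apply/colP => i; rewrite !mxE (bigD1 q) //= mxE !eqxx !andbT.
  rewrite big1 ?addr0 => [|l lq]; last by rewrite mxE (negPf lq) andbF mul0r.
  by rewrite mulrCA mulVf // mulr1.
case: (pselect (forall u, V u -> W u)) => [|/existsNP[v /not_implyP[Vv nWv]]];
  first by left.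
right=> w Ww; have [q vq nWq] : exists2 q, v q ord0 != 0 & ~ W (delta_mx q ord0).
  apply: contrapT => no; apply: nWv; rewrite (Ecol v); elim/big_ind: _ => // q _.
  case: (eqVneq (v q ord0) 0) => [->|nz]; first by rewrite scale0r.
  by apply: WZ; apply: contrapT => nW; apply: no; exists q.
rewrite (Ecol w); elim/big_ind: _ => // p _.
case: (eqVneq (w p ord0) 0) => [->|nz]; first by rewrite scale0r.
apply: (VZ); case: (leqP p q) => [le|lt].
  by rewrite (dmul p q v vq); apply: VZ; exact: VB.
by case: nWq; rewrite (dmul q p w nz); apply: WZ; apply: WB => //; exact: ltnW.
Qed.

End TotalPreorder.

Section ClosedOrbitTotal.
Variables (n : nat) (k : fieldType) (char0 : [pchar k] =i pred0).
Variables (I : set {mpoly k[n]}) (monI : monomial_ideal I).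

Lemma closed_orbit_le_below_total D d :
  (forall J, in_orbit_closure I D J -> GL_orbit I J) ->
  forall i j, le_below (exponents I) d i j \/ le_below (exponents I) d j i.
Proof.
move=> cl; have [B [uB [g /= Ug EB] stB]] := closed_orbit_strongly_stable char0 monI d cl.
have [uI EI] := monomial_idealE monI; set E := exponents I in uI EI *.
have Bpq (p q : 'I_n) : (p <= q)%N -> le_below B d q p.
  rewrite leq_eqVlt => /orP[/eqP/val_inj ->//|pq] m md; exact: stB.
(* As E_pq preserves g I in degrees at most d when p <= q, its conjugate by g^-1 preserves I in
   these degrees. *)
pose A (p q : 'I_n) := invmx g *m delta_mx p q *m g.
have AE (p q : 'I_n) a b : (p <= q)%N -> A p q a b != 0 -> le_below E d b a.
  move=> pq; apply: (lin_deriv_mon_ideal_entry char0) => m md Em.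
  have com : invmx g *m delta_mx p q = A p q *m invmx g by rewrite /A mulmxK.
  have Em' : E m = I 'X_[m] by [].
  rewrite -EI -(lin_substK Ug 'X_[m]) -(lin_subst_lin_deriv _ com).
  rewrite Em' in Em; rewrite -lin_subst_imageE // EB.
  apply: stable_lin_deriv (Bpq _ _ pq) _ _ => //; first by rewrite -EB; exists 'X_[m].
  by move=> m' /(dhomog_mf (lin_subst_dhomogX g m)) /= ->.
(* The image under g of the span of the variables above x_i. It is stable under all E_pq with p <=
   q, since their conjugates A p q only move variables upwards. *)
pose V i (u : 'cV[k]_n) : Prop := forall l, (invmx g *m u) l ord0 != 0 ->
  le_below E d i l.
have Vchain i j := @borel_stable_chain n k (V i) (V j).
(* The vector g e_i is in V i; its membership in V j says that x_i is above x_j. *)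
have sub i j : (forall u, V i u -> V j u) -> le_below E d j i.
  move=> /(_ (g *m delta_mx i ord0)); rewrite /V mulKmx // => H; apply: H.
    by move=> l; rewrite mxE andbT; case: (eqVneq l i) => [-> _ m //|_];
      rewrite mulr0n eqxx.
  by rewrite mxE !eqxx oner_neq0.
move=> i j; have [|/sub|/sub] := Vchain i j; [|by right|by left].
move=> U HU; have {HU}[c ->] : exists c, U = V c by case: HU => ->; [exists i|exists j].
split=> [u v Vu Vv l|l|a u Vu l|p q u pq Vu l].
- rewrite mulmxDr mxE; case: (eqVneq ((invmx g *m u) l ord0) 0) => [->|/Vu //].
  by rewrite add0r; exact: Vv.
- by rewrite mulmx0 mxE eqxx.
- by rewrite -scalemxAr mxE mulf_eq0 negb_or => /andP[_ /Vu].
- have -> : invmx g *m (delta_mx p q *m u) = A p q *m (invmx g *m u).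
    by rewrite /A -!mulmxA mulKVmx.
  rewrite mxE => nz; have [b nzb] : exists b, A p q l b * (invmx g *m u) b ord0 != 0.
    by apply: contrapT => no; case/negP: nz; rewrite big1 // => b _;
      apply/eqP/negPn/negP => nb; apply: no; exists b.
  move: nzb; rewrite mulf_eq0 negb_or => /andP[Alb /Vu cb].
  exact: le_below_trans cb (AE _ _ _ _ pq Alb).
Qed.

Lemma closed_orbit_total D : (forall J, in_orbit_closure I D J -> GL_orbit I J) ->
  total_preorder (ideal_le I).
Proof.
move=> cl; split=> [i m //|x y z xy yz m /xy/yz //|i j].
apply: contrapT => /not_orP[/existsNP[m /not_implyP[im njm]] /existsNP[m'
  /not_implyP[jm nim]]].
have E l (c : 'X_{1..n}) : I ('X_l * 'X_[c]) = exponents I (c + U_(l))%MM.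
  by rewrite /exponents /= addmC mpolyXD.
rewrite !E in im njm jm nim.
(* d exceeds the degrees of both witnesses of incomparability. *)
have [H|H] := closed_orbit_le_below_total (mdeg m + mdeg m').+1 cl i j.
  by apply: njm; apply: H => //; rewrite ltnS leq_addr.
by apply: nim; apply: H => //; rewrite ltnS leq_addl.
Qed.

End ClosedOrbitTotal.

(** * Generic position *)

Section LinearAlgebra.
Variables (k : fieldType) (N : nat).

Lemma finite_spanning_family (T : Type) (z : T -> 'rV[k]_N) :
  exists s (G : 'I_s -> T), row_free (\matrix_i z (G i)) /\
    forall t, (z t <= \matrix_i z (G i))%MS.
Proof.
pose P s := `[< exists G : 'I_s -> T, row_free (\matrix_i z (G i)) >].
have exP : exists s, P s.
  exists 0%N; apply/asboolP.
  exists (fun i : 'I_0 => False_rect T (notF (ltn_ord i))).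
  by rewrite -row_leq_rank.
have ub s : P s -> (s <= N)%N.
  by move=> /asboolP[G /eqP <-]; exact: rank_leq_col.
case: (ex_maxnP exP ub) => s /asboolP[G rG] maxs.
exists s, G; split=> // t; apply/negPn/negP => nt.
suff /maxs : P s.+1 by rewrite ltnn.
apply/asboolP; exists (fun i : 'I_s.+1 => if unlift ord0 i is Some j then G j else t).
apply: inj_row_free => y /= y0.
pose y1 : 'rV[k]_s := \row_j y ord0 (lift ord0 j).
have {}y0 : y ord0 ord0 *: z t + y1 *m (\matrix_i z (G i)) = 0.
  rewrite -y0; apply/rowP => c; rewrite !mxE big_ord_recl mxE unlift_none.
  by congr (_ + _); apply: eq_bigr => j _; rewrite !mxE liftK.
have yt : y ord0 ord0 = 0.
  apply/eqP; apply: contraNT nt => nz; apply/submxP; exists (- (y ord0 ord0)^-1 *: y1).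
  apply: (can_inj (scalerK nz)); rewrite -scalemxAl scalerA mulrN divff // scaleN1r.
  by apply/eqP; rewrite -addr_eq0 y0.
move: y0; rewrite yt scale0r add0r => y10.
apply/rowP => i; rewrite [RHS]mxE; case: (unliftP ord0 i) => [j|] -> //.
have /rowP/(_ j) : y1 = 0 by apply: (row_free_inj rG); rewrite mul0mx.
by rewrite !mxE.
Qed.

End LinearAlgebra.

(** The Gram determinant is the image of an integer. If this integer were 0, some nonzero integral y
    would satisfy y G = 0, so the positive definite form would vanish at y X; then y X = 0, against
    the independence of the rows. *)
Lemma int_gram_unit (k : fieldType) (char0 : [pchar k] =i pred0) s N
    (X : 'M[int]_(s, N)) (w : 'I_N -> nat) :
  (forall c, 0 < w c)%N -> row_free (map_mx intr X : 'M[k]_(s, N)) ->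
  (map_mx intr (\matrix_(i, j) \sum_c (w c)%:Z * X i c * X j c) : 'M[k]_s) \in unitmx.
Proof.
move=> w0 rX; set G := \matrix_(i, j) _.
have zinj (a : int) : ((a%:~R : k) == 0) = (a == 0).
  by case: a => a; rewrite ?NegzE ?mulrNz ?oppr_eq0 (natr_eq0_char0 char0).
rewrite unitmxE unitfE det_map_mx zinj; apply/negP => /det0P[y y0 yG].
have yX : y *m X = 0.
  have : \sum_c (w c)%:Z * ((y *m X) ord0 c) ^+ 2 = (y *m G *m y^T) ord0 ord0.
    have -> : G = X *m diag_mx (\row_c (w c)%:Z) *m X^T.
      apply/matrixP => i j; rewrite mxE [RHS]mxE; apply: eq_bigr => c _.
      by rewrite mul_mx_diag !mxE; congr (_ * _); rewrite mulrC.
    rewrite !mulmxA -mulmxA -trmx_mul mul_mx_diag mxE; apply: eq_bigr => c _.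
    by rewrite [(_^T) _ _]mxE [X in _ = X * _]mxE [(\row__ _) _ _]mxE expr2 mulrCA mulrA.
  rewrite yG mul0mx [RHS]mxE => /Num.Theory.psumr_eq0P H; apply/rowP => c.
  have /H/(_ c isT)/eqP : forall c : 'I_N, true -> 0 <= (w c)%:Z * ((y *m X) ord0 c) ^+ 2.
    by move=> i _; rewrite Num.Theory.mulr_ge0 ?Num.Theory.sqr_ge0.
  rewrite mulf_eq0 expf_eq0 /= => /orP[|/eqP ->]; last by rewrite mxE.
  by have := w0 c; case: (w c).
have y0k : map_mx intr y = 0 :> 'rV[k]_s.
  apply: (row_free_inj rX); rewrite mul0mx -map_mxM yX; apply/rowP => c.
  by rewrite !mxE.
case/eqP: y0; apply/rowP => i; have /rowP/(_ i) := y0k.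
by rewrite !mxE => /eqP; rewrite zinj => /eqP.
Qed.

Section GenericPosition.
Variables (n : nat) (k : fieldType) (char0 : [pchar k] =i pred0).
Variables (I : set {mpoly k[n]}) (monI : monomial_ideal I) (D : nat).
Local Notation h := (hilbert I).
Variable top : forall d, {ffun 'I_(h d) -> mon n d}.
Hypothesis top_inj : forall d, injective (top d).
Hypothesis topI : forall d i, I 'X_[mnm_of_mon (top d i)].

Let gI : graded_ideal I. Proof. exact: monomial_ideal_graded. Qed.
Let iI : is_ideal I. Proof. exact: graded_ideal_is_ideal. Qed.

Definition top_hpoly d (i : 'I_(h d)) : hpoly n k d := to_hpoly d 'X_[mnm_of_mon (top
  d i)].

Lemma top_hpolyE d i : (top_hpoly (d := d) i : {mpoly k[n]}) = 'X_[mnm_of_mon (top d i)].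
Proof. by rewrite to_hpolyK // dhomogX /= mdeg_mon. Qed.

Lemma minor_top_hpoly d : minor (@top_hpoly d) (top d) = 1.
Proof.
rewrite /minor (_ : \matrix_(i, j) _ = 1%:M) ?det1 //; apply/matrixP => i j.
by rewrite !mxE top_hpolyE mcoeffX (inj_eq (@mnm_of_mon_inj _ _)) (inj_eq (@top_inj _)).
Qed.

(** The Plücker vector of g I_d on the basis of images of monomials: it is polynomial in g, and
    defined for singular g as well. *)
Definition top_image_minor d (g : 'M[k]_n) (f : 'I_(h d) -> mon n d) : k :=
  minor (fun i => lin_subst g 'X_[mnm_of_mon (top d i)]) f.

Lemma top_image_minorE d g f :
  @top_image_minor d g f = minor (fun i => lin_hpoly g (top_hpoly (d := d) i)) f.
Proof.
by congr (\det _); apply/matrixP => i j; rewrite !mxE lin_hpolyE top_hpolyE.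
Qed.

Lemma top_image_plucker d g : g \in unitmx -> exists2 c, c != 0 &
  forall f : {ffun 'I_(h d) -> mon n d},
    top_image_minor g f = c * plucker (gpiece (lin_subst g @` I) d) f.
Proof.
move=> Ug; have igI := is_ideal_image Ug iI.
have [|i|c Ec] := @minor_plucker _ _ d _ (gpiece (lin_subst g @` I) d) (fun i =>
  lin_hpoly g (top_hpoly i)).
- by rewrite -/(hilbert _ d) hilbert_image.
- apply/(mem_gpiece igI); rewrite lin_hpolyE; exists (top_hpoly i) => //.
  by rewrite top_hpolyE; exact: topI.
exists c => [|f]; last by rewrite top_image_minorE.
apply/eqP => c0; have /eqP := minor_top_hpoly d; apply/negP; rewrite eq_sym.
have -> : minor (@top_hpoly d) (top d) =
    minor (fun i => lin_hpoly (invmx g) (lin_hpoly g (top_hpoly (d := d) i))) (top d).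
  by congr (\det _); apply/matrixP => i j; rewrite !mxE !lin_hpolyE lin_substK.
by rewrite minor_act big1 ?oner_neq0 // => f _; rewrite Ec c0 mul0r mulr0.
Qed.

Lemma linewise_poly_lin_subst (V : lmodType k) (g : V -> 'M[k]_n) (m m' : 'X_{1..n}) :
  (forall i j, linewise_poly (fun x => g x i j)) ->
  linewise_poly (fun x => (lin_subst (g x) 'X_[m])@_m').
Proof. exact: (fun_subring_lin_subst m m' (@linewise_poly_subring k V)). Qed.

Lemma linewise_poly_top_image d (f : 'I_(h d) -> mon n d) :
  linewise_poly (fun g : 'M[k]_n => top_image_minor g f).
Proof.
apply: (fun_subring_det (@linewise_poly_subring k _)) => i j.
have := @linewise_poly_lin_subst _ id (mnm_of_mon (top d i)) (mnm_of_mon (f j)).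
move=> /(_ (@linewise_poly_entry k n n)); apply: fun_subring_ext => x.
by rewrite mxE.
Qed.

Lemma top_image_minor_int d (g : 'M[nat]_n) (f : 'I_(h d) -> mon n d) :
  exists z : int, top_image_minor (map_mx (fun i => i%:R) g) f = z%:~R.
Proof.
pose P (phi : 'M[nat]_n -> k) := forall x, exists z : int, phi x = z%:~R.
have sP : fun_subring P.
  split=> [x|u v Pu Pv x|u v Pu Pv x]; first by exists 1.
    by have [a ->] := Pu x; have [b ->] := Pv x; exists (a - b); rewrite intrB.
  by have [a ->] := Pu x; have [b ->] := Pv x; exists (a * b); rewrite intrM.
suff : P (fun g => top_image_minor (map_mx (fun i => i%:R) g) f) by apply.
apply: (fun_subring_det sP) => i j.
apply: (@fun_subring_ext _ _ P (fun g : 'M[nat]_n => (lin_subst (map_mx (fun i => i%:R) g)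
   'X_[mnm_of_mon (top d i)])@_(mnm_of_mon (f j))) _) => [x|]; first by rewrite mxE.
apply: (fun_subring_lin_subst _ _ sP) => a b x.
by exists (x a b)%:Z; rewrite mxE.
Qed.

Variables (J : set {mpoly k[n]}) (IJ : in_orbit_closure I D J).

(** A linear form in the coordinates of a single degree is multihomogeneous, so linear relations
    that hold on the orbit pass to its closure: the Plücker vector of J_d lies in the span L of
    those of the orbit. *)
Lemma plucker_linear_relation (d : 'I_D.+1) (c : {ffun 'I_(h d) -> mon n d} -> k) :
  (forall g, g \in unitmx -> \sum_f c f * top_image_minor g f = 0) ->
  \sum_f c f * plucker (gpiece J d) f = 0.
Proof.
move=> c0; pose F : plucker_ring n k h D :=
  \sum_f c f *: coord_var k (Tagged (fun d : 'I_D.+1 => {ffun 'I_(h d) -> mon n d}) f).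
have FE K : plucker_eval F K = \sum_f c f * plucker (gpiece K d) f.
  rewrite -[LHS]/(coord_eval F (plucker_coords K)) /coord_eval linear_sum.
  by apply: eq_bigr => f _; rewrite /= mevalZ -/(coord_eval _ _) coord_eval_var.
rewrite -FE; apply: IJ.2.
  exists (fun d' => tag (Tagged (fun d : 'I_D.+1 =>
    {ffun 'I_(h d) -> mon n d}) (top d)) == d' : nat).
  by apply: multideg_sum => f _; apply: multidegZ; exact: multideg_var.
move=> _ [g /= Ug <-]; rewrite FE; have [a a0 Ea] := top_image_plucker d Ug.
apply: (mulfI a0); rewrite mulr0 big_distrr -[RHS](c0 g Ug); apply: eq_bigr => f _ /=.
by rewrite mulrCA Ea.
Qed.

(** By contravariance and Cauchy-Binet, the pairing of the Plücker vectors of J_d and g I_d is a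
    multiple of the coordinate of g^T J_d at the monomials of I. *)
Lemma apolar_orthogonal (d : 'I_D.+1) :
  (forall g : 'M[k]_n, minor (fun i =>
    lin_hpoly g (basis_family J (d := d) i)) (top d) = 0) ->
  forall g, \sum_(f : {ffun 'I_(h d) -> mon n d}) (\prod_j (mfact (mnm_of_mon (f j)))%:R)
    * plucker (gpiece J d) f * top_image_minor g f = 0.
Proof.
move=> J0 g; apply: (@cauchy_binet_eq0 k (mon n d) _
  (fun i m => (basis_family J i : {mpoly k[n]})@_(mnm_of_mon m))
  (fun j m => (lin_subst g 'X_[mnm_of_mon (top d j)])@_(mnm_of_mon m))
  (fun m => (mfact (mnm_of_mon m))%:R)).
have := J0 g^T; rewrite /minor => /(congr1 (fun x => x * \det (diag_mx
  (\row_j (mfact (mnm_of_mon (top d j)))%:R)))).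
rewrite mul0r -det_mulmx => E; rewrite -[RHS]E {E}; congr (\det _); apply/matrixP => i j.
rewrite mul_mx_diag !mxE lin_hpolyE [in RHS](sum_mon (hpoly_dhomog (basis_family J i))).
rewrite lin_subst_sum linear_sum mulr_suml; apply: eq_bigr => m _ /=.
rewrite lin_substZ mcoeffZ mulrAC lin_subst_contravariant.
by rewrite mulrC [_%:R * _]mulrC mulrA.
Qed.

Lemma generic_position_degree (d : 'I_D.+1) : exists g : 'M[k]_n,
  minor (fun i => lin_hpoly g (basis_family J (d := d) i)) (top d) != 0.
Proof.
apply: contrapT => no; have orth : forall g, _ := apolar_orthogonal (fun g =>
  contrapT (fun nz => no (ex_intro _ g (introN eqP nz)))).
pose T := {ffun 'I_(h d) -> mon n d};
  pose natmx (g : 'M[nat]_n) : 'M[k]_n := map_mx (fun i => i%:R) g.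
(* Matrices with natural entries are Zariski dense, hence they suffice to span L, and their vectors
   are integral. *)
pose z (g : 'M[nat]_n) : 'rV[k]_#|{: T}| := \row_c top_image_minor (natmx g)
  (enum_val c : T).
have [s [G [rX spanX]]] := finite_spanning_family z.
have /choice[x0 Ex0] : forall u : 'I_s * 'I_#|{: T}|, exists a : int,
  z (G u.1) ord0 u.2 = a%:~R.
  by move=> [i c]; have [a Ea] := top_image_minor_int (G i) (enum_val c : T);
    exists a; rewrite mxE.
pose X0 : 'M[int]_(s, #|{: T}|) := \matrix_(i, c) x0 (i, c).
have EX : \matrix_i z (G i) = map_mx intr X0.
  by apply/matrixP => i c; rewrite !mxE -Ex0 mxE.
rewrite EX in rX spanX; set X := map_mx intr X0 in rX spanX EX.
pose w (c : 'I_#|{: T}|) : nat := \prod_j mfact (mnm_of_mon ((enum_val c : T) j)).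
have w0 c : (0 < w c)%N by rewrite prodn_gt0 // => j; exact: mfact_gt0.
have UG := int_gram_unit char0 w0 rX.
pose x : 'rV[k]_#|{: T}| := \row_c plucker (gpiece J d) (enum_val c : T).
have sumT (F : T -> k) : \sum_f F f = \sum_(c < #|{: T}|) F (enum_val c).
  by rewrite (reindex_onto (@enum_val T predT) enum_rank) => [|f _];
    [apply: eq_bigl => c; rewrite enum_valK eqxx|rewrite enum_rankK].
(* The columns of the cokernel of X are linear relations on all the z g; by density of the natural
   matrices they hold on the orbit, and therefore at J. *)
have /submxP[y Ey] : (x <= X)%MS.
  rewrite submxE; apply/eqP/rowP => j; rewrite [RHS]mxE mxE.
  have := @plucker_linear_relation d (fun f => cokermx X (enum_rank f) j).
  rewrite sumT => H; rewrite -[RHS]H => [|g _].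
    by apply: eq_bigr => c _; rewrite mxE enum_valK mulrC.
  move: g; apply: (linewise_poly_nat_eq0 char0).
    have PS := @linewise_poly_subring k 'M[k]_n.
    apply: (fun_subring_sum PS) => f _; apply: (fun_subringM PS).
      exact: linewise_poly_cst.
    exact: linewise_poly_top_image.
  move=> g; have := spanX g; rewrite submxE => /eqP/rowP/(_ j); rewrite mxE [RHS]mxE => E.
  rewrite -[RHS]E sumT; apply: eq_bigr => c _.
  by rewrite [z g _ _]mxE enum_valK mulrC.
(* x = y X is orthogonal to every row of X, so y is killed by the invertible Gram matrix. *)
have y0 : y = 0.
  apply: (can_inj (mulmxK UG)); rewrite mul0mx; apply/rowP => j; rewrite [RHS]mxE.
  have := orth (natmx (G j)); rewrite sumT => E; rewrite -[RHS]E mxE.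
  transitivity (\sum_c (w c)%:R * (y *m X) ord0 c * X j c); last first.
    apply: eq_bigr => c _; rewrite -Ey mxE /w natr_prod; congr (_ * _).
    by rewrite -EX !mxE.
  under [RHS]eq_bigr => c _ do rewrite mxE mulr_sumr mulr_suml.
  rewrite exchange_big; apply: eq_bigr => i _ /=; rewrite !mxE rmorph_sum mulr_sumr.
  apply: eq_bigr => c _; rewrite !rmorphM /= [(X0 ^ intr)%sesqui _ _]mxE.
  by rewrite [X j c]mxE !mulrA [y _ _ * _]mulrC.
have [f /eqP[]] := plucker_neq0 (IJ.1.2 d).
have /rowP/(_ (enum_rank f)) : x = 0 by rewrite Ey y0 mul0mx.
by rewrite !mxE enum_rankK.
Qed.

(** By irreducibility, the product of the determinant and of the coordinates in all degrees up to D
    is not identically zero; so one invertible g serves for all degrees. *)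
Lemma generic_position : exists2 g : 'M[k]_n, g \in unitmx &
  forall d : 'I_D.+1, plucker (gpiece (lin_subst g @` J) d) (top d) != 0.
Proof.
pose Phi (d : 'I_D.+1) (g : 'M[k]_n) := minor (fun i =>
  lin_hpoly g (basis_family J (d := d) i)) (top d).
have PS := @linewise_poly_subring k 'M[k]_n.
have PPhi d : linewise_poly (Phi d).
  apply: (fun_subring_det PS) => i j.
  apply: (@fun_subring_ext _ _ (@linewise_poly k 'M[k]_n) (fun g => \sum_(m : mon n d)
     (basis_family J i : {mpoly k[n]})@_(mnm_of_mon m) *
     (lin_subst g 'X_[mnm_of_mon m])@_(mnm_of_mon (top d j))) _).
    move=> g; rewrite mxE lin_hpolyE [in RHS](sum_mon (hpoly_dhomog (basis_family J i))).
    rewrite lin_subst_sum linear_sum; apply: eq_bigr => m _ /=.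
    by rewrite lin_substZ mcoeffZ.
  apply: (fun_subring_sum PS) => m _; apply: (fun_subringM PS);
    first exact: linewise_poly_cst.
  exact: (@linewise_poly_lin_subst _ id _ _ (@linewise_poly_entry k n n)).
suff [g] : exists g : 'M[k]_n, \det g * \prod_d Phi d g != 0.
  rewrite mulf_eq0 negb_or => /andP[Ug /prodf_neq0 nz].
  have {}Ug : g \in unitmx by rewrite unitmxE unitfE.
  exists g => // d; have hgJ := (in_orbit_closure_act gI Ug IJ).1.
  have [|i|c Ec] := @minor_plucker n k d (h d) (gpiece (lin_subst g @` J) d)
    (fun i => lin_hpoly g (basis_family J (d := d) i)).
  - exact: hgJ.2.
  - apply/(mem_gpiece (graded_ideal_is_ideal hgJ.1)); rewrite lin_hpolyE.
    by exists (basis_family J i) => //; exact: (basis_family_mem _ IJ.1).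
  by have := nz d isT; rewrite /= [Phi d g]Ec mulf_eq0 negb_or => /andP[].
apply: contrapT => no; have H g : \det g * \prod_d Phi d g = 0.
  by apply/eqP/negPn/negP => nz; apply: no; exists g.
have Pdet : linewise_poly (fun g : 'M[k]_n => \det g).
  by apply: (fun_subring_det PS) => i j; exact: linewise_poly_entry.
have [H1|] := linewise_poly_mul_eq0 char0 Pdet (fun_subring_prod PS _ (fun d _ =>
  PPhi d)) H.
  by have := H1 1%:M; rewrite det1 => /eqP; rewrite oner_eq0.
elim: (index_enum _) => [/(_ 0)|d r IH].
  by rewrite big_nil => /eqP; rewrite oner_eq0.
move=> H'; have {}H' g : Phi d g * \prod_(d <- r) Phi d g = 0 by rewrite -(H' g) big_cons.
have [H1|//] := linewise_poly_mul_eq0 char0 (PPhi d) (fun_subring_prod PS _ (fun d _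
  => PPhi d)) H'.
by have [g] := generic_position_degree d; rewrite -/(Phi d g) H1 eqxx.
Qed.

End GenericPosition.

(** * The weight filtration *)

(** A nonidentity permutation s with nonzero product would satisfy \sum w j < \sum w (s j), although
    both sums are equal. Indices of equal weight need no order. *)
Lemma det_unitriangular (R : comNzRingType) r (A : 'M[R]_r) (w : 'I_r -> nat) :
  (forall i j, A i j != (i == j)%:R -> (w i < w j)%N) -> \det A = 1.
Proof.
move=> tri; rewrite /determinant (bigD1 1%g) //= odd_perm1 expr0 mul1r.
rewrite [X in _ + X]big1 ?addr0 => [|s s1].
  rewrite big1 // => i _; rewrite perm1; apply/eqP; apply: contraT => ne.
  by have := tri i i; rewrite eqxx ltnn => /(_ ne).
suff [i Ai] : exists i, A i (s i) = 0 by rewrite (bigD1 i) //= Ai mul0r mulr0.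
apply: contrapT => nz; case/eqP: s1; apply/permP => i; rewrite perm1.
have ge j : s j != j -> (w j < w (s j))%N.
  move=> sj; apply: tri; rewrite [j == s j]eq_sym (negPf sj); apply/eqP => A0.
  by apply: nz; exists j.
apply/eqP; apply: contraT => /ge lt.
have : (\sum_j w j < \sum_j w (s j))%N.
  rewrite (bigD1 i) //= [X in (_ < X)%N](bigD1 i) //= -addSn leq_add // leq_sum // => j _.
  by case: (eqVneq (s j) j) => [->//|/ge/ltnW].
by rewrite [X in (X < _)%N](reindex_inj (@perm_inj _ s)) ltnn.
Qed.

Section WeightFiltration.
Variables (n : nat) (k : fieldType) (rho : 'I_n -> nat).
Implicit Types (m : 'X_{1..n}) (p q : {mpoly k[n]}) (u : 'M[k]_n).

Definition wt (m : 'X_{1..n}) : nat := \sum_(i < n) rho i * m i.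

Lemma wtD m m' : wt (m + m')%MM = (wt m + wt m')%N.
Proof. by rewrite /wt -big_split; apply: eq_bigr => i _; rewrite mnmDE mulnDr. Qed.

Lemma wtU i : wt U_(i)%MM = rho i.
Proof.
rewrite /wt (bigD1 i) //= mnm1E eqxx muln1 big1 ?addn0 // => j ji.
by rewrite mnm1E eq_sym (negPf ji) muln0.
Qed.

(* The weights are <= e - a, stated without truncated subtraction. *)
Definition drops (e a : nat) p : Prop := forall m, m \in msupp p -> (wt m + a <= e)%N.

Lemma drops0 e a : drops e a 0.
Proof. by move=> m; rewrite msupp0. Qed.

Lemma dropsX m : drops (wt m) 0 'X_[m].
Proof. by move=> m'; rewrite msuppX inE => /eqP ->; rewrite addn0. Qed.

Lemma dropsD e a p q : drops e a p -> drops e a q -> drops e a (p + q).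
Proof. by move=> Dp Dq m /msuppD_le; rewrite mem_cat => /orP[/Dp|/Dq]. Qed.

Lemma dropsZ e a c p : drops e a p -> drops e a (c *: p).
Proof. by move=> Dp m /msuppZ_le/Dp. Qed.

Lemma dropsN e a p : drops e a p -> drops e a (- p).
Proof. by move=> Dp; rewrite -scaleN1r; exact: dropsZ. Qed.

Lemma drops_sum e a J (r : seq J) (P : pred J) (F : J -> {mpoly k[n]}) :
  (forall i, P i -> drops e a (F i)) -> drops e a (\sum_(i <- r | P i) F i).
Proof. by move=> DF; elim/big_ind: _ => //; [exact: drops0|exact: dropsD]. Qed.

Lemma dropsM e a e' a' p q : drops e a p -> drops e' a' q ->
  drops (e + e') (a + a') (p * q).
Proof.
move=> Dp Dq m /msuppM_le/allpairsP[[b c] /= [/Dp lb /Dq lc ->]].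
by rewrite wtD addnACA leq_add.
Qed.

Lemma drops_le e a a' p : (a' <= a)%N -> drops e a p -> drops e a' p.
Proof. by move=> le Dp m /Dp; apply: leq_trans; rewrite leq_add2l. Qed.

Lemma drops_coef e a p m : drops e a p -> (e < wt m + a)%N -> p@_m = 0.
Proof.
by move=> Dp lt; apply: memN_msupp_eq0; apply/negP => /Dp; rewrite leqNgt lt.
Qed.

(* u x_j is x_j plus a combination of variables strictly below x_j. *)
Definition strictly_unipotent u : Prop :=
  forall i j, u i j != (i == j)%:R -> (rho i < rho j)%N.

Lemma strictly_unipotent_unit u : strictly_unipotent u -> u \in unitmx.
Proof. by move=> Uu; rewrite unitmxE (det_unitriangular Uu) unitr1. Qed.

Lemma uni_var u j : strictly_unipotent u -> drops (rho j) 1 (lin_subst u 'X_j - 'X_j).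
Proof.
move=> Uu; have -> : lin_subst u 'X_j - 'X_j = \sum_i (u i j - (i == j)%:R) *: 'X_i.
  rewrite lin_substXU; under [RHS]eq_bigr => i _ do rewrite scalerBl.
  rewrite sumrB; congr (_ - _); rewrite (bigD1 j) //= eqxx scale1r big1 ?addr0 // => i ij.
  by rewrite (negPf ij) scale0r.
apply: drops_sum => i _; case: (eqVneq (u i j) (i == j)%:R) => [->|/Uu lt].
  by rewrite subrr scale0r; exact: drops0.
by apply: dropsZ => m; rewrite msuppX inE => /eqP ->; rewrite wtU addn1.
Qed.

Lemma uni_monomial u m : strictly_unipotent u ->
  drops (wt m) 1 (lin_subst u 'X_[m] - 'X_[m]).
Proof.
move=> Uu; elim/mnm_ind: m => [|m j IH].
  by rewrite mpolyX0 -mpolyC1 lin_substC subrr; exact: drops0.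
rewrite mpolyXD lin_substM wtD wtU.
have -> : lin_subst u 'X_[m] * lin_subst u 'X_j - 'X_[m] * 'X_j =
    (lin_subst u 'X_[m] - 'X_[m]) * (lin_subst u 'X_j - 'X_j) +
    (lin_subst u 'X_[m] - 'X_[m]) * 'X_j + 'X_[m] * (lin_subst u 'X_j - 'X_j).
  by rewrite -mulrDr subrK mulrBl mulrBr addrA subrK.
have Dj := @uni_var u j Uu; have Xj := @dropsX U_(j)%MM; rewrite wtU in Xj.
apply: dropsD; [apply: dropsD|]; last exact: (dropsM (@dropsX m) Dj).
  exact: drops_le (dropsM IH Dj).
by rewrite -[1%N]addn0; exact: dropsM.
Qed.

Lemma uni_drops u e a p : strictly_unipotent u -> drops e a p ->
  drops e a.+1 (lin_subst u p - p).
Proof.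
move=> Uu Dp; rewrite {2}(mpolyE p) {1}(mpolyE p) lin_subst_sum -sumrB big_seq.
apply: drops_sum => m /Dp le; rewrite lin_substZ -scalerBr;
  apply: dropsZ => m' /(uni_monomial Uu).
by rewrite addn1 addnS => lt; apply: leq_trans le; rewrite -addSn leq_add2r.
Qed.

Lemma uni_drops0 u e a p : strictly_unipotent u -> drops e a p ->
  drops e a (lin_subst u p).
Proof.
move=> Uu Dp; rewrite -(subrK p (lin_subst u p)); apply: dropsD => //.
by apply: drops_le (uni_drops Uu Dp).
Qed.

Section Truncation.
Variables (u : 'M[k]_n) (w : nat) (w0 : (0 < w)%N) (Uu : strictly_unipotent u).

(** With rho j - rho i as the weight of the entry (i, j), only the entries of u of weight less than
    w are kept; [layer] consists of those of weight w. *)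
Definition truncation : 'M[k]_n :=
  \matrix_(i, j) if (rho j < rho i + w)%N then u i j else (i == j)%:R.

Definition layer : 'M[k]_n :=
  \matrix_(i, j) if (rho j == rho i + w)%N then u i j else 0.

Lemma truncation_uni : strictly_unipotent truncation.
Proof. by move=> i j; rewrite mxE; case: ifP => _; [exact: Uu|rewrite eqxx]. Qed.

Lemma layer_deriv_drops e a p : drops e a p -> drops e (a + w) (lin_deriv layer p).
Proof.
move=> Dp; apply: drops_sum => i _; apply: drops_sum => j _; rewrite mxE.
case: eqP => [rj|_]; last by rewrite scale0r; exact: drops0.
apply: dropsZ; rewrite (mpolyE p) linear_sum mulr_sumr big_seq.
apply: drops_sum => m /Dp le /=; rewrite mderivZ -scalerAr mderivX -scalerAr;
  apply: dropsZ.
case: (eqVneq (m j) 0%N) => [->|mj]; first by rewrite scale0r; exact: drops0.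
apply: dropsZ; rewrite -mpolyXD => m'; rewrite msuppX inE => /eqP ->; apply: leq_trans le.
have -> : wt m = (wt (m - U_(j)) + (rho i + w))%N by rewrite -rj -wtU -wtD submK ?lep1mP.
by rewrite wtD wtU [(rho i + _)%N]addnC -!addnA [(a + w)%N]addnC.
Qed.

Lemma layer_deriv_var_drops j : drops (rho j) w (lin_deriv layer 'X_j).
Proof. by rewrite -wtU -[w]add0n; apply: layer_deriv_drops; exact: dropsX. Qed.

Lemma lin_derivM A p q : lin_deriv A (p * q)
  = lin_deriv A p * q + p * lin_deriv A q :> {mpoly k[n]}.
Proof.
rewrite /lin_deriv mulr_suml mulr_sumr -big_split; apply: eq_bigr => a _.
rewrite /= mulr_suml mulr_sumr -big_split; apply: eq_bigr => b _ /=.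
by rewrite mderivM mulrDr scalerDr -scalerAl -scalerAr; congr (_ *: _ + _ *: _);
  [exact: mulrA|exact: mulrCA].
Qed.

Lemma lin_derivZ A c p : lin_deriv A (c *: p) = c *: lin_deriv A p :> {mpoly k[n]}.
Proof.
rewrite /lin_deriv scaler_sumr; apply: eq_bigr => a _; rewrite scaler_sumr.
by apply: eq_bigr => b _; rewrite mderivZ -scalerAr !scalerA mulrC.
Qed.

Lemma lin_derivD A p q : lin_deriv A (p + q)
  = lin_deriv A p + lin_deriv A q :> {mpoly k[n]}.
Proof.
rewrite /lin_deriv -big_split; apply: eq_bigr => a _; rewrite -big_split.
by apply: eq_bigr => b _; rewrite mderivD mulrDr scalerDr.
Qed.

Lemma lin_deriv_sum A J (r : seq J) (P : pred J) (F : J -> {mpoly k[n]}) :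
  lin_deriv A (\sum_(i <- r | P i) F i) = \sum_(i <- r | P i) lin_deriv A (F i).
Proof.
rewrite /lin_deriv [RHS]exchange_big; apply: eq_bigr => a _ /=.
rewrite [RHS]exchange_big; apply: eq_bigr => b _ /=.
by rewrite linear_sum mulr_sumr scaler_sumr.
Qed.

Lemma truncation_var j : drops (rho j) w.+1
  (lin_subst u 'X_j - lin_subst truncation 'X_j - lin_deriv layer 'X_j).
Proof.
have -> : lin_deriv layer 'X_j = \sum_i layer i j *: 'X_i.
  apply: eq_bigr => i _; rewrite (bigD1 j) //= mderivXU eqxx mulr1 big1 ?addr0 // => b bj.
  by rewrite mderivXU eq_sym (negPf bj) mpolyC0 mulr0 scaler0.
rewrite !lin_substXU -!sumrB; apply: drops_sum => i _; rewrite -!scalerBl !mxE.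
case: ltnP => [lt|le].
  by rewrite (ltn_eqF lt) subrr subr0 scale0r; exact: drops0.
have ij : i == j = false.
  by apply/negP => /eqP e; move: le; rewrite e leqNgt -{1}[rho j]addn0 ltn_add2l w0.
rewrite ij; case: (eqVneq (rho j) (rho i + w)%N) => [_|ne].
  by rewrite subr0 subrr scale0r; exact: drops0.
apply: dropsZ => m; rewrite msuppX inE => /eqP ->; rewrite wtU addnS.
by rewrite ltn_neqAle le eq_sym ne.
Qed.

(** The first-order term of u relative to its truncation: an entry of weight w combined with any
    further nontrivial entry, or an entry of larger weight, drops the weight of the monomial by more
    than w. *)
Lemma truncation_monomial m : drops (wt m) w.+1
  (lin_subst u 'X_[m] - lin_subst truncation 'X_[m] - lin_deriv layer 'X_[m]).
Proof.
have Ut := truncation_uni; elim/mnm_ind: m => [|m j IH].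
  rewrite mpolyX0 -mpolyC1 !lin_substC subrr sub0r; apply: dropsN.
  apply: drops_sum => a _; apply: drops_sum => b _; rewrite mderivC mulr0 scaler0.
  exact: drops0.
rewrite mpolyXD !lin_substM lin_derivM wtD wtU.
have Rj := @truncation_var j; have Dj := @layer_deriv_var_drops j.
have Dm : drops (wt m) w (lin_deriv layer 'X_[m]).
  by rewrite -[w]add0n; apply: layer_deriv_drops; exact: dropsX.
move: IH Rj Dj Dm (@uni_var _ j Ut) (@uni_monomial u m Uu).
have Um : drops (wt m) 0 (lin_subst u 'X_[m]) by apply: uni_drops0 => //; exact: dropsX.
have Tj : drops (rho j) 0 (lin_subst truncation 'X_j).
  by apply: uni_drops0 => //; rewrite -wtU; exact: dropsX.
move: Um Tj.
move: ('X_[m]) (lin_deriv layer 'X_[m]) (lin_subst truncation 'X_[m]) (lin_subst u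
  'X_[m]).
move: ('X_j) (lin_deriv layer 'X_j) (lin_subst truncation 'X_j) (lin_subst u 'X_j).
move=> xj dj tj uj xm dm tm um Um Tj Rm Rj Dj Dm tjx umx.
(* The defect of the product rule, written as four products each of which drops the weight by at
   least w + 1. *)
have -> : um * uj - tm * tj - (dm * xj + xm * dj) =
  dm * (tj - xj) + (um - tm - dm) * tj + (um - xm) * dj + um * (uj - tj - dj).
  rewrite !mulrBr !mulrBl.
  move: (um * uj) (tm * tj) (dm * xj) (xm * dj) (dm * tj) (um * tj) (um * dj) =>
    g d b f a c e.
  rewrite [a - b + _]addrC [c - d - a + _]addrA subrK [RHS]addrC [_ + (e - f)]addrC.
  rewrite [RHS]addrA [g - c - e + _]addrA subrK [g - c - f]addrAC !addrA subrK.
  by rewrite opprD addrA addrAC [g - d - f]addrAC.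
apply: dropsD; [apply: dropsD; [apply: dropsD|]|].
- by rewrite -addn1; exact: dropsM.
- by rewrite -[w.+1]addn0; exact: dropsM.
- by rewrite -add1n; exact: dropsM.
- by rewrite -[w.+1]add0n; exact: dropsM.
Qed.

Lemma truncation_drops e a p : drops e a p -> drops e (a + w.+1)
  (lin_subst u p - lin_subst truncation p - lin_deriv layer p).
Proof.
move=> Dp; have -> : lin_subst u p - lin_subst truncation p - lin_deriv layer p =
    \sum_(m <- msupp p) p@_m *: (lin_subst u 'X_[m] - lin_subst truncation 'X_[m] -
      lin_deriv layer 'X_[m]).
  rewrite [in LHS](mpolyE p) !lin_subst_sum lin_deriv_sum -!sumrB.
  by apply: eq_bigr => m _; rewrite !lin_substZ lin_derivZ -!scalerBr.
rewrite big_seq; apply: drops_sum => m /Dp le;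
  apply: dropsZ => m' /truncation_monomial le'.
by apply: leq_trans le; rewrite addnA addnAC leq_add2r addnC addnC.
Qed.

End Truncation.

End WeightFiltration.

(** * Reduced bases of the ideals u I *)

Section ReducedBasis.
Variables (n : nat) (k : fieldType) (char0 : [pchar k] =i pred0).
Variables (I : set {mpoly k[n]}) (monI : monomial_ideal I).
Local Notation h := (hilbert I).
Variable top : forall d, {ffun 'I_(h d) -> mon n d}.
Hypothesis top_inj : forall d, injective (top d).
Hypothesis topI : forall d i, I 'X_[mnm_of_mon (top d i)].
Hypothesis top_onto : forall d (m : mon n d), I 'X_[mnm_of_mon m] ->
  exists i, m = top d i.
Variable rho : 'I_n -> nat.

Let gI : graded_ideal I. Proof. exact: monomial_ideal_graded. Qed.
Let iI : is_ideal I. Proof. exact: graded_ideal_is_ideal. Qed.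

Lemma monomial_ideal_supp p m : I p -> m \in msupp p -> I 'X_[m].
Proof. by have [_ {1}->] := monomial_idealE monI; move=> H /H. Qed.

Lemma ideal_sub p q : I p -> I q -> I (p - q).
Proof.
by move=> Ip Iq; case: iI => _ ID _; apply: ID => //; rewrite -scaleN1r;
  exact: ideal_scale.
Qed.

(** At a monomial c of maximal weight in q, u q and q have the same coefficient, and c belongs to
    the monomial ideal I. Thus the coefficients of u q at monomials of I control all the weights in
    q. *)
Lemma uni_leading (u : 'M[k]_n) q e a : strictly_unipotent rho u -> I q ->
  (forall m, I 'X_[m] -> (lin_subst u q)@_m != 0 -> (wt rho m + a <= e)%N) ->
  drops rho e a q.
Proof.
move=> Uu Iq Hq m mq; rewrite leqNgt; apply/negP => lt.
pose P t := has (fun c => (wt rho c == t) && (e < t + a)%N) (msupp q).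
have exP : exists t, P t by exists (wt rho m); apply/hasP; exists m; rewrite ?eqxx.
have ub t : P t -> (t <= \sum_(c <- msupp q) wt rho c)%N.
  by case/hasP => c cq /andP[/eqP <- _]; rewrite (big_rem c cq) leq_addr.
case: (ex_maxnP exP ub) => _ /hasP[c cq /andP[/eqP <- ltc]] maxc.
have [nz0|nz] := eqVneq ((lin_subst u q)@_c) 0; last first.
  by have := Hq c (monomial_ideal_supp Iq cq) nz; rewrite leqNgt ltc.
have : (lin_subst u q - q)@_c = 0.
  have -> : lin_subst u q - q = \sum_(b <- msupp q) q@_b *: (lin_subst u 'X_[b] - 'X_[b]).
    rewrite {1 2}(mpolyE q) lin_subst_sum -sumrB; apply: eq_bigr => b _.
    by rewrite lin_substZ scalerBr.
  rewrite linear_sum big_seq big1 // => b bq /=; rewrite mcoeffZ.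
  rewrite (drops_coef (uni_monomial (m := b) Uu)) ?mulr0 // addn1 ltnS.
  case: (leqP (wt rho b) (wt rho c)) => // ltb.
  have := maxc (wt rho b); rewrite leqNgt ltb => H; suff : false by [].
  apply: H; apply/hasP; exists b => //; rewrite eqxx /=.
  by apply: leq_trans ltc _; rewrite leq_add2r ltnW.
by rewrite mcoeffB nz0 sub0r => /eqP; rewrite oppr_eq0 mcoeff_eq0 cq.
Qed.

(* The entries of u of weight w contribute only linearly to the coordinates of
   weight w of the reduced basis of u I. *)
Lemma truncation_reduced (u : 'M[k]_n) w m m' (b b' : {mpoly k[n]}) :
  strictly_unipotent rho u -> (0 < w)%N -> I 'X_[m] -> ~ I 'X_[m'] ->
  (wt rho m' + w)%N = wt rho m ->
  (lin_subst u @` I) b -> (lin_subst (truncation rho u w) @` I) b' ->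
  (forall c, I 'X_[c] -> b@_c = (c == m)%:R) -> (forall c, I 'X_[c] ->
    b'@_c = (c == m)%:R) ->
  b@_m' = b'@_m' + (lin_deriv (layer rho u w) 'X_[m])@_m'.
Proof.
set t := truncation rho u w; set D := lin_deriv _ =>
  Uu w0 Im nIm' Em [s0 Is0 <-] [q Iq <-] bE b'E.
have Ut : strictly_unipotent rho t := truncation_uni Uu.
have Dq0 : drops rho (wt rho m) 0 q.
  apply: (uni_leading Ut Iq) => c Ic; rewrite b'E //; case: (eqVneq c m) => [-> _|_];
    rewrite ?eqxx ?addn0 //.
have Dq1 : drops rho (wt rho m) 1 (q - 'X_[m]).
  apply: (uni_leading Ut) => [|c Ic]; first exact: ideal_sub.
  rewrite -[q - _]/(q + _) lin_substD -scaleN1r lin_substZ mcoeffD b'E // mcoeffZ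
    mulN1r [c == m]eq_sym -mcoeffX.
  rewrite -mcoeffB -opprB mcoeffN oppr_eq0 -mcoeff_msupp; exact: (uni_monomial Ut).
pose R := lin_subst u q - lin_subst t q - D q.
have DR : drops rho (wt rho m) w.+1 R by rewrite -[w.+1]add0n; exact: truncation_drops.
have Eq : lin_subst u q = lin_subst t q + (D q + R).
  by rewrite /R [D q + _]addrC subrK addrC subrK.
have DE : drops rho (wt rho m) w (D q + R).
  apply: dropsD; last by apply: drops_le DR.
  by rewrite -[w]add0n; exact: layer_deriv_drops.
(* As b and b' agree at the monomials of I, u (s0 - q) = b - b' - (D q + R) is there equal to its
   last term, which drops the weight by w. Since s0 - q has no term m', nothing of u (s0 - q)
   remains at m'. *)
have Is : I (s0 - q) by exact: ideal_sub.
have us : lin_subst u (s0 - q) = lin_subst u s0 - lin_subst u q.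
  by rewrite -[s0 - q]/(s0 + _) lin_substD -scaleN1r lin_substZ scaleN1r.
have Ds : drops rho (wt rho m) w (s0 - q).
  apply: (uni_leading Uu Is) => c Ic.
  rewrite us Eq mcoeffB mcoeffD bE // b'E // opprD addrA subrr sub0r oppr_eq0.
  by rewrite -mcoeff_msupp; exact: DE.
have lt : (wt rho m < wt rho m' + w.+1)%N by rewrite addnS Em.
have := drops_coef (uni_drops Uu Ds) lt; rewrite mcoeffB.
have -> : (s0 - q)@_m' = 0.
  by apply: memN_msupp_eq0; apply/negP => /(monomial_ideal_supp Is).
rewrite subr0 us mcoeffB => /eqP; rewrite subr_eq0 => /eqP ->.
rewrite Eq mcoeffD mcoeffD (drops_coef DR lt) addr0; congr (_ + _).
rewrite -[in LHS](subrK 'X_[m] q) [D _]lin_derivD mcoeffD.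
have DD : drops rho (wt rho m) (1 + w) (D (q - 'X_[m])) by exact: layer_deriv_drops.
by rewrite (drops_coef DD) ?add0r ?add1n.
Qed.

(** By Cramer's rule, the Plücker coordinate at this index divided by the one at [top d] is the
    coefficient of m in the element number l of the reduced basis. *)
Definition replace_top d (l : 'I_(h d)) (m : mon n d) : {ffun 'I_(h d) -> mon n d} :=
  [ffun j => if j == l then m else top d j].

Lemma uni_top_minor (u : 'M[k]_n) d : strictly_unipotent rho u ->
  top_image_minor top u (top d) = 1.
Proof.
move=> Uu; rewrite /top_image_minor /minor -det_tr.
apply: (det_unitriangular (w := fun i => wt rho (mnm_of_mon (top d i)))) => i j.
rewrite !mxE; set m := mnm_of_mon (top d j) => ne.
have : (lin_subst u 'X_[m] - 'X_[m])@_(mnm_of_mon (top d i)) != 0.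
  rewrite mcoeffB mcoeffX subr_eq0 (inj_eq (@mnm_of_mon_inj _ _)) (inj_eq (@top_inj _)).
  by rewrite [j == i]eq_sym.
by rewrite -mcoeff_msupp => /(uni_monomial Uu); rewrite addn1.
Qed.

Lemma uni_plucker_top (u : 'M[k]_n) d : strictly_unipotent rho u ->
  plucker (gpiece (lin_subst u @` I) d) (top d) != 0.
Proof.
move=> Uu; have [c _ Ec] := top_image_plucker monI top_inj topI d
  (strictly_unipotent_unit Uu).
have := oner_neq0 k; rewrite -(uni_top_minor d Uu) Ec mulf_eq0 negb_or.
by case/andP.
Qed.

Lemma uni_reduced (u : 'M[k]_n) d l : strictly_unipotent rho u ->
  exists b : hpoly n k d, [/\ (lin_subst u @` I) b,
    forall c, I 'X_[c] -> (b : {mpoly k[n]})@_c = (c == mnm_of_mon (top d l))%:R &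
    forall m, (b : {mpoly k[n]})@_(mnm_of_mon m)
      = top_image_minor top u (replace_top l m)].
Proof.
move=> Uu; have UU := strictly_unipotent_unit Uu; have iuI := is_ideal_image UU iI.
have du : \dim (gpiece (lin_subst u @` I) d)
  = h d by rewrite -/(hilbert _ d) hilbert_image.
have nz := uni_plucker_top d Uu.
have [b /(mem_gpiece iuI) ub bE] := plucker_reduced (fun j => (j == l)%:R) du nz.
exists b; split=> // [c Ic|m].
  case: (eqVneq (mdeg c) d) => [dc|ndc].
    have [j Ej] := @top_onto d (mk_mon dc) Ic;
      rewrite -[c]/(mnm_of_mon (mk_mon dc)) Ej bE.
    by rewrite (inj_eq (@mnm_of_mon_inj _ _)) (inj_eq (@top_inj _)).
  rewrite (dhomog_nemf_coeff (hpoly_dhomog b)) //; case: eqP => // e.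
  by rewrite e mdeg_mon eqxx in ndc.
have [c _ Ec] := top_image_plucker monI top_inj topI d UU.
rewrite Ec (@plucker_replace _ _ _ _ _ _ b l m du nz) //; last by apply/(mem_gpiece iuI).
by rewrite mulrCA -Ec uni_top_minor // mulr1.
Qed.

(** The factor of u_ij is the exponent of x_j in m0 x_j, produced by the derivation; it is
    invertible in characteristic 0. *)
Lemma truncation_minor (u : 'M[k]_n) w d l (m : mon n d) m0 i j :
  strictly_unipotent rho u -> (0 < w)%N -> rho j = (rho i + w)%N ->
  mnm_of_mon (top d l) = (m0 + U_(j))%MM -> mnm_of_mon m = (m0 + U_(i))%MM ->
  ~ I 'X_[m0 + U_(i)] ->
  top_image_minor top u (replace_top l m) =
  top_image_minor top (truncation rho u w) (replace_top l m) + u i j * (m0 j).+1%:R.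
Proof.
move=> Uu w0 rj Etop Em nI; have Ut := truncation_uni (w := w) Uu.
have [b [ub bE <-]] := uni_reduced l Uu; have [b' [ub' b'E <-]] := uni_reduced l Ut.
have ij : i != j by apply/eqP => e; move: rj;
  rewrite e -{1}[rho j]addn0 => /addnI e0; rewrite -e0 in w0.
rewrite Em (truncation_reduced Uu w0 (topI l) nI _ ub ub' bE b'E) ?Etop
  ?mcoeff_lin_derivX //.
  by rewrite mxE rj eqxx.
by rewrite !wtD !wtU rj addnA.
Qed.

End ReducedBasis.

(** * The chart of the orbit *)

Section OrbitChart.
Variables (n : nat) (k : fieldType) (char0 : [pchar k] =i pred0).
Variables (I : set {mpoly k[n]}) (monI : monomial_ideal I) (D : nat).
Local Notation h := (hilbert I).
Variable top : forall d, {ffun 'I_(h d) -> mon n d}.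
Hypothesis top_inj : forall d, injective (top d).
Hypothesis topI : forall d i, I 'X_[mnm_of_mon (top d i)].
Hypothesis top_onto : forall d (m : mon n d), I 'X_[mnm_of_mon m] ->
  exists i, m = top d i.
Variable rho : 'I_n -> nat.
Hypothesis rho_le : forall i j, (rho i <= rho j)%N -> ideal_le I i j.

Let gI : graded_ideal I. Proof. exact: monomial_ideal_graded. Qed.
Let iI : is_ideal I. Proof. exact: graded_ideal_is_ideal. Qed.

Implicit Types (J : set {mpoly k[n]}) (phi psi : set {mpoly k[n]} -> k).

Definition in_chart J : Prop := hilb_scheme h J /\
  forall d : 'I_D.+1, plucker (gpiece J d) (top d) != 0.

Local Notation index := (plucker_index n h D).

Definition idx (d : 'I_D.+1) (f : {ffun 'I_(h d) -> mon n d}) : index :=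
  Tagged (fun d : 'I_D.+1 => {ffun 'I_(h d) -> mon n d}) f.

Definition top_form : plucker_ring n k h D := \prod_d coord_var k (idx (top (d :
  'I_D.+1))).

Definition top_value J : k := coord_eval top_form (plucker_coords J).

Lemma coord_evalM (F G : plucker_ring n k h D) xi :
  coord_eval (F * G) xi = coord_eval F xi * coord_eval G xi.
Proof. exact: mevalM. Qed.

Lemma coord_evalX (F : plucker_ring n k h D) e xi : coord_eval (F ^+ e) xi
  = coord_eval F xi ^+ e.
Proof. exact: rmorphXn. Qed.

Lemma top_valueE J : top_value J = \prod_(d < D.+1) plucker (gpiece J d) (top d).
Proof.
rewrite /top_value /coord_eval rmorph_prod; apply: eq_bigr => d _ /=.
by rewrite -/(coord_eval _ _) coord_eval_var.
Qed.

Lemma top_value_neq0 J : in_chart J -> top_value J != 0.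
Proof. by move=> [_ nz]; rewrite top_valueE; apply/prodf_neq0 => d _. Qed.

Lemma multideg_prod_var (U : 'I_D.+1 -> index) : (forall d, tag (U d) = d) ->
  multideg (fun=> 1%N) (\prod_d coord_var k (U d)).
Proof.
move=> tU m mF d.
have H : multideg (fun d => \sum_e (tag (U e) == d))%N (\prod_e coord_var k (U e)).
  by apply: multideg_prod => e; exact: multideg_var.
rewrite (H m mF d) (bigD1 d) //= tU eqxx big1 // => e /negPf ed.
by rewrite tU ed.
Qed.

Lemma multideg_top_form : multideg (fun=> 1%N) top_form.
Proof.
exact: multideg_prod_var.
Qed.

(** The regular functions of the open chart [top_form] <> 0: forms of multidegree (N, ..., N)
    divided by the power N of [top_form]. Only the values of phi on the chart matter. *)
Definition regular phi : Prop := exists N (F : plucker_ring n k h D),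
  multideg (fun=> N) F /\
  forall J, in_chart J -> coord_eval F (plucker_coords J) = phi J * top_value J ^+ N.

Lemma multideg_top_formX N : multideg (fun=> N) (top_form ^+ N).
Proof. by move=> m mF d; rewrite (multidegX multideg_top_form mF) muln1. Qed.

Lemma regular_cst c : regular (fun=> c).
Proof.
exists 0%N, c%:MP; split; first exact: multidegC.
by move=> J _; rewrite expr0 mulr1; exact: mevalC.
Qed.

Lemma regular_subring : fun_subring regular.
Proof.
split=> [|f g [N [F [FN FE]]] [N' [G [GN GE]]]|f g [N [F [FN FE]]] [N' [G [GN GE]]]].
- exact: regular_cst.
- exists (N + N')%N, (F * top_form ^+ N' + (-1) *: (G * top_form ^+ N)); split.
    apply: multidegD; first exact: multidegM FN (@multideg_top_formX N').
    apply: multidegZ => m mF d; rewrite addnC;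
      exact: (multidegM GN (@multideg_top_formX N)).
  move=> J cJ; rewrite /coord_eval mevalD mevalZ -!/(coord_eval _ _) !coord_evalM
    !coord_evalX.
  by rewrite FE // GE // -/(top_value J) mulN1r -!mulrA -!exprD [(N' + N)%N]addnC mulrBl.
- exists (N + N')%N, (F * G); split; first exact: multidegM FN GN.
  by move=> J cJ; rewrite coord_evalM FE // GE // exprD mulrACA.
Qed.

Definition chart_coord (d : 'I_D.+1) l (m : mon n d) J : k :=
  plucker (gpiece J d) (replace_top top l m) / plucker (gpiece J d) (top d).

Lemma regular_chart_coord d l m : regular (@chart_coord d l m).
Proof.
(* The factors of [top_form] in the degrees other than d are kept, so that numerator and denominator
   have the same multidegree. *)
exists 1%N, (\prod_e coord_var k (if e == d then idx (replace_top top l m)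
  else idx (top (e : 'I_D.+1)))); split.
  by apply: multideg_prod_var => e; case: eqP => [->|].
move=> J cJ; rewrite expr1 top_valueE (bigD1 d) //= [in RHS](bigD1 d) //= coord_evalM
  eqxx.
rewrite coord_eval_var /chart_coord mulrA divfK; last exact: cJ.2.
congr (_ * _); rewrite /coord_eval rmorph_prod; apply: eq_bigr => e /negPf ed /=.
by rewrite ed -/(coord_eval _ _) coord_eval_var.
Qed.

Lemma uni_in_chart u : strictly_unipotent rho u -> in_chart (lin_subst u @` I).
Proof.
move=> Uu; split; last by move=> d; exact: (uni_plucker_top monI top_inj topI d Uu).
by apply: GL_orbit_hilb => //; exists u => //; exact: strictly_unipotent_unit Uu.
Qed.

Lemma chart_coord_uni u d l m : strictly_unipotent rho u ->
  @chart_coord d l m (lin_subst u @` I) = top_image_minor top u (replace_top top l m).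
Proof.
move=> Uu; have [c c0 Ec] := top_image_plucker monI top_inj topI d
  (strictly_unipotent_unit Uu).
have E1 := uni_top_minor top_inj d Uu; rewrite Ec in E1.
by rewrite Ec /chart_coord -[X in _ / X](mulKf c0) [c * _ in X in _ / X]E1 mulr1
  invrK mulrC.
Qed.

(** In [main] the factors of m are replaced one at a time by larger variables, those already
    replaced being collected in m'. Equality of Hilbert functions turns the inclusion into an
    equality. *)
Lemma image_parabolic (P : 'M[k]_n) : P \in unitmx ->
  (forall i j, P i j != 0 -> (rho j <= rho i)%N) -> lin_subst P @` I = I.
Proof.
move=> UP Ppar; have iPI := is_ideal_image UP iI; have [uI EI] := monomial_idealE monI.
have main m m' : I 'X_[m + m'] -> I (lin_subst P 'X_[m] * 'X_[m']).
  elim/mnm_ind: m m' => [|m j IH] m'.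
    by rewrite mpolyX0 -mpolyC1 lin_substC mpolyC1 add0m mul1r.
  rewrite -addmA => Imj; rewrite mpolyXD lin_substM lin_substXU -mulrA mulrCA mulr_suml.
  apply: ideal_sum => // i _; rewrite -scalerAl.
  case: (eqVneq (P i j) 0) => [->|/Ppar/rho_le le]; first by rewrite scale0r; case: iI.
  apply: ideal_scale => //; rewrite mulrCA -mpolyXD; apply: IH.
  rewrite addmA [(m + U_(i))%MM]addmC -addmA mpolyXD; apply: le.
  by rewrite -mpolyXD addmA [(U_(j) + m)%MM]addmC -addmA.
have sub p : I p -> I (lin_subst P p).
  move=> Ip; rewrite (mpolyE p) lin_subst_sum big_seq; apply: ideal_sum => // m mp.
  rewrite lin_substZ; apply: ideal_scale => //; rewrite -[lin_subst _ _]mulr1 -mpolyX0.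
  by apply: main; rewrite addm0; exact: (monomial_ideal_supp monI Ip).
rewrite eqEsubset; split=> [_ [p Ip <-]|]; first exact: sub.
apply: graded_ideal_subset => // d; apply: gpiece_eq_of_subset => //.
  by move=> _ _ [p Ip <-]; exact: sub.
by rewrite hilbert_image.
Qed.

(* The product of the unipotent group with the stabilizer of [I] is dense. *)
Lemma unipotent_parabolic_dense (Phi : 'M[k]_n -> k) : linewise_poly Phi ->
  (forall g P, P \in unitmx -> (forall i j, P i j != 0 -> (rho j <= rho i)%N) ->
     strictly_unipotent rho (g *m P) -> Phi g = 0) ->
  forall g, Phi g = 0.
Proof.
move=> PPhi Phi0.
(* Analogue of the leading principal blocks: rows and columns of weight at least rho j, completed by
   the identity. When no corner is singular, g has an LU factorization. *)
pose corner j (g : 'M[k]_n) : 'M[k]_n := \matrix_(a, b)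
  if (rho j <= rho a)%N && (rho j <= rho b)%N then g a b else (a == b)%:R.
pose Psi g := \prod_j \det (corner j g).
have PS := @linewise_poly_subring k 'M[k]_n.
have PPsi : linewise_poly Psi.
  apply: (fun_subring_prod PS) => j _; apply: (fun_subring_det PS) => a b.
  case c: ((rho j <= rho a)%N && (rho j <= rho b)%N).
    rewrite (_ : (fun x => _) = (fun g : 'M[k]_n => g a b));
      first exact: linewise_poly_entry.
    by apply/funext => g; rewrite mxE c.
  rewrite (_ : (fun x => _) = (fun=> (a == b)%:R)); first exact: linewise_poly_cst.
  by apply/funext => g; rewrite mxE c.
have Psi1 : Psi 1%:M = 1.
  rewrite /Psi big1 // => j _; rewrite (_ : corner j 1%:M = 1%:M) ?det1 //.
  by apply/matrixP => a b; rewrite !mxE; case: ifP.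
have [//|H] : (forall g, Phi g = 0) \/ (forall g, Psi g = 0); last first.
  by have /eqP := H 1%:M; rewrite Psi1 oner_eq0.
apply: (linewise_poly_mul_eq0 char0) => // g.
case: (eqVneq (Psi g) 0) => [->|/prodf_neq0 nz]; first by rewrite mulr0.
have UC j : corner j g \in unitmx by rewrite unitmxE unitfE nz.
(* Column j of P is chosen so that column j of g P is e_j on the rows of weight at least rho j. *)
pose P : 'M[k]_n := \matrix_(l, j) invmx (corner j g) l j.
have CP i j : \sum_l corner j g i l * P l j = (i == j)%:R.
  have /matrixP/(_ i j) := mulmxV (UC j); rewrite mxE [RHS]mxE => <-.
  by apply: eq_bigr => l _; rewrite [P _ _]mxE.
have Ppar i j : P i j != 0 -> (rho j <= rho i)%N.
  move=> nzP; rewrite leqNgt; apply/negP => lt; case/eqP: nzP.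
  have := CP i j; rewrite (bigD1 i) //= mxE leqNgt lt /= eqxx mul1r big1 => [|l li].
    by rewrite addr0 => ->; case: eqP lt => // ->; rewrite ltnn.
  by rewrite mxE leqNgt lt /= eq_sym (negPf li) mul0r.
have SU : strictly_unipotent rho (g *m P).
  move=> i j; apply: contraNT; rewrite -leqNgt => le; rewrite -CP mxE.
  apply/eqP/eq_bigr => l _; rewrite [corner _ _ _ _]mxE le /=; case: ifP => // nle.
  by rewrite (_ : P l j = 0) ?mulr0 //; apply/eqP; apply: contraFT nle => /Ppar.
have : P \in unitmx by have := strictly_unipotent_unit SU; rewrite unitmx_mul => /andP[].
by move=> UP; rewrite (Phi0 g P) ?mul0r.
Qed.

Lemma image_eq_of_parabolic (g P : 'M[k]_n) : g \in unitmx -> P \in unitmx ->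
  (forall i j, P i j != 0 -> (rho j <= rho i)%N) ->
  lin_subst (g *m P) @` I = lin_subst g @` I.
Proof.
move=> Ug UP Ppar; rewrite -[in RHS](image_parabolic UP Ppar) eqEsubset.
split=> [_ [p Ip <-]|_ [_ [p Ip <-] <-]].
  by exists (lin_subst P p); [exists p|rewrite lin_subst_comp].
by exists p => //; rewrite lin_subst_comp.
Qed.

Variables (J : set {mpoly k[n]}) (IJ : in_orbit_closure I D J) (cJ : in_chart J).

(** The parabolic factor fixes I, so by density the numerator of phi vanishes at the Plücker vectors
    of all g I, hence at J, where the denominator is nonzero. *)
Lemma regular_vanishing phi : regular phi ->
  (forall u, strictly_unipotent rho u -> phi (lin_subst u @` I) = 0) -> phi J = 0.
Proof.
move=> [N [F [FN FE]]] phi0.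
have lorb g : g \in unitmx -> exists2 c : k, c != 0 &
    coord_eval F (fun u => top_image_minor top g (tagged u))
      = c * plucker_eval F (lin_subst g @` I).
  move=> Ug; have /choice[la Ela] : forall d : 'I_D.+1, exists c : k, c != 0 /\
      forall f : {ffun 'I_(h d) -> mon n d},
        top_image_minor top g f = c * plucker (gpiece (lin_subst g @` I) d) f.
    by move=> d; have [c c0 Ec] := top_image_plucker monI top_inj topI d Ug; exists c.
  exists (\prod_d la d ^+ N); first by apply/prodf_neq0 => d _;
    rewrite expf_neq0 ?(Ela d).1.
  transitivity (coord_eval F (fun u : index =>
    la (tag u) * plucker_coords (lin_subst g @` I) u)).
    2: exact: coord_eval_scale FN.
  congr coord_eval; apply/funext => -[d f].
  exact: (Ela d).2.
have Phi0 : forall g, coord_eval F (fun u => top_image_minor top g (tagged u)) = 0.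
  apply: unipotent_parabolic_dense => [|g P UP Ppar SU].
    apply: (@fun_subring_meval _ _ _ (@linewise_poly_subring k 'M[k]_n) _ F
      (fun g a => top_image_minor top g (tagged (plucker_var a)))) => [|a];
        first exact: linewise_poly_cst.
    exact: linewise_poly_top_image.
  have Ug : g \in unitmx by have := strictly_unipotent_unit SU;
    rewrite unitmx_mul => /andP[].
  have [c _ ->] := lorb g Ug; rewrite -(image_eq_of_parabolic Ug UP Ppar).
  rewrite -[plucker_eval _ _]/(coord_eval F (plucker_coords _)) FE ?phi0 ?mul0r ?mulr0 //.
  exact: uni_in_chart.
have : plucker_eval F J = 0.
  apply: IJ.2; first by exists (fun=> N).
  move=> _ [g /= Ug <-]; have [c c0 Ec] := lorb g Ug.
  by have /esym/eqP := Ec; rewrite Phi0 mulf_eq0 (negPf c0) => /eqP.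
rewrite -[LHS]/(coord_eval F (plucker_coords J)) FE // => /eqP.
by rewrite mulf_eq0 expf_eq0 (negPf (top_value_neq0 cJ)) andbF orbF => /eqP.
Qed.

Hypothesis test : forall i j, (rho i < rho j)%N -> exists m, [/\ (mdeg m < D)%N,
  I 'X_[m + U_(j)] & ~ I 'X_[m + U_(i)]].

Lemma regular_matrix_minor (th : 'I_n -> 'I_n -> set {mpoly k[n]} ->
  k) d (f : 'I_(h d) -> mon n d) :
  (forall i j, regular (th i j)) ->
  regular (fun K => top_image_minor top (\matrix_(i, j) th i j K) f).
Proof.
move=> th_reg; apply: (fun_subring_det regular_subring) => a b.
rewrite (_ : (fun K => _) = (fun K => (lin_subst (\matrix_(i, j) th i j K)
  'X_[mnm_of_mon (top d a)])@_(mnm_of_mon (f b)))); last first.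
  by apply/funext => K; rewrite mxE.
apply: (fun_subring_lin_subst _ _ regular_subring) => i j.
rewrite (_ : (fun K => _) = th i j) //.
by apply/funext => K; rewrite mxE.
Qed.

(* The entries of u are recovered from the chart coordinates of u I, by
   induction on the weight: see [truncation_minor]. *)
Lemma regular_entries w : exists th : 'I_n -> 'I_n -> set {mpoly k[n]} -> k,
  (forall i j, regular (th i j)) /\
  forall u, strictly_unipotent rho u ->
    forall i j, th i j (lin_subst u @` I) = truncation rho u w i j.
Proof.
elim: w => [|w [th [th_reg thE]]].
  exists (fun i j => fun=> (i == j)%:R); split=> [i j|u Uu i j]; first exact: regular_cst.
  rewrite mxE addn0; case: ifP => // lt; apply/eqP; apply: contraTT lt;
    rewrite eq_sym => /Uu.
  by rewrite -leqNgt => /ltnW.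
suff H (ij : 'I_n * 'I_n) : exists phi, regular phi /\ forall u,
  strictly_unipotent rho u ->
    phi (lin_subst u @` I) = truncation rho u w.+1 ij.1 ij.2.
  have [th' Eth'] := choice H; exists (fun i j => th' (i, j)).
  by split=> [i j|u Uu i j]; [exact: (Eth' (i, j)).1|exact: (Eth' (i, j)).2].
case: ij => i j /=; case: (eqVneq (rho j) (rho i + w)%N) => [rj|nrj]; last first.
  exists (th i j); split=> // u Uu; rewrite thE // !mxE addnS ltnS.
  by rewrite [in RHS]leq_eqVlt (negPf nrj).
case: (posnP w) => [w0|w0].
  exists (fun=> (i == j)%:R); split=> [|u Uu]; first exact: regular_cst.
  rewrite mxE rj addnS ltnSn; apply/eqP; apply: contraT; rewrite eq_sym => /Uu.
  by rewrite rj w0 addn0 ltnn.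
have lt_ij : (rho i < rho j)%N by rewrite rj -[X in (X < _)%N]addn0 ltn_add2l.
have [m0 [dm0 Ij nIi]] := test lt_ij.
have dj : mdeg (m0 + U_(j))%MM = (mdeg m0).+1 by rewrite mdegD mdeg1 addn1.
have di : mdeg (m0 + U_(i))%MM = (mdeg m0).+1 by rewrite mdegD mdeg1 addn1.
pose d : 'I_D.+1 := Ordinal (dm0 : ((mdeg m0).+1 < D.+1)%N).
have [l El] := @top_onto d (mk_mon dj) Ij; pose m : mon n d := mk_mon di.
(* [truncation_minor] solved for u_ij: the functions th already known give the truncation of u at w,
   whose contribution is subtracted. *)
exists (fun K => (@chart_coord d l m K -
  top_image_minor top (\matrix_(i,
    j) th i j K) (replace_top top l m)) * ((m0 j).+1%:R)^-1).
have RS := regular_subring; split=> [|u Uu].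
  apply: (fun_subringM RS); last exact: regular_cst.
  apply: (fun_subringB RS); first exact: regular_chart_coord.
  exact: regular_matrix_minor.
have -> : \matrix_(i, j) th i j (lin_subst u @` I) = truncation rho u w.
  by apply/matrixP => a b; rewrite mxE thE.
rewrite chart_coord_uni // (truncation_minor monI top_inj topI top_onto Uu w0 rj (l
  := l) (m := m) (m0 := m0)) //.
  by rewrite addrC addKr mulfK ?natr_eq0_char0 // mxE rj addnS ltnSn.
by rewrite -El.
Qed.

(** The functions that recover u from u I are evaluated at J, which gives a matrix over k itself.
    Identities between regular functions that hold at all the u I persist at J: this matrix is
    unipotent, and J has the reduced basis of its u I in each degree at most D. *)
Lemma chart_closure_subset : exists2 u : 'M[k]_n, strictly_unipotent rho u &
  forall d (p : {mpoly k[n]}), (d <= D)%N -> p \is d.-homog -> J p ->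
    (lin_subst u @` I) p.
Proof.
(* Beyond the largest value of rho the truncation is u itself. *)
have [th [th_reg thE]] := regular_entries (\max_i rho i).+1.
have RS := regular_subring.
have {}thE u i j : strictly_unipotent rho u -> th i j (lin_subst u @` I) = u i j.
  by move=> Uu; rewrite thE // mxE addnS ltnS (leq_trans (leq_bigmax j)) ?leq_addl.
pose u : 'M[k]_n := \matrix_(i, j) th i j J.
have Uu : strictly_unipotent rho u.
  move=> i j; apply: contraNT; rewrite -leqNgt => le; rewrite mxE -subr_eq0; apply/eqP.
  apply: (@regular_vanishing (fun K => th i j K - (i == j)%:R)) => [|v Uv].
    by apply: (fun_subringB RS) => //; exact: regular_cst.
  by rewrite thE //; apply/eqP; rewrite subr_eq0; apply: contraT => /Uv;
    rewrite ltnNge le.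
exists u => // d p dD hp Jp; pose d' : 'I_D.+1 := Ordinal (dD : (d < D.+1)%N).
have iJ : is_ideal J := graded_ideal_is_ideal cJ.1.1.
have iuI := is_ideal_image (strictly_unipotent_unit Uu) iI.
have coordE l m : @chart_coord d' l m J = top_image_minor top u (replace_top top l m).
  apply/eqP; rewrite -subr_eq0; apply/eqP; apply: (@regular_vanishing
    (fun K => @chart_coord d' l m K - top_image_minor top (\matrix_(i,
      j) th i j K) (replace_top top l m))).
    apply: (fun_subringB RS); first exact: regular_chart_coord.
    exact: regular_matrix_minor.
  move=> v Uv; rewrite chart_coord_uni // (_ : \matrix_(i, j) _ = v) ?subrr //.
  by apply/matrixP => i j; rewrite mxE thE.
have dJ : \dim (gpiece J d) = h d := cJ.1.2 d.
have nzJ : plucker (gpiece J d) (top d) != 0 := cJ.2 d'.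
have [b Eb] : exists b : 'I_(h d) ->
  hpoly n k d, forall l, [/\ J (b l), (lin_subst u @` I) (b l) &
    forall j, (b l : {mpoly k[n]})@_(mnm_of_mon (top d j)) = (j == l)%:R].
  suff H l : exists b : hpoly n k d, [/\ J b, (lin_subst u @` I) b &
      forall j, (b : {mpoly k[n]})@_(mnm_of_mon (top d j)) = (j == l)%:R].
    by have [b Eb] := choice H; exists b.
  have [b bJ bE] := plucker_reduced (fun j => (j == l)%:R) dJ nzJ.
  exists b; split=> //; first exact/(mem_gpiece iJ).
  have [b' [ub' _ b'E]] := uni_reduced monI top_inj topI top_onto l Uu.
  suff -> : b = b' by [].
  apply: hpolyP => m; rewrite b'E -(coordE l m) /chart_coord.
  by rewrite (@plucker_replace _ _ _ _ _ _ b l m dJ nzJ) // mulfK.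
have -> : p = \sum_l p@_(mnm_of_mon (top d l)) *: (b l : {mpoly k[n]}).
  rewrite -(to_hpolyK hp); set p' := to_hpoly d p.
  have <- : ((\sum_l (p' : {mpoly k[n]})@_(mnm_of_mon (top d l)) *: b l : hpoly n k
    d) : {mpoly k[n]})
    = \sum_l (p' : {mpoly k[n]})@_(mnm_of_mon (top d l)) *: (b l : {mpoly k[n]}) by
      rewrite hpoly_sum.
  congr mpoly_of_hpoly; apply/eqP; rewrite -subr_eq0; apply/eqP.
  apply: (plucker_coef_inj dJ nzJ).
    apply: memvB; first by apply/(mem_gpiece iJ); rewrite to_hpolyK.
    by apply: memv_suml => l _; apply: memvZ; apply/(mem_gpiece iJ); have [] := Eb l.
  move=> j; rewrite -[X in (_ + X)]scaleN1r hpolyD hpolyZ mcoeffD mcoeffZ hpoly_sum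
    linear_sum.
  rewrite (bigD1 j) //= big1 ?addr0 => [|l lj].
    by rewrite mcoeffZ; have [_ _ ->] := Eb j; rewrite eqxx mulr1 mulN1r subrr.
  by rewrite mcoeffZ; have [_ _ ->] := Eb l; rewrite eq_sym (negPf lj) mulr0.
by apply: ideal_sum => // l _; apply: ideal_scale => //; have [] := Eb l.
Qed.

Hypothesis generated : forall m, I 'X_[m] ->
  exists m', [/\ (m' <= m)%MM, I 'X_[m'] & (mdeg m' <= D)%N].

(** Degrees at most D contain the generators of u I, so agreement there gives u I inside J; equality
    of Hilbert functions does the rest in all degrees. *)
Lemma chart_closure_orbit : GL_orbit I J.
Proof.
have [u Uu sub] := chart_closure_subset; have UU := strictly_unipotent_unit Uu.
exists u => //; have iuI := is_ideal_image UU iI.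
have iJ : is_ideal J := graded_ideal_is_ideal cJ.1.1.
have hJu d : hilbert J d = hilbert (lin_subst u @` I) d by rewrite hilbert_image //;
  exact: cJ.1.2.
have uJ p : (lin_subst u @` I) p -> J p.
  move=> [q Iq <-]; rewrite (mpolyE q) lin_subst_sum big_seq; apply: ideal_sum => // m mq.
  rewrite lin_substZ; apply: ideal_scale => //.
  have [m' [le Im' dm']] := generated (monomial_ideal_supp monI Iq mq).
  rewrite -(submK le) mpolyXD lin_substM; case: (iJ) => _ _; apply.
  apply: (gpiece_eq_of_subset iJ iuI (d := mdeg m')) => // [r hr|].
  - exact: (sub (mdeg m')).
  - exact: lin_subst_dhomogX.
rewrite eqEsubset; split=> [p /uJ //|].
apply: (graded_ideal_subset cJ.1.1 iuI) => d.
by apply: (gpiece_eq_of_subset iuI iJ) => // p _; exact: uJ.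
Qed.

End OrbitChart.

(** * Dickson's lemma and conclusion *)

Section Dickson.

(** [h N] is the index of a minimum of f from N on; the subsequence takes such minima
    successively. *)
Lemma nondecreasing_subsequence (f : nat -> nat) : exists g : nat -> nat,
  {homo g : i j / (i < j)%N} /\ {homo f \o g : i j / (i <= j)%N}.
Proof.
have /choice[h Eh] : forall N, exists i, (N <= i)%N /\ forall j, (N <= j)%N ->
  (f i <= f j)%N.
  move=> N; pose P v := `[< exists2 i, (N <= i)%N & f i = v >].
  have exP : exists v, P v by exists (f N); apply/asboolP; exists N.
  case: (ex_minnP exP) => _ /asboolP[i Ni <-] minv; exists i; split=> // j Nj.
  by apply: minv; apply/asboolP; exists j.
pose g := fix g i := if i is i'.+1 then h (g i').+1 else h 0%N.
exists g; split.
  by apply: homo_ltn => [|i]; [exact: ltn_trans|exact: (Eh (g i).+1).1].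
apply: homo_leq => [//||i]; first exact: leq_trans.
have le : (g i <= g i.+1)%N by apply: ltnW; exact: (Eh (g i).+1).1.
case: i le => [|i] le; first by apply: (Eh 0%N).2.
by apply: (Eh (g i).+1).2; apply: leq_trans le; exact: (Eh (g i).+1).1.
Qed.

Lemma nondecreasing_mnm_subsequence n (f : nat -> 'X_{1..n}) : exists g : nat -> nat,
  {homo g : i j / (i < j)%N} /\ forall i j, (i <= j)%N -> (f (g i) <= f (g j))%MM.
Proof.
suff [g [g_incr fg]] : exists g : nat -> nat, {homo g : i j / (i < j)%N} /\
    forall l, l \in enum 'I_n -> forall i j, (i <= j)%N -> (f (g i) l <= f (g j) l)%N.
  by exists g; split=> // i j ij; apply/mnm_lepP => l; apply: fg; rewrite ?mem_enum.
elim: (enum 'I_n) => [|l s [g [g_incr fg]]]; first by exists id; split.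
have [g' [g'_incr fg']] := nondecreasing_subsequence (fun i => f (g i) l).
exists (g \o g'); split=> [i j /g'_incr/g_incr //|c];
  rewrite inE => /orP[/eqP ->|cs] i j ij.
  exact: fg'.
by apply: fg => //; exact: ltnW_homo ij.
Qed.

Lemma dickson n (E : set 'X_{1..n}) : exists D, forall m, E m ->
  exists m', [/\ (m' <= m)%MM, E m' & (mdeg m' <= D)%N].
Proof.
apply: contrapT => /forallNP no.
have /choice[F EF] : forall D, exists m, E m /\ forall m', E m' -> (m' <= m)%MM ->
  (D < mdeg m')%N.
  move=> D; have /existsNP[m /not_implyP[Em nm]] := no D; exists m; split=> // m' Em' le.
  by rewrite ltnNge; apply/negP => dm'; apply: nm; exists m'.
have [g [g_incr Fg]] := nondecreasing_mnm_subsequence F.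
have ge j : (j <= g j)%N.
  by elim: j => // j IH; apply: leq_ltn_trans IH (g_incr _ _ _).
(* F (g 0) divides F (g j) and has degree j <= g j, against the choice of F (g j). *)
pose j := mdeg (F (g 0%N)).
have := (EF (g j)).2 _ (EF (g 0%N)).1 (Fg _ _ (leq0n j)).
by rewrite ltnNge ge.
Qed.

End Dickson.

Section Final.
Variables (n : nat) (k : fieldType) (char0 : [pchar k] =i pred0).
Variables (I : set {mpoly k[n]}) (monI : monomial_ideal I).

Lemma exists_top : exists top : forall d, {ffun 'I_(hilbert I d) -> mon n d},
  [/\ forall d, injective (top d), forall d i, I 'X_[mnm_of_mon (top d i)] &
      forall d (m : mon n d), I 'X_[mnm_of_mon m] -> exists i, m = top d i].
Proof.
have [uI EI] := monomial_idealE monI.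
have hI d : hilbert I d = #|mons (exponents I) d| by rewrite {1}EI hilbert_mon_ideal.
exists (fun d => [ffun i => enum_val (cast_ord (hI d) i)]); split=> [d i j|d i|d m Im].
- by rewrite !ffunE => /enum_val_inj/cast_ord_inj.
- by rewrite ffunE; have := enum_valP (cast_ord (hI d) i); rewrite inE => /asboolP.
- have mI : m \in mons (exponents I) d by rewrite inE; apply/asboolP.
  exists (cast_ord (esym (hI d)) (enum_rank_in mI m)).
  by rewrite ffunE cast_ordKV enum_rankK_in.
Qed.

Lemma total_orbit_closed : total_preorder (ideal_le I) ->
  exists D0, forall D, (D0 <= D)%N ->
  forall J, in_orbit_closure I D J -> GL_orbit I J.
Proof.
move=> [le_refl le_trans le_total]; have gI := monomial_ideal_graded monI.
have [D1 gen] := dickson (exponents I).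
have /choice[t Et] : forall ij : 'I_n * 'I_n, exists m : 'X_{1..n},
  ~ ideal_le I ij.2 ij.1 ->
    I 'X_[m + U_(ij.2)] /\ ~ I 'X_[m + U_(ij.1)].
  move=> [i j] /=; case: (pselect (ideal_le I j i)) =>
    [ji|/existsNP[m /not_implyP[Ij nIi]]].
    by exists 0%MM.
  by exists m => _; rewrite addmC [(m + U_(i))%MM]addmC !mpolyXD.
(* The bound covers the generators of I and, strictly, the degree of one test monomial for each pair
   of variables. *)
exists (D1 + \sum_ij (mdeg (t ij)).+1)%N => D leD J IJ.
have [top [top_inj topI top_onto]] := exists_top.
pose down (i : 'I_n) : {set 'I_n} := [set l : 'I_n | `[< ideal_le I l i >]]%SET.
have downS i j : ideal_le I i j -> down i \subset down j.
  by move=> ij; apply/fintype.subsetP => l; rewrite !inE => li; exact: le_trans li ij.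
(* For a total preorder, counting the variables below each variable gives a faithful numbering, with
   equal values exactly on equivalent variables. *)
pose rho i := #|down i|.
have rho_le i j : (rho i <= rho j)%N -> ideal_le I i j.
  move=> le; case: (le_total i j) => // ji; apply: contrapT => nij.
  suff : (rho j < rho i)%N by rewrite ltnNge le.
  apply: proper_card; apply/properP; split; first exact: downS.
  by exists i; rewrite inE; [apply: asboolT; exact: le_refl|exact/asboolPn].
have test i j : (rho i < rho j)%N ->
  exists m, [/\ (mdeg m < D)%N, I 'X_[m + U_(j)] & ~ I 'X_[m + U_(i)]].
  move=> lt; have [|Ij nIi] := Et (i, j).
    by move=> /downS/subset_leq_card; rewrite leqNgt -/(rho _) -/(rho _) lt.
  exists (t (i, j)); split=> //; apply: leq_trans leD.
  by rewrite (bigD1 (i, j)) //= addnCA leq_addr.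
have generated m : I 'X_[m] -> exists m', [/\ (m' <= m)%MM, I 'X_[m'] & (mdeg m' <= D)%N].
  move=> /gen[m' [le Im' dm']]; exists m'; split=> //.
  by apply: leq_trans dm' (leq_trans (leq_addr _ _) leD).
have [g Ug cgJ] := generic_position char0 monI top_inj topI IJ.
have IgJ := in_orbit_closure_act gI Ug IJ.
have orb : GL_orbit I (lin_subst g @` J).
  exact: (chart_closure_orbit char0 monI top_inj topI top_onto rho_le IgJ (conj IgJ.1
    cgJ) test generated).
apply: (GL_orbit_trans orb); exists (invmx g); first by rewrite /= unitmx_inv.
rewrite eqEsubset; split=> [_ [_ [p Jp <-] <-]|p Jp]; first by rewrite lin_substK.
by exists (lin_subst g p); [exists p|rewrite lin_substK].
Qed.

End Final.

Theorem theorem7p4 (k : fieldType) (char0 : [pchar k] =i pred0) (n : nat)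
    (I : set {mpoly k[n]}) (monI : monomial_ideal I) :
  most_degenerate I <-> total_preorder (ideal_le I).
Proof.
have gI := monomial_ideal_graded monI; split=> [[D closed]|/(total_orbit_closed char0 monI)[D closed]].
  apply: (closed_orbit_total char0 monI (D := D)).
  exact/(orbit_closed_atP D gI)/closed.
by exists D => D' /closed/(orbit_closed_atP D' gI).
Qed.
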